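(* Let $C\subset\mathbb{P}^2$ be a rational curve of degree $n$ given by a proper parameterization, viewed as the projection $\pi|_{C_n}:C_n\to C$ of the rational normal curve $C_n\subset\mathbb{P}^n$, and let $P\in C$ be a double point (singular point of multiplicity $2$) of $C$. Let $m\ge1$. Then: (1) $P$ is an $A_{2m-1}$ singularity if and only if (a) $\pi^{-1}(P)=Q_1\cup Q_2\subset C_n$ (two distinct points), (b) $\pi(mQ_1|_{C_n}\cup mQ_2|_{C_n})=X$, where $X$ is a curvilinear scheme of length $m$ contained in $C$, (c) $m$ is the maximum integer for which (b) holds. (2) $P$ is an $A_{2m}$ singularity if and only if (a) $\pi^{-1}(P)=Q\in C_n$ (a single point), (b) $\pi(2mQ|_{C_n})=X$, where $X$ is a curvilinear scheme of length $m$ contained in $C$, (c) $m$ is the maximum integer for which (b) holds.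
   Context: $K$ is an algebraically closed field of characteristic $0$, $\mathbb{P}^m=\mathbb{P}^m_K$, $n\ge3$. $C\subset\mathbb{P}^2$ is the image of $\mathbf f=(f_0:f_1:f_2)$, $f_u=\sum_{j=0}^n a_{uj}s^{n-j}t^j\in K[s,t]_n$; proper means that $\mathbf f$ is generically $1:1$ onto $C$ and the $f_u$ have no common zeroes. $C_n=\nu_n(\mathbb{P}^1)\subset\mathbb{P}^n$ with $\nu_n(s:t)=(s^n:s^{n-1}t:\dots:t^n)$, and $\pi:\mathbb{P}^n\dashrightarrow\mathbb{P}^2$ is the projection $\pi(z_0:\dots:z_n)=(\sum_j a_{0j}z_j:\sum_j a_{1j}z_j:\sum_j a_{2j}z_j)$, so that its center does not meet $C_n$ and $\pi\circ\nu_n=\mathbf f$, $\pi(C_n)=C$. Here $\pi^{-1}(P)$ means the set of points of $C_n$ mapped to $P$, and $\pi$ of a subscheme of $C_n$ is its scheme-theoretic image. For $m\ge1$, an $A_{2m-1}$ (resp. $A_{2m}$) singularity is a double point which is two-branched (resp. a cusp, i.e. unibranch) and which needs $m$ successive blow-ups before the singularity disappears ($A_1$ is an ordinary node, $A_2$ a simple cusp, $A_3$ a tacnode). Every double point is of exactly one of these types. A $0$-dimensional scheme $X$ supported at one point $P$ is curvilinear if it is contained in a reduced curve $\Gamma$ which is smooth at $P=\operatorname{Supp}(X)$. For a smooth point $R$ on a curve $D\subset\mathbb{P}^n$, $sR|_D$ denotes the curvilinear subscheme of $D$ supported at $R$ of length $s$, i.e. the scheme defined by the ideal $I_D+(I_R)^s$.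 *)

(* Defs.v *)
From HB Require Import structures.
From mathcomp Require Import all_boot all_order all_algebra.
From mathcomp Require Import mpoly.

Set Implicit Arguments.
Unset Strict Implicit.
Unset Printing Implicit Defensive.

Import GRing.Theory.
Local Open Scope ring_scope.

(* A point of P^N is given by a nonzero row vector in 'rV[K]_(N.+1), up to
   proj_eq; a subset of P^N is a predicate on vectors, relevant only on the
   nonzero ones and stable under proj_eq.  A closed subscheme of P^N is given
   by a homogeneous ideal of {mpoly K[N.+1]} (as a predicate), two ideals
   defining the same scheme when they have the same saturation. *)
Section Schemes.
Variables (K : closedFieldType) (N : nat).
Implicit Types (v w : 'rV[K]_N) (V : 'rV[K]_N -> Prop).
Implicit Types (G H : {mpoly K[N]}) (I J : {mpoly K[N]} -> Prop).

Definition proj_eq v w : Prop := exists2 c : K, c != 0 & w = c *: v.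

Definition eval_at G v : K := G.@[fun i => v 0 i].

(* Since K is infinite and V is stable under scaling, the homogeneous
   components of a member are again members. *)
Definition vanishing_ideal V : {mpoly K[N]} -> Prop :=
  fun G => forall v, v != 0 -> V v -> eval_at G v = 0.

Definition point_ideal v : {mpoly K[N]} -> Prop := vanishing_ideal (proj_eq v).

Definition principal_ideal H : {mpoly K[N]} -> Prop :=
  fun G => exists A, G = A * H.

Definition ideal_add I J : {mpoly K[N]} -> Prop :=
  fun G => exists A B, [/\ I A, J B & G = A + B].

Definition ideal_cap I J : {mpoly K[N]} -> Prop := fun G => I G /\ J G.

Definition ideal_pow I (s : nat) : {mpoly K[N]} -> Prop :=
  fun G => exists (k : nat) (c : 'I_k -> {mpoly K[N]})
                  (g : 'I_k -> 'I_s -> {mpoly K[N]}),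
    (forall i j, I (g i j)) /\ G = \sum_(i < k) c i * \prod_(j < s) g i j.

Definition saturation I : {mpoly K[N]} -> Prop :=
  fun G => exists k : nat, forall i : 'I_N, I ('X_i ^+ k * G).

Definition subscheme I J : Prop :=
  forall G, saturation J G -> saturation I G.

Definition supported_at I v : Prop :=
  forall w, w != 0 -> ((forall G, I G -> eval_at G w = 0) <-> proj_eq v w).

(* The Hilbert function of the coordinate ring is l in every large degree d:
   the forms of degree d modulo those of the ideal have a basis of size l. *)
Definition scheme_length I (l : nat) : Prop :=
  exists d0 : nat, forall d : nat, (d0 <= d)%N ->
    exists2 b : 'I_l -> {mpoly K[N]}, (forall i, b i \is d.-homog) &
      forall G, G \is d.-homog ->
        exists! c : 'rV[K]_l, saturation I (G - \sum_(i < l) c 0 i *: b i).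

(* s R|_D, where R is the point v: the scheme of I_D + (I_R)^s. *)
Definition fat_point (s : nat) v (D : 'rV[K]_N -> Prop) :
    {mpoly K[N]} -> Prop :=
  saturation (ideal_add (vanishing_ideal D) (ideal_pow (point_ideal v) s)).

Definition squarefree_form H : Prop :=
  forall A B, H = A * A * B -> (msize A <= 1)%N.

End Schemes.

(* Reduced curves in P^2 are given by squarefree forms H. *)
Definition curvilinear (K : closedFieldType) (I : {mpoly K[3]} -> Prop) : Prop :=
  exists P : 'rV[K]_3, [/\ P != 0, supported_at I P &
    exists (d : nat) (H : {mpoly K[3]}),
      [/\ H \is d.-homog, squarefree_form H,
          subscheme I (principal_ideal H) &
          exists u : 'I_3, eval_at (H^`M(u)) P != 0]].

Section Parameterization.
Variables (K : closedFieldType) (n : nat) (a : 'M[K]_(3, n.+1)).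

Definition param (q : 'rV[K]_2) : 'rV[K]_3 :=
  \row_u \sum_(j < n.+1) a u j * q 0 0 ^+ (n - j) * q 0 1 ^+ j.

Definition veronese (q : 'rV[K]_2) : 'rV[K]_(n.+1) :=
  \row_(j < n.+1) (q 0 0 ^+ (n - j) * q 0 1 ^+ j).

Definition proj_map (z : 'rV[K]_(n.+1)) : 'rV[K]_3 :=
  \row_u \sum_(j < n.+1) a u j * z 0 j.

Definition on_curve (v : 'rV[K]_3) : Prop :=
  exists2 q : 'rV[K]_2, q != 0 & proj_eq (param q) v.

Definition on_rnc (z : 'rV[K]_(n.+1)) : Prop :=
  exists2 q : 'rV[K]_2, q != 0 & proj_eq (veronese q) z.

(* The second conjunct is generic injectivity: away from finitely many
   points S of the plane, the fibres have at most one point. *)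
Definition proper_param : Prop :=
  (forall q : 'rV[K]_2, q != 0 -> param q != 0) /\
  (exists S : seq 'rV[K]_3, forall q r : 'rV[K]_2, q != 0 -> r != 0 ->
     (forall v, v \in S -> ~ proj_eq v (param q)) ->
     proj_eq (param q) (param r) -> proj_eq q r).

(* F is a form of degree n generating the homogeneous ideal of C. *)
Definition curve_equation (F : {mpoly K[3]}) : Prop :=
  F \is n.-homog /\
  forall G, vanishing_ideal on_curve G <-> principal_ideal F G.

Definition in_fibre (P : 'rV[K]_3) (z : 'rV[K]_(n.+1)) : Prop :=
  [/\ z != 0, on_rnc z & proj_eq P (proj_map z)].

(* Scheme-theoretic image of a scheme disjoint from the centre of the
   projection: the kernel of the pull-back of forms. *)
Definition scheme_image (I : {mpoly K[n.+1]} -> Prop) : {mpoly K[3]} -> Prop :=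
  fun G => saturation I
    (G \mPo [tuple \sum_(j < n.+1) a u j *: 'X_j | u < 3]).

Definition curvilinear_on_curve (X : {mpoly K[3]} -> Prop) (l : nat) : Prop :=
  [/\ curvilinear X, scheme_length X l &
      subscheme X (vanishing_ideal on_curve)].

End Parameterization.

(* Formal power series in two variables: g i j is the coefficient of x^i y^j,
   and equality is =2. *)
Section PowerSeries.
Variable K : closedFieldType.
Definition ps2 := nat -> nat -> K.
Implicit Types a b c : ps2.

Definition ps_one : ps2 := fun i j => ((i == 0%N) && (j == 0%N))%:R.

Definition ps_mul a b : ps2 := fun i j =>
  \sum_(k < i.+1) \sum_(l < j.+1) a k l * b (i - k)%N (j - l)%N.

Definition ps_of_mpoly (g : {mpoly K[2]}) : ps2 :=
  fun i j => g@_[multinom [tuple i; j]].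

Definition ps_unit a : Prop := exists b, ps_mul a b =2 ps_one.

Definition ps_dvd a b : Prop := exists c, ps_mul a c =2 b.

Definition ps_irreducible a : Prop :=
  ~ ps_unit a /\ forall b c, ps_mul b c =2 a -> ps_unit b \/ ps_unit c.

Definition ps_assoc a b : Prop := exists2 u, ps_unit u & ps_mul u a =2 b.

(* Branches at the origin are the irreducible factors in K[[x,y]], up to
   units. *)
Definition has_branches (r : nat) (g : {mpoly K[2]}) : Prop :=
  exists b : 'I_r -> ps2,
    [/\ forall i, ps_irreducible (b i) /\ ps_dvd (b i) (ps_of_mpoly g),
        forall i j, i != j -> ~ ps_assoc (b i) (b j) &
        forall c, ps_irreducible c -> ps_dvd c (ps_of_mpoly g) ->
          exists i, ps_assoc c (b i)].
End PowerSeries.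

(* A plane curve germ is an affine equation g in {mpoly K[2]}, considered at
   the origin, with coordinates x = 'X_0 and y = 'X_1. *)
Section Germs.
Variable K : closedFieldType.
Implicit Types g h : {mpoly K[2]}.
Local Notation x := ('X_(0 : 'I_2) : {mpoly K[2]}).
Local Notation y := ('X_(1 : 'I_2) : {mpoly K[2]}).

Definition has_mult (k : nat) g : Prop :=
  (forall mon, mon \in msupp g -> (k <= mdeg mon)%N) /\
  (exists2 mon, mon \in msupp g & mdeg mon = k).

(* h is the germ of the strict transform of g, under the blow-up of the
   origin, at one of its points on the exceptional divisor: either (0, c) in
   the chart (x, xy), or the origin of the chart (xy, y). *)
Definition blowup_germ g h : Prop :=
  exists k : nat, [/\ has_mult k g, h@_0%MM = 0 &
    (exists c : K, g \mPo [tuple x; x * (y + c%:MP)] = x ^+ k * h)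
    \/ g \mPo [tuple x * y; y] = y ^+ k * h].

Fixpoint smooth_after (m : nat) g : Prop :=
  match m with
  | 0 => has_mult 1 g
  | m'.+1 => forall h, blowup_germ g h -> smooth_after m' h
  end.

Definition needs_blowups (m : nat) g : Prop :=
  smooth_after m g /\ forall k, (k < m)%N -> ~ smooth_after k g.

End Germs.

Section DoublePoints.
Variables (K : closedFieldType) (F : {mpoly K[3]}) (P : 'rV[K]_3).

Definition chart : 'I_3 := odflt 0 [pick i | P 0 i != 0].

(* The equation of the curve F = 0 in the affine chart where the coordinate
   of index chart equals 1, translated so that P becomes the origin. *)
Definition germ_at : {mpoly K[2]} :=
  F \mPo [tuple if unlift chart u is Some j
                then 'X_j + (P 0 u / P 0 chart)%:MP else 1 | u < 3].

Definition double_point : Prop := has_mult 2 germ_at.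

(* Singularities of type A_(2m-1), resp. A_(2m), for m >= 1. *)
Definition sing_A_odd (m : nat) : Prop :=
  [/\ double_point, has_branches 2 germ_at & needs_blowups m germ_at].

Definition sing_A_even (m : nat) : Prop :=
  [/\ double_point, has_branches 1 germ_at & needs_blowups m germ_at].
End DoublePoints.

(* Main.v *)
Require Import Defs.
From HB Require Import structures.
From mathcomp Require Import all_boot all_order all_algebra separable.
From mathcomp Require Import boolp.
From mathcomp Require Import mpoly ring zify.
Import GRing.Theory.
Local Open Scope ring_scope.

(* Near the fibre over P the affine coordinates at P pull back to rational
   functions x, y of one variable t, and the fibre is the zero scheme of
   W = gcd of the two numerators.  It has length exactly 2: a general line
   through P meets the curve in n - deg W distinct further points, and there are
   at most n - 2 of them, so deg W >= 2; since modulo higher order terms y^2 is a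
   combination of x^2 and xy (after a shear), the forms of a given degree span at
   most 2k dimensions modulo W^k, whereas a dimension count for forms modulo the
   equation of the curve gives deg W * k - O(1), so deg W <= 2.

   Write W = (t - tau1) (t - tau2).  Say that there is contact of order k if
   y = q(x) modulo W^k, or x = q(y) modulo W^k, for a polynomial q with q(0) = 0,
   i.e. if a smooth arc approximates the branches to order k; the same dimension
   count shows that the order of contact is finite.  Everything is governed by
   its maximal value m:
   - a blow-up replaces y by y/x - c and lowers the order of contact by one, so
     the germ becomes smooth after exactly m blow-ups;
   - the image of the scheme W^k = 0 is cut out by the forms whose pull-back is
     divisible by W^k; it lies on a smooth arc, and then has length k with basis
     1, x, ..., x^(k-1), exactly when there is contact of order k;
   - the germ has one branch if tau1 = tau2 and two otherwise, by dividing in the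
     ring of formal power series by the equation y - gam(x) of a smooth branch. *)

Set Implicit Arguments.
Unset Strict Implicit.
Unset Printing Implicit Defensive.

(** * Evaluation of polynomials *)

(** Powers of [W] in one semilocal ring treat both types of singularity together: divisibility by
    [W ^+ k] means order [k] at each of two points or order [2 * k] at one, which is why $kQ_1\cup
    kQ_2$ and $2kQ$ lead to the same condition. The points are separated only to count branches. The
    obstacle is that [W] does not generate the radical when it has a double root, so membership in
    the radical must be improved to divisibility by [W]. The point at infinity of the parameter line
    is chosen off the fibre, so that polynomials in one variable suffice. Characteristic 0 enters
    through the Wronskian, which makes the residual intersections with a general line simple.
    Contact allows both [y = q(x)] and [x = q(y)] since the common tangent may be either axis;
    exchanging the coordinates reduces one form to the other and the second blow-up chart to the
    first. Finiteness of contact acts twice: it keeps the strict transform singular while contact of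
    order 2 persists, and it forbids a smooth series that vanishes at the whole fibre. *)

Section Evaluation.
Variables (K : fieldType).

Lemma mpoly_rmorph_ext (N : nat) (R : comNzRingType)
    (f g : {rmorphism {mpoly K[N]} -> R}) :
  (forall c, f c%:MP = g c%:MP) -> (forall i, f 'X_i = g 'X_i) -> f =1 g.
Proof.
move=> hC hX p; elim/mpolyind: p => [|c m p _ _ IH]; first by rewrite !rmorph0.
rewrite !rmorphD IH -!mul_mpolyC !rmorphM hC; congr (_ * _ + _).
by rewrite mpolyXE_id !rmorph_prod; apply: eq_bigr => i _; rewrite !rmorphXn hX.
Qed.

Lemma mmap_ext (N : nat) (R : comNzRingType) (f : {rmorphism K -> R})
    (u v : 'I_N -> R) : u =1 v -> mmap f u =1 mmap f v.
Proof.
move=> uv; apply: (mpoly_rmorph_ext (f := mmap f u) (g := mmap f v)).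
  by move=> c; rewrite /= !mmapC.
by move=> i; rewrite /= !mmapX !mmap1U.
Qed.

Lemma mmap_ext2 (N : nat) (R : comNzRingType) (f g : {rmorphism K -> R})
    (u v : 'I_N -> R) : f =1 g -> u =1 v -> mmap f u =1 mmap g v.
Proof.
move=> fg uv; apply: (mpoly_rmorph_ext (f := mmap f u) (g := mmap g v)).
  by move=> c; rewrite /= !mmapC; apply: fg.
by move=> i; rewrite /= !mmapX !mmap1U; apply: uv.
Qed.

Lemma mmap_comp (N M : nat) (R : comNzRingType) (f : {rmorphism K -> R})
    (v : 'I_M -> R) (t : N.-tuple {mpoly K[M]}) (p : {mpoly K[N]}) :
  mmap f v (p \mPo t) = mmap f (fun i => mmap f v (tnth t i)) p.
Proof.
apply: (mpoly_rmorph_ext (f := mmap f v \o comp_mpoly t) (g := mmap f _) _ _ p).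
  by move=> c; rewrite /= comp_mpolyC !mmapC.
by move=> i; rewrite /= comp_mpolyXU -tnth_nth !mmapX mmap1U.
Qed.

Lemma rmorph_mmap (N : nat) (R S : comNzRingType) (f : {rmorphism K -> R})
    (h : {rmorphism R -> S}) (v : 'I_N -> R) (p : {mpoly K[N]}) :
  h (mmap f v p) = mmap (h \o f) (h \o v) p.
Proof.
apply: (mpoly_rmorph_ext (f := h \o mmap f v) (g := mmap (h \o f) (h \o v)) _ _ p).
  by move=> c; rewrite /= !mmapC.
by move=> i; rewrite /= !mmapX !mmap1U.
Qed.

Lemma mmap_homog (N d : nat) (R : comNzRingType) (f : {rmorphism K -> R})
    (v : 'I_N -> R) (c : R) (p : {mpoly K[N]}) : p \is d.-homog ->
  mmap f (fun i => c * v i) p = c ^+ d * mmap f v p.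
Proof.
move=> /dhomogP hp; rewrite /mmap mulr_sumr; apply: eq_big_seq => m /hp hm.
have {}hm : mdeg m = d := hm.
rewrite mulrCA; congr (_ * _); rewrite /mmap1 -hm mdegE.
by rewrite expr_sum -big_split; apply: eq_bigr => i _; rewrite exprMn.
Qed.

End Evaluation.

Lemma ord2P (i : 'I_2) : i = 0 \/ i = 1.
Proof. by case: i => [[|[|[]]]] //= hi; [left|right]; apply/val_inj. Qed.

(** * Polynomials in two variables through their coefficients of degree at most 2 *)

Section Plane.
Variable K : closedFieldType.
Implicit Types g h A B D : {mpoly K[2]}.
Local Notation X0 := ('X_(0 : 'I_2) : {mpoly K[2]}).
Local Notation X1 := ('X_(1 : 'I_2) : {mpoly K[2]}).

Definition mon2 (i j : nat) : 'X_{1..2} := [multinom [tuple i; j]].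

Lemma mon2E i j k : mon2 i j k = if k == 0 then i else j.
Proof. by rewrite multinomE (tnth_nth 0%N); case: k => [[|[|[]]]]. Qed.

Lemma mon2P (m : 'X_{1..2}) : m = mon2 (m 0%R) (m 1%R).
Proof.
by apply/mnmP => k; rewrite mon2E; case: k => [[|[|[]]]] //= hk;
  congr (m _); apply/val_inj.
Qed.

Lemma mdeg_mon2 i j : mdeg (mon2 i j) = (i + j)%N.
Proof. by rewrite mdegE !big_ord_recl big_ord0 !mon2E addn0. Qed.

Lemma mon2D i j k l : (mon2 i j + mon2 k l)%MM = mon2 (i + k) (j + l).
Proof. by apply/mnmP => u; rewrite mnmDE !mon2E; case: ifP. Qed.

Lemma mon2_inj i j k l : mon2 i j = mon2 k l -> i = k /\ j = l.
Proof.
by move/mnmP => h; have := h 0; have := h 1; rewrite !mon2E.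
Qed.

Lemma mon2_eq i j k l : (mon2 i j == mon2 k l) = (i == k) && (j == l).
Proof.
apply/eqP/andP => [/mon2_inj[-> ->]//|]; by case=> /eqP-> /eqP->.
Qed.

Lemma mon2_U0 : U_(0%R)%MM = mon2 1 0.
Proof. by apply/mnmP => k; rewrite mon2E mnm1E; case: k => [[|[|[]]]]. Qed.
Lemma mon2_U1 : U_(1%R)%MM = mon2 0 1.
Proof. by apply/mnmP => k; rewrite mon2E mnm1E; case: k => [[|[|[]]]]. Qed.
Lemma mon2_0 : 0%MM = mon2 0 0.
Proof. by apply/mnmP => k; rewrite mon2E mnm0E; case: k => [[|[|[]]]]. Qed.

Lemma mpolyX_mon2 i j : 'X_[mon2 i j] = X0 ^+ i * X1 ^+ j.
Proof. by rewrite mpolyXE_id !big_ord_recl big_ord0 !mon2E mulr1. Qed.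

Lemma mcoeffM_mon2 g i j k l :
  (g * 'X_[mon2 i j])@_(mon2 k l) =
  if (i <= k)%N && (j <= l)%N then g@_(mon2 (k - i) (l - j)) else 0.
Proof.
case: ifP => [/andP[ik jl]|].
  by rewrite -{1}(subnKC ik) -{1}(subnKC jl) -mon2D mcoeffMX.
apply: contraFeq; rewrite -mcoeff_msupp (perm_mem (msuppMX _ _)).
case/mapP => m _; rewrite [m]mon2P mon2D => /mon2_inj[-> ->].
by rewrite !leq_addr.
Qed.

Lemma hadamard g : exists A B, g = (g@_(mon2 0 0))%:MP + X0 * A + X1 * B.
Proof.
elim/mpolyind: g => [|c m p _ _ [A [B IH]]].
  by exists 0, 0; rewrite !mulr0 mcoeff0 mpolyC0 !addr0.
rewrite mcoeffD mcoeffZ mcoeffX mpolyCD {1}IH [m]mon2P.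
case: (m 0%R) => [|i]; last first.
  exists (A + c *: 'X_[mon2 i (m 1%R)]), B.
  rewrite mon2_eq /= mulr0 mpolyC0 -!mul_mpolyC !mpolyX_mon2 exprS; ring.
case: (m 1%R) => [|j]; last first.
  exists A, (B + c *: 'X_[mon2 0 j]).
  rewrite mon2_eq /= mulr0 mpolyC0 -!mul_mpolyC !mpolyX_mon2 exprS; ring.
exists A, B; rewrite mon2_eq /= mulr1 -!mul_mpolyC !mpolyX_mon2; ring.
Qed.

Lemma taylor2 g : exists A B D,
  g = (g@_(mon2 0 0))%:MP + (g@_(mon2 1 0)) *: X0 + (g@_(mon2 0 1)) *: X1
      + X0 ^+ 2 * A + X0 * X1 * B + X1 ^+ 2 * D.
Proof.
have [A [B e]] := hadamard g; have [A1 [A2 eA]] := hadamard A.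
have [B1 [B2 eB]] := hadamard B.
have X10 : X0 = 'X_[mon2 1 0] by rewrite mon2_U0.
have X01 : X1 = 'X_[mon2 0 1] by rewrite mon2_U1.
have -> : g@_(mon2 1 0) = A@_(mon2 0 0).
  rewrite e !mcoeffD mcoeffC mon2_0 mon2_eq mulr0 X10 X01 add0r.
  by rewrite mulrC mcoeffM_mon2 mulrC mcoeffM_mon2 addr0.
have -> : g@_(mon2 0 1) = B@_(mon2 0 0).
  rewrite e !mcoeffD mcoeffC mon2_0 mon2_eq mulr0 X10 X01 add0r.
  by rewrite mulrC mcoeffM_mon2 mulrC mcoeffM_mon2 add0r.
exists A1, (A2 + B1), B2.
by rewrite {1}e {1}eA {1}eB -!mul_mpolyC; ring.
Qed.

Lemma coef2 A B D : let g := X0 ^+ 2 * A + X0 * X1 * B + X1 ^+ 2 * D in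
  [/\ g@_(mon2 0 0) = 0, g@_(mon2 1 0) = 0 & g@_(mon2 0 1) = 0] /\
  [/\ g@_(mon2 2 0) = A@_(mon2 0 0), g@_(mon2 1 1) = B@_(mon2 0 0)
    & g@_(mon2 0 2) = D@_(mon2 0 0)].
Proof.
have e20 : X0 ^+ 2 = 'X_[mon2 2 0] by rewrite mpolyX_mon2 mulr1.
have e11 : X0 * X1 = 'X_[mon2 1 1] by rewrite mpolyX_mon2.
have e02 : X1 ^+ 2 = 'X_[mon2 0 2] by rewrite mpolyX_mon2 mul1r.
rewrite /= !mcoeffD e20 e11 e02 ![_ * A]mulrC ![_ * B]mulrC ![_ * D]mulrC.
by rewrite !mcoeffM_mon2 /= !addr0 ?add0r.
Qed.

Lemma mdeg2_cases (m : 'X_{1..2}) : mdeg m = 2%N ->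
  [\/ m = mon2 2 0, m = mon2 1 1 | m = mon2 0 2].
Proof.
rewrite [m]mon2P mdeg_mon2; move: (m 0%R) (m 1%R) => i j.
case: i => [|[|[|i]]] h; last by [].
- by rewrite add0n in h; constructor 3; subst j.
- by rewrite add1n in h; case: h => h; constructor 2; subst j.
- by case: j h => // _; constructor 1.
Qed.

Lemma has_mult1P g : has_mult 1 g <->
  g@_(mon2 0 0) = 0 /\ (g@_(mon2 1 0) != 0 \/ g@_(mon2 0 1) != 0).
Proof.
split=> [[h1 [m]]|[g0 g1]].
  rewrite mcoeff_msupp => gm dm; split.
    apply/eqP; rewrite mcoeff_eq0; apply/negP => /h1.
    by rewrite mdeg_mon2.
  move: dm gm; rewrite [m]mon2P mdeg_mon2.
  by case: (m 0%R) => [|[|i]] //=; case: (m 1%R) => [|[|j]] // _ gm; [right|left].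
split.
  move=> m; rewrite mcoeff_msupp [m]mon2P mdeg_mon2.
  by case: (m 0%R) => [|i] //; case: (m 1%R) => [|j] //; rewrite g0 eqxx.
by case: g1 => h; [exists (mon2 1 0)|exists (mon2 0 1)];
  rewrite ?mcoeff_msupp ?mdeg_mon2.
Qed.

Lemma has_mult2P g : has_mult 2 g <-> exists A B D,
  g = X0 ^+ 2 * A + X0 * X1 * B + X1 ^+ 2 * D /\
  [\/ A@_(mon2 0 0) != 0, B@_(mon2 0 0) != 0 | D@_(mon2 0 0) != 0].
Proof.
split=> [[h1 [m]]|[A [B [D [e h]]]]].
  rewrite mcoeff_msupp => gm dm.
  have z i j : (i + j < 2)%N -> g@_(mon2 i j) = 0.
    move=> ij; apply/eqP; rewrite mcoeff_eq0; apply/negP => /h1.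
    by rewrite mdeg_mon2 leqNgt ij.
  have [A [B [D]]] := taylor2 g; rewrite !z // !scale0r mpolyC0 !add0r => e.
  exists A, B, D; split=> //.
  have [_ []] := coef2 A B D; rewrite -e => e1 e2 e3.
  by case: (mdeg2_cases dm) => em; move: gm; rewrite em ?e1 ?e2 ?e3 => gm;
    [constructor 1|constructor 2|constructor 3].
have [[z0 z1 z2] [e1 e2 e3]] := coef2 A B D; rewrite -e in z0 z1 z2 e1 e2 e3.
split=> [m|].
  rewrite mcoeff_msupp [m]mon2P mdeg_mon2.
  case: (m 0%R) => [|[|i]] //; case: (m 1%R) => [|[|j]] //;
  by rewrite ?z0 ?z1 ?z2 ?eqxx.
by case: h => h; [exists (mon2 2 0)|exists (mon2 1 1)|exists (mon2 0 2)];
  rewrite ?mdeg_mon2 ?mcoeff_msupp ?e1 ?e2 ?e3.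
Qed.

Lemma has_mult_uniq k l g : has_mult k g -> has_mult l g -> k = l.
Proof.
move=> [h1 [m gm dm]] [h2 [m' gm' dm']]; apply/eqP; rewrite eqn_leq.
by rewrite -{1}dm' -{2}dm (h1 _ gm') (h2 _ gm).
Qed.

(** Exchanging the coordinates turns the chart [(xy, y)] into [(x, xy)] and a graph over [y] into a
    graph over [x], so each argument is carried out for one of the two only. *)
Definition swap g : {mpoly K[2]} := g \mPo [tuple X1; X0].

Lemma swapX0 : swap X0 = X1. Proof. exact: comp_mpolyXU. Qed.
Lemma swapX1 : swap X1 = X0. Proof. exact: comp_mpolyXU. Qed.
Lemma swapM g h : swap (g * h) = swap g * swap h. Proof. exact: rmorphM. Qed.
Lemma swapD g h : swap (g + h) = swap g + swap h. Proof. exact: rmorphD. Qed.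
Lemma swapXn g k : swap (g ^+ k) = swap g ^+ k. Proof. exact: rmorphXn. Qed.

Lemma mcoeff_swap g i j : (swap g)@_(mon2 i j) = g@_(mon2 j i).
Proof.
elim/mpolyind: g => [|c m p _ _ IH]; first by rewrite /swap rmorph0 !mcoeff0.
rewrite swapD !mcoeffD IH /swap comp_mpolyZ !mcoeffZ; congr (c * _ + _).
rewrite [m]mon2P mpolyX_mon2 -/(swap _) swapM !swapXn swapX0 swapX1.
rewrite mulrC -!mpolyX_mon2 !mcoeffX !mon2_eq andbC; by [].
Qed.

Lemma swapK : involutive swap.
Proof.
by move=> g; apply/mpolyP => m; rewrite [m]mon2P !mcoeff_swap.
Qed.

Lemma has_mult_swap k g : has_mult k g -> has_mult k (swap g).
Proof.
have md (m : 'X_{1..2}) : mdeg m = mdeg (mon2 (m 1%R) (m 0%R)).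
  by rewrite [in LHS](mon2P m) !mdeg_mon2 addnC.
have ms (m : 'X_{1..2}) : (m \in msupp (swap g)) = (mon2 (m 1%R) (m 0%R) \in msupp g).
  by rewrite !mcoeff_msupp [in LHS](mon2P m) mcoeff_swap.
move=> [h1 [m gm dm]]; split=> [m'|]; first by rewrite ms md => /h1.
exists (mon2 (m 1%R) (m 0%R)); first by rewrite ms !mon2E /= -mon2P.
by rewrite -md.
Qed.

End Plane.

(** * The semilocal ring at the fibre, contact and blow-ups *)

Section LocalRing.
Variables (K : closedFieldType) (L : fieldType).
Variable phi : {rmorphism {poly K} -> L}.
Hypothesis phi_inj : injective phi.
Variable rs : seq K.

Definition root_poly : {poly K} := \prod_(r <- rs) ('X - r%:P).
Local Notation w := (phi root_poly).

Definition loc_unit (q : {poly K}) : Prop := q != 0 /\ {in rs, forall r, q.[r] != 0}.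

(* When [phi] embeds K[t] into K(t), [loc] is the semilocal ring at [rs], [rad] its
   Jacobson radical, and [loc_ord k] the ideal generated by [w ^+ k], which is
   smaller than the [k]-th power of [rad] if [rs] has repetitions. *)
Definition loc (z : L) : Prop := exists p q, loc_unit q /\ z = phi p / phi q.

Definition rad (z : L) : Prop :=
  exists p q, [/\ loc_unit q, {in rs, forall r, p.[r] = 0} & z = phi p / phi q].

Definition loc_ord (k : nat) (z : L) : Prop := exists2 u, loc u & z = w ^+ k * u.

Definition iota : {rmorphism K -> L} := phi \o polyC.

Lemma phi_eq0 p : (phi p == 0) = (p == 0).
Proof. by rewrite -(rmorph0 phi) (inj_eq phi_inj). Qed.

Lemma iota_eq0 c : (iota c == 0) = (c == 0).
Proof. by rewrite /= phi_eq0 polyC_eq0. Qed.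

Lemma root_poly_neq0 : root_poly != 0.
Proof. by rewrite monic_neq0 // monic_prod_XsubC. Qed.

Lemma w_neq0 : w != 0. Proof. by rewrite phi_eq0 root_poly_neq0. Qed.

Lemma wX_neq0 k : w ^+ k != 0. Proof. by rewrite expf_neq0 ?w_neq0. Qed.

Lemma loc_unit_phi q : loc_unit q -> phi q != 0.
Proof. by case=> q0 _; rewrite phi_eq0. Qed.

Lemma loc_unitM p q : loc_unit p -> loc_unit q -> loc_unit (p * q).
Proof.
move=> [p0 hp] [q0 hq]; split; first by rewrite mulf_neq0.
by move=> r hr; rewrite hornerM mulf_neq0 ?hp ?hq.
Qed.

Lemma loc_unitC c : c != 0 -> loc_unit c%:P.
Proof. by move=> c0; split=> [|r _]; rewrite ?polyC_eq0 ?hornerC. Qed.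

Lemma loc_phi p : loc (phi p).
Proof.
exists p, 1; split; last by rewrite rmorph1 divr1.
exact: (loc_unitC (oner_neq0 K)).
Qed.

Lemma loc_iota c : loc (iota c). Proof. exact: loc_phi. Qed.
Lemma loc0 : loc 0. Proof. by rewrite -(rmorph0 phi); apply: loc_phi. Qed.
Lemma loc1 : loc 1. Proof. by rewrite -(rmorph1 phi); apply: loc_phi. Qed.

Lemma locD y z : loc y -> loc z -> loc (y + z).
Proof.
move=> [p [q [hq ->]]] [p' [q' [hq' ->]]].
exists (p * q' + p' * q), (q * q'); split; first exact: loc_unitM.
rewrite rmorphD !rmorphM; field.
by rewrite !loc_unit_phi.
Qed.

Lemma locM y z : loc y -> loc z -> loc (y * z).
Proof.
move=> [p [q [hq ->]]] [p' [q' [hq' ->]]].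
exists (p * p'), (q * q'); split; first exact: loc_unitM.
rewrite !rmorphM; field.
by rewrite !loc_unit_phi.
Qed.

Lemma locN z : loc z -> loc (- z).
Proof.
by move=> [p [q [hq ->]]]; exists (- p), q; rewrite rmorphN mulNr.
Qed.

Lemma locB y z : loc y -> loc z -> loc (y - z).
Proof. by move=> hy hz; apply: locD hy (locN hz). Qed.

Lemma locX z k : loc z -> loc (z ^+ k).
Proof.
move=> hz; elim: k => [|k IH]; first by rewrite expr0; apply: loc1.
by rewrite exprS; apply: locM.
Qed.

Lemma loc_sum (I : Type) (s : seq I) (P : pred I) (f : I -> L) :
  (forall i, P i -> loc (f i)) -> loc (\sum_(i <- s | P i) f i).
Proof. by move=> h; elim/big_ind: _ => //; [apply: loc0|apply: locD]. Qed.

Lemma loc_ord0 z : loc_ord 0 z <-> loc z.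
Proof.
split=> [[u hu ->]|hz]; first by rewrite expr0 mul1r.
by exists z => //; rewrite expr0 mul1r.
Qed.

Lemma loc_ord_zero k : loc_ord k 0.
Proof. by exists 0; rewrite ?mulr0 //; apply: loc0. Qed.

Lemma loc_ordD k y z : loc_ord k y -> loc_ord k z -> loc_ord k (y + z).
Proof.
by move=> [u hu ->] [v hv ->]; exists (u + v); rewrite ?mulrDr //; apply: locD.
Qed.

Lemma loc_ordN k z : loc_ord k z -> loc_ord k (- z).
Proof. by move=> [u hu ->]; exists (- u); rewrite ?mulrN //; apply: locN. Qed.

Lemma loc_ordB k y z : loc_ord k y -> loc_ord k z -> loc_ord k (y - z).
Proof. by move=> hy hz; apply: loc_ordD hy (loc_ordN hz). Qed.

Lemma loc_ordM j k y z : loc_ord j y -> loc_ord k z -> loc_ord (j + k) (y * z).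
Proof.
move=> [u hu ->] [v hv ->]; exists (u * v); first exact: locM.
by rewrite exprD mulrACA.
Qed.

Lemma loc_ordMl k y z : loc y -> loc_ord k z -> loc_ord k (y * z).
Proof. by move=> hy hz; apply: (loc_ordM (j := 0)) => //; apply/loc_ord0. Qed.

Lemma loc_ordMr k y z : loc_ord k y -> loc z -> loc_ord k (y * z).
Proof. by move=> hy hz; rewrite mulrC; apply: loc_ordMl. Qed.

Lemma loc_ord_sum k (I : Type) (s : seq I) (P : pred I) (f : I -> L) :
  (forall i, P i -> loc_ord k (f i)) -> loc_ord k (\sum_(i <- s | P i) f i).
Proof. by move=> h; elim/big_ind: _ => //; [apply: loc_ord_zero|apply: loc_ordD]. Qed.

Lemma loc_w : loc w. Proof. exact: loc_phi. Qed.

Lemma loc_ord_le j k z : (j <= k)%N -> loc_ord k z -> loc_ord j z.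
Proof.
move=> jk [u hu ->]; exists (w ^+ (k - j) * u).
  by apply: locM hu; apply: locX loc_w.
by rewrite mulrA -exprD subnKC.
Qed.

Lemma loc_ord_loc k z : loc_ord k z -> loc z.
Proof. by move/(loc_ord_le (leq0n k))/loc_ord0. Qed.

Lemma loc_ordX k z : loc_ord 1 z -> loc_ord k (z ^+ k).
Proof.
move=> hz; elim: k => [|k IH]; first by apply/loc_ord0; rewrite expr0; apply: loc1.
by rewrite exprS -add1n; apply: loc_ordM.
Qed.

Lemma loc_ord_cancel j k z : loc_ord (j + k) (w ^+ j * z) <-> loc_ord k z.
Proof.
split=> [[u hu e]|[u hu ->]]; exists u => //; last by rewrite exprD mulrA.
by apply: (mulfI (wX_neq0 j)); rewrite e exprD mulrA.
Qed.

Hypothesis rs_neq0 : rs != [::].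

Lemma radD y z : rad y -> rad z -> rad (y + z).
Proof.
move=> [p [q [hq hp ->]]] [p' [q' [hq' hp' ->]]].
exists (p * q' + p' * q), (q * q'); split; first exact: loc_unitM.
  by move=> r hr; rewrite hornerD !hornerM hp ?hp' // !mul0r addr0.
by rewrite rmorphD !rmorphM; field; rewrite !loc_unit_phi.
Qed.

Lemma radMl y z : loc y -> rad z -> rad (y * z).
Proof.
move=> [p [q [hq ->]]] [p' [q' [hq' hp' ->]]].
exists (p * p'), (q * q'); split; first exact: loc_unitM.
  by move=> r hr; rewrite hornerM hp' // mulr0.
by rewrite !rmorphM; field; rewrite !loc_unit_phi.
Qed.

Lemma radMr y z : rad y -> loc z -> rad (y * z).
Proof. by move=> hy hz; rewrite mulrC; apply: radMl. Qed.

Lemma radN z : rad z -> rad (- z).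
Proof.
move=> [p [q [hq hp ->]]]; exists (- p), q; rewrite rmorphN mulNr; split=> //.
by move=> r hr; rewrite hornerN hp ?oppr0.
Qed.

Lemma radB y z : rad y -> rad z -> rad (y - z).
Proof. by move=> hy hz; apply: radD hy (radN hz). Qed.

Lemma rad_loc z : rad z -> loc z.
Proof. by move=> [p [q [hq _ ->]]]; exists p, q. Qed.

Lemma root_poly_root r : r \in rs -> root_poly.[r] = 0.
Proof. by move=> hr; apply/eqP; rewrite -/(root _ _) root_prod_XsubC. Qed.

Lemma ord1_rad z : loc_ord 1 z -> rad z.
Proof.
move=> [u hu ->]; rewrite expr1; apply: radMr hu.
exists root_poly, 1; rewrite rmorph1 divr1; split=> //.
  exact: (loc_unitC (oner_neq0 K)).
exact: root_poly_root.
Qed.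

(** A constant in the radical vanishes at some root, hence is 0. Constant coefficients are shown to
    vanish below by exhibiting them as elements of the radical. *)
Lemma rad_iota c : rad (iota c) -> c = 0.
Proof.
move=> [p [q [hq hp e]]].
have {}e : c%:P * q = p.
  by apply: phi_inj; rewrite rmorphM [phi c%:P]e divfK // loc_unit_phi.
case: hq => _; case: rs rs_neq0 hp => // r s _ hp /(_ r (mem_head _ _)) hq.
have := hp r (mem_head _ _); rewrite -e hornerM hornerC => /eqP.
by rewrite mulf_eq0 (negPf hq) orbF => /eqP.
Qed.

Definition loc_invertible z : Prop := [/\ loc z, z != 0 & loc z^-1].

Lemma loc_invertible_iota c z : c != 0 -> rad z -> loc_invertible (iota c + z).
Proof.
move=> c0 [p [q [hq hp ->]]].
have hu : loc_unit (c%:P * q + p).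
  have h : {in rs, forall r, (c%:P * q + p).[r] != 0}.
    move=> r hr; rewrite hornerD (hp _ hr) addr0 hornerM hornerC mulf_neq0 //.
    by case: hq => _ /(_ _ hr).
  split=> //; case: rs rs_neq0 h => // r s _ /(_ r (mem_head _ _)).
  by apply: contraNneq => ->; rewrite horner0.
have -> : iota c + phi p / phi q = phi (c%:P * q + p) / phi q.
  by rewrite rmorphD rmorphM /=; field; rewrite loc_unit_phi.
split; first by exists (c%:P * q + p), q.
  by rewrite mulf_neq0 ?invr_eq0 ?loc_unit_phi.
by exists q, (c%:P * q + p); rewrite invf_div.
Qed.

Lemma loc_invertible_rad a b z : loc a -> loc b -> rad z -> a * b = 1 + z ->
  loc_invertible a.
Proof.
move=> ha hb hz e.
have := loc_invertible_iota (oner_neq0 K) hz; rewrite rmorph1 -e => -[_ h0 h1].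
have a0 : a != 0 by apply: contraNneq h0 => ->; rewrite mul0r.
have b0 : b != 0 by apply: contraNneq h0 => ->; rewrite mulr0.
split=> //; have -> : a^-1 = b * (a * b)^-1 by rewrite invfM mulrCA mulfV ?mulr1.
exact: locM.
Qed.

Lemma loc_invertible_not_rad z : loc_invertible z -> ~ rad z.
Proof.
move=> [_ z0 hi] /(radMl hi); rewrite mulVf // -(rmorph1 iota) => /rad_iota /eqP.
by rewrite oner_eq0.
Qed.

Lemma loc_ord_invertible k a z : loc_invertible a -> loc_ord k (a * z) -> loc_ord k z.
Proof.
move=> [_ a0 ha] /(loc_ordMl ha); by rewrite mulKf.
Qed.

Lemma rad_sqrt z : loc z -> rad (z ^+ 2) -> rad z.
Proof.
move=> [p [q [hq ->]]] [p' [q' [hq' hp' e]]]; exists p, q; split=> //.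
have {}e : p ^+ 2 * q' = p' * q ^+ 2.
  apply: phi_inj; rewrite !rmorphM -!expr2.
  have -> : phi p ^+ 2 = (phi p / phi q) ^+ 2 * phi q ^+ 2.
    by rewrite expr_div_n divfK // expf_neq0 // loc_unit_phi.
  by rewrite e; field; rewrite loc_unit_phi.
move=> r hr; have := congr1 (horner^~ r) e; rewrite !hornerM hp' // mul0r.
case: hq' => _ /(_ _ hr) h /eqP; rewrite mulf_eq0 (negPf h) orbF.
by rewrite mulf_eq0 orbb => /eqP.
Qed.

Hypothesis rs2 : size rs = 2.

(** At two distinct roots, membership in the radical suffices. At a double root [a] it provides one
    factor; cancelling the square of ['X - a] leaves [p1 ^+ 2 * q' = p' * q ^+ 2], where [p']
    vanishes at [a] because [u] lies in the radical, and this gives the second factor. Three equal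
    roots would defeat the argument, hence [size rs = 2]. *)
Lemma ord1_sqrt z u : loc z -> rad u -> z ^+ 2 = w * u -> loc_ord 1 z.
Proof.
move=> hz hu e; have : rad z.
  by apply: rad_sqrt hz _; rewrite e; apply: radMl hu; apply: loc_w.
move=> [p [q [hq hp ez]]].
suff [s hs] : exists s, p = root_poly * s.
  by exists (phi s / phi q); [exists s, q|rewrite expr1 ez hs rmorphM mulrA].
move: e; rewrite {}ez; case: hu => [p' [q' [hq' hp' ->]]] e.
have {}e : p ^+ 2 * q' = root_poly * p' * q ^+ 2.
  apply: phi_inj; rewrite !rmorphM -!expr2.
  have -> : phi p ^+ 2 = (phi p / phi q) ^+ 2 * phi q ^+ 2.
    by rewrite expr_div_n divfK // expf_neq0 // loc_unit_phi.
  by rewrite e; field; rewrite loc_unit_phi.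
case: hq' => _ hq'; move: e hp hp' hq'; rewrite /root_poly.
case: rs rs2 => [|a [|b []]] // _.
rewrite !big_cons big_nil mulr1 => e hp hp' hq'.
have ha : a \in [:: a; b] by rewrite inE eqxx.
have hb : b \in [:: a; b] by rewrite !inE eqxx orbT.
have /factor_theorem[p1 ep] : root p a by apply/rootP/hp.
suff /factor_theorem[p2 ep1] : root p1 b by exists p2; rewrite ep ep1; ring.
apply/rootP; case: (eqVneq a b) => [ab|ab]; last first.
  have := hp b hb; rewrite ep hornerM !hornerE => /eqP.
  by rewrite mulf_eq0 subr_eq0 [b == a]eq_sym (negPf ab) orbF => /eqP.
rewrite -ab in e *.
have X0 : ('X - a%:P) * ('X - a%:P) != 0 :> {poly K}.
  by rewrite mulf_neq0 // polyXsubC_eq0.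
have {}e : p1 ^+ 2 * q' = p' * q ^+ 2.
  by apply: (mulfI X0); rewrite [RHS]mulrA -e ep; ring.
have := congr1 (horner^~ a) e; rewrite !hornerM hp' // mul0r => /eqP.
by rewrite mulf_eq0 (negPf (hq' _ ha)) orbF mulf_eq0 orbb => /eqP.
Qed.

Implicit Types (g h : {mpoly K[2]}) (x y : L).
Local Notation X0 := ('X_(0 : 'I_2) : {mpoly K[2]}).
Local Notation X1 := ('X_(1 : 'I_2) : {mpoly K[2]}).
Local Notation ord := loc_ord.
Local Notation invertible := loc_invertible.

Definition pair2 (R : Type) (x y : R) (i : 'I_2) : R := if i == 0 then x else y.

Definition eval2 (x y : L) (g : {mpoly K[2]}) : L := mmap iota (pair2 x y) g.

Definition peval (c : {poly K}) (x : L) : L := (map_poly iota c).[x].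

Lemma eval2C x y c : eval2 x y c%:MP = iota c. Proof. exact: mmapC. Qed.
Lemma eval2X0 x y : eval2 x y X0 = x. Proof. by rewrite /eval2 mmapX mmap1U. Qed.
Lemma eval2X1 x y : eval2 x y X1 = y. Proof. by rewrite /eval2 mmapX mmap1U. Qed.
Lemma eval2D x y g h : eval2 x y (g + h) = eval2 x y g + eval2 x y h.
Proof. exact: rmorphD. Qed.
Lemma eval2B x y g h : eval2 x y (g - h) = eval2 x y g - eval2 x y h.
Proof. exact: rmorphB. Qed.
Lemma eval2M x y g h : eval2 x y (g * h) = eval2 x y g * eval2 x y h.
Proof. exact: rmorphM. Qed.
Lemma eval2Xn x y g k : eval2 x y (g ^+ k) = eval2 x y g ^+ k.
Proof. exact: rmorphXn. Qed.
Lemma eval2Z x y c g : eval2 x y (c *: g) = iota c * eval2 x y g.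
Proof. exact: mmapZ. Qed.

Definition eval2E := (eval2B, eval2D, eval2M, eval2Xn, eval2Z, eval2C, eval2X0, eval2X1).

Lemma eval2_swap x y g : eval2 y x (swap g) = eval2 x y g.
Proof.
rewrite /swap /eval2 mmap_comp; apply: mmap_ext => i.
by case: i => [[|[|[]]]] //= hi; rewrite (tnth_nth 0) /= mmapX mmap1U.
Qed.

Lemma eval2_comp x y g (a b : {mpoly K[2]}) :
  eval2 x y (g \mPo [tuple a; b]) = eval2 (eval2 x y a) (eval2 x y b) g.
Proof.
rewrite /eval2 mmap_comp; apply: mmap_ext => i.
by case: i => [[|[|[]]]] //= hi; rewrite (tnth_nth 0).
Qed.

Lemma loc_eval2 x y g : loc x -> loc y -> loc (eval2 x y g).
Proof.
move=> hx hy; elim/mpolyind: g => [|c m p _ _ IH].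
  by rewrite /eval2 rmorph0; apply: loc0.
rewrite eval2D; apply: locD IH. rewrite eval2Z (mon2P m) mpolyX_mon2 !eval2E.
by apply: locM; [apply: loc_iota|apply: locM; apply: locX].
Qed.

Lemma loc_ord_eval2_sub k x y y' g : loc x -> loc y -> loc y' -> ord k (y - y') ->
  ord k (eval2 x y g - eval2 x y' g).
Proof.
move=> hx hy hy' hk; elim/mpolyind: g => [|c m p _ _ IH].
  by rewrite /eval2 !rmorph0 subr0; apply: loc_ord_zero.
rewrite !eval2D opprD addrACA; apply: loc_ordD IH.
rewrite (mon2P m) mpolyX_mon2 !eval2E -!mulrBr.
apply: loc_ordMl; first exact: loc_iota.
apply: loc_ordMl; first exact: locX.
rewrite subrXX; apply: loc_ordMr => //.
by apply: loc_sum => i _; apply: locM; apply: locX.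
Qed.

Lemma eval2_at0 (R : comNzRingType) (f : {rmorphism K -> R}) g :
  mmap f (pair2 0 0) g = f g@_(mon2 0 0).
Proof.
have [A [B {1}->]] := hadamard g.
by rewrite !rmorphD !rmorphM /= mmapC !mmapX !mmap1U /pair2 /= !mul0r !addr0.
Qed.

Lemma rad_eval2 x y g : rad x -> rad y ->
  exists2 z, rad z & eval2 x y g = iota g@_(mon2 0 0) + z.
Proof.
move=> hx hy; have [A [B e]] := hadamard g.
have hA := loc_eval2 A (rad_loc hx) (rad_loc hy).
have hB := loc_eval2 B (rad_loc hx) (rad_loc hy).
exists (x * eval2 x y A + y * eval2 x y B).
  by apply: radD; apply: radMr.
by rewrite {1}e !eval2E addrA.
Qed.

Lemma ord_eval2 x y g : ord 1 x -> ord 1 y ->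
  exists2 z, ord 1 z & eval2 x y g = iota g@_(mon2 0 0) + z.
Proof.
move=> hx hy; have [A [B e]] := hadamard g.
have hA := loc_eval2 A (loc_ord_loc hx) (loc_ord_loc hy).
have hB := loc_eval2 B (loc_ord_loc hx) (loc_ord_loc hy).
exists (x * eval2 x y A + y * eval2 x y B).
  by apply: loc_ordD; apply: loc_ordMr.
by rewrite {1}e !eval2E addrA.
Qed.

Lemma peval_mmap (a b : {poly K}) g x :
  peval (mmap polyC (pair2 a b) g) x = eval2 (peval a x) (peval b x) g.
Proof.
rewrite /peval.
pose F : {rmorphism {poly K} -> L} := horner_eval x \o map_poly iota.
rewrite -[LHS]/(F _) rmorph_mmap.
apply: mmap_ext2 => [c|i] /=; first by rewrite map_polyC /= horner_evalE hornerC.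
by rewrite /pair2; case: ifP.
Qed.

Lemma pevalX x : peval 'X x = x.
Proof. by rewrite /peval map_polyX hornerX. Qed.

Lemma pevalZ a c x : peval (a *: c) x = iota a * peval c x.
Proof. by rewrite /peval map_polyZ hornerZ. Qed.

Lemma loc_peval c x : loc x -> loc (peval c x).
Proof.
move=> hx; rewrite /peval horner_poly; apply: loc_sum => i _.
by apply: locM; [apply: loc_iota|apply: locX].
Qed.

Lemma peval_root0 c x : c.[0] = 0 -> exists c', peval c x = x * peval c' x /\ c = 'X * c'.
Proof.
move/eqP/factor_theorem => [c' e]; exists c'.
by rewrite /peval e subr0 rmorphM /= map_polyX hornerM hornerX mulrC ['X * _]mulrC.
Qed.

Lemma peval_root0_linear c : c.[0] = 0 -> exists b c2,
  c = 'X * (b%:P + 'X * c2) /\ forall x, peval c x = x * (iota b + x * peval c2 x).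
Proof.
move=> c0; have [c1 [_ e1]] := peval_root0 0 c0.
have [|c2 [_ e2]] := peval_root0 (c := c1 - c1.[0]%:P) 0.
  by rewrite hornerD hornerN hornerC subrr.
have e : c = 'X * (c1.[0]%:P + 'X * c2) by rewrite e1 -e2 addrC subrK.
exists c1.[0], c2; split=> // x.
by rewrite e /peval !(rmorphM, rmorphD) /= map_polyX map_polyC !hornerE.
Qed.

Lemma ord_peval c x k : c.[0] = 0 -> ord k x -> ord k (peval c x).
Proof.
move=> /peval_root0 -/(_ x) [c' [-> _]] hx; apply: loc_ordMr => //.
by apply: loc_peval; apply: loc_ord_loc hx.
Qed.

Definition contact (k : nat) (x y : L) : Prop :=
  exists2 c : {poly K}, c.[0] = 0 &
    ord k (y - peval c x) \/ ord k (x - peval c y).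

Lemma contact_le j k x y : (j <= k)%N -> contact k x y -> contact j x y.
Proof.
by move=> jk [c c0 h]; exists c => //; case: h => h; [left|right];
  apply: loc_ord_le jk h.
Qed.

Lemma contactC k x y : contact k x y <-> contact k y x.
Proof. by split=> -[c c0 h]; exists c => //; case: h; [right|left|right|left]. Qed.

Lemma contact1 x y : ord 1 y -> contact 1 x y.
Proof.
move=> hy; exists 0; rewrite ?horner0 //; left.
by rewrite /peval rmorph0 horner0 subr0.
Qed.

(* Truncated implicit function theorem: solve [g = 0] for the second coordinate
   by iterating the fixed point equation [y = - (g - b y) / b]. *)
Lemma contact_of_smooth k g x y : g@_(mon2 0 0) = 0 -> g@_(mon2 0 1) != 0 ->
  ord 1 x -> ord 1 y -> ord k (eval2 x y g) ->
  exists2 c : {poly K}, c.[0] = 0 & ord k (y - peval c x).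
Proof.
move=> g0 b0 hx hy hk; set b := g@_(mon2 0 1) in b0.
have lx := loc_ord_loc hx; have ly := loc_ord_loc hy.
suff h j : (j <= k)%N ->
    exists2 c : {poly K}, c.[0] = 0 & ord j (y - peval c x) by apply: h.
elim: j => [|j IH] jk.
  exists 0; rewrite ?horner0 //; apply/loc_ord0/locB => //.
  exact: loc_peval.
have [c c0 hc] := IH (ltnW jk).
have [A [B [D e]]] := taylor2 g.
pose Q := g - b *: X1; pose y' := peval c x.
have hy' : ord 1 y' by apply: ord_peval.
have ly' := loc_ord_loc hy'.
exists (- b^-1 *: mmap polyC (pair2 'X c) Q).
  rewrite hornerZ -[_.[0]]/(horner_eval 0 _) rmorph_mmap.
  have -> : mmap (horner_eval 0 \o polyC) (horner_eval 0 \o pair2 'X c) Q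
      = mmap (horner_eval 0 \o polyC) (pair2 0 0) Q.
    apply: mmap_ext => i; rewrite /= /pair2 !horner_evalE.
    by case: ifP => _; rewrite ?hornerX.
  rewrite eval2_at0 /= horner_evalE hornerC /Q mcoeffB g0 mcoeffZ.
  by rewrite mon2_U1 mcoeffX mon2_eq /= mulr0 subr0 mulr0.
have -> : peval (- b^-1 *: mmap polyC (pair2 'X c) Q) x
    = - iota b^-1 * eval2 x y' Q.
  by rewrite pevalZ peval_mmap pevalX rmorphN.
have ib : iota b != 0 by rewrite iota_eq0.
have -> : y - (- iota b^-1 * eval2 x y' Q) =
    iota b^-1 * (eval2 x y g - (eval2 x y Q - eval2 x y' Q)).
  have -> : eval2 x y Q = eval2 x y g - iota b * y.
    by rewrite /Q -scaleNr !eval2E rmorphN mulNr.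
  by rewrite fmorphV; field.
apply: loc_ordMl; first exact: loc_iota.
apply: loc_ordB; first exact: loc_ord_le hk.
have -> : Q = (g@_(mon2 1 0)) *: X0 + X0 ^+ 2 * A + X0 * X1 * B + X1 ^+ 2 * D.
  by rewrite /Q {1}e g0 mpolyC0; ring.
rewrite !eval2E.
(* [Q] has no linear term in [X1]. Every term of the difference is therefore a product of an element
   of order 1 and one of order [j], and the approximation gains one order. *)
have -> a u v u1 u2 v1 v2 : a * x + x ^+ 2 * u + x * y * u1 + y ^+ 2 * u2
    - (a * x + x ^+ 2 * v + x * y' * v1 + y' ^+ 2 * v2)
  = x * (x * (u - v)) + x * ((y - y') * u1) + x * (y' * (u1 - v1))
   + (y + y') * ((y - y') * u2) + y' * (y' * (u2 - v2)) :> L by ring.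
have hd C : ord j (eval2 x y C - eval2 x y' C) by apply: loc_ord_eval2_sub.
have lC C : loc (eval2 x y C) by apply: loc_eval2.
rewrite -add1n; do ![apply: loc_ordD]; apply: loc_ordM => //.
- exact: loc_ordMl.
- exact: loc_ordMr.
- exact: loc_ordMl.
- exact: loc_ordD.
- exact: loc_ordMr.
- exact: loc_ordMl.
Qed.

Lemma contact_of_mult1 k g x y : has_mult 1 g -> ord 1 x -> ord 1 y ->
  ord k (eval2 x y g) -> contact k x y.
Proof.
move=> /has_mult1P[g0 [h|h]] hx hy hk; last first.
  by have [c c0 hc] := contact_of_smooth g0 h hx hy hk; exists c => //; left.
rewrite -eval2_swap in hk; rewrite -mcoeff_swap in g0; rewrite -mcoeff_swap in h.
by have [c c0 hc] := contact_of_smooth g0 h hy hx hk; exists c => //; right.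
Qed.

Definition chart0 (c : K) (k : nat) (g h : {mpoly K[2]}) : Prop :=
  g \mPo [tuple X0; X0 * (X1 + c%:MP)] = X0 ^+ k * h.

Lemma comp_tupleX (a b : {mpoly K[2]}) :
  ((X0 \mPo [tuple a; b] = a) * (X1 \mPo [tuple a; b] = b))%type.
Proof. by split; rewrite comp_mpolyXU. Qed.

Lemma swap_chart g :
  swap (g \mPo [tuple X0 * X1; X1]) = swap g \mPo [tuple X0; X0 * (X1 + 0%:MP)].
Proof.
rewrite mpolyC0 addr0 /swap; symmetry.
apply: (mpoly_rmorph_ext
  (f := comp_mpoly [tuple X0; X0 * X1] \o comp_mpoly [tuple X1; X0])
  (g := comp_mpoly [tuple X1; X0] \o comp_mpoly [tuple X0 * X1; X1])) => [c|i] /=.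
  by rewrite !comp_mpolyC.
have [->|->] := ord2P i.
  by rewrite !(comp_tupleX, rmorphM) /= !comp_tupleX mulrC.
by rewrite !comp_tupleX.
Qed.

(** Only the origin of the second chart occurs in [blowup_germ], so the exchange of coordinates
    makes it [chart0] at [c = 0]. Strict transforms are then studied in [chart0] alone. *)
Lemma chart1_swap k g h :
  g \mPo [tuple X0 * X1; X1] = X1 ^+ k * h <-> chart0 0 k (swap g) (swap h).
Proof.
rewrite /chart0 -swap_chart; split=> [->|/(congr1 (@swap K))].
  by rewrite swapM swapXn swapX1.
by rewrite swapM swapXn swapX0 !swapK.
Qed.

Lemma blowup_germE g h : blowup_germ g h <->
  exists k, [/\ has_mult k g, h@_(mon2 0 0) = 0 &
    (exists c, chart0 c k g h) \/ chart0 0 k (swap g) (swap h)].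
Proof.
split=> -[k [hk h0 hc]]; exists k; split=> //; try by rewrite -?mon2_0 // mon2_0.
  by case: hc => hc; [left|right; apply/chart1_swap].
by case: hc => hc; [left|right; apply/chart1_swap].
Qed.

Lemma mpolyX_neq0 : X0 != 0.
Proof. by rewrite -msize_poly_eq0 msizeX. Qed.

Lemma chart0_inj c k g h h' : chart0 c k g h -> chart0 c k g h' -> h = h'.
Proof.
rewrite /chart0 => -> /mulfI; apply.
by rewrite expf_neq0 ?mpolyX_neq0.
Qed.

Lemma mcoeff_X0M g i j :
  (X0 * g)@_(mon2 i j) = if i is i'.+1 then g@_(mon2 i' j) else 0.
Proof.
rewrite mulrC (_ : X0 = 'X_[mon2 1 0]) ?mcoeffM_mon2 ?mon2_U0 //.
by case: i => [|i] //=; rewrite subSS !subn0.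
Qed.

Lemma mcoeff_X1M g i j :
  (X1 * g)@_(mon2 i j) = if j is j'.+1 then g@_(mon2 i j') else 0.
Proof.
rewrite mulrC (_ : X1 = 'X_[mon2 0 1]) ?mcoeffM_mon2 ?mon2_U1 //.
by case: j => [|j] //=; rewrite subSS !subn0.
Qed.

Lemma mcoeff_mulC (c : K) g m : (c%:MP * g)@_m = c * g@_m.
Proof. by rewrite mcoeffCM. Qed.

Lemma hadamard_chart c A : exists E,
  A \mPo [tuple X0; X0 * (X1 + c%:MP)] = (A@_(mon2 0 0))%:MP + X0 * E.
Proof.
have [A1 [A2 e]] := hadamard A.
exists (A1 \mPo [tuple X0; X0 * (X1 + c%:MP)]
        + (X1 + c%:MP) * (A2 \mPo [tuple X0; X0 * (X1 + c%:MP)])).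
rewrite {1}e !rmorphD !rmorphM /= comp_mpolyC !comp_tupleX; ring.
Qed.

(** If the linear part of [g] is [u x + v y], then [h] restricts to [u + v (y + c)] on the
    exceptional divisor. As [h] vanishes at the origin, [v = 0] would force [u = 0]; so [v] is
    nonzero, and it is the coefficient of [y] in [h]. *)
Lemma chart0_mult1 c g h : has_mult 1 g -> chart0 c 1 g h ->
  h@_(mon2 0 0) = 0 -> has_mult 1 h.
Proof.
move=> /has_mult1P[g0 g1]; rewrite /chart0 expr1 => e h0.
have [A [B [D eg]]] := taylor2 g.
have [a ea] := hadamard_chart c A; have [b eb] := hadamard_chart c B.
have [d ed] := hadamard_chart c D.
set u := g@_(mon2 1 0) in eg g1; set v := g@_(mon2 0 1) in eg g1.
have eh : exists E, h = u%:MP + v%:MP * X1 + (v * c)%:MP + X0 * E.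
  exists (((A@_(mon2 0 0))%:MP + X0 * a) + (X1 + c%:MP) * ((B@_(mon2 0 0))%:MP + X0 * b)
     + (X1 + c%:MP) ^+ 2 * ((D@_(mon2 0 0))%:MP + X0 * d)).
  apply: (mulfI mpolyX_neq0); rewrite -e {1}eg g0 mpolyC0 add0r.
  rewrite !rmorphD !rmorphM /= -!mul_mpolyC !rmorphM /= !comp_mpolyC.
  rewrite !comp_tupleX ea eb ed; ring.
move: h0 => /[dup] h0; case: eh => E ->.
rewrite !mcoeffD mcoeff_X0M mcoeff_mulC !mcoeffC mon2_0 mon2_U1 mcoeffX.
rewrite !mon2_eq /= !mulr0 !mulr1 !addr0 => uv.
have v0 : v != 0.
  apply: contraPneq g1 => v0; rewrite v0 eqxx => -[|//].
  by move: uv; rewrite v0 mul0r addr0 => ->; rewrite eqxx.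
apply/has_mult1P; split.
  rewrite !mcoeffD mcoeff_X0M mcoeff_mulC !mcoeffC mon2_0 mcoeffX.
  by rewrite !mon2_eq /= !mulr0 !mulr1 !addr0.
right; rewrite !mcoeffD mcoeff_X0M mcoeff_mulC !mcoeffC mon2_0 mcoeffX.
by rewrite !mon2_eq /= !mulr0 !mulr1 !addr0 add0r.
Qed.

Lemma smooth_after_mult1 k g : has_mult 1 g -> smooth_after k g.
Proof.
elim: k g => [|k IH] g hg //= h /blowup_germE[j [hj h0]].
rewrite -(has_mult_uniq hg hj) {hj} => -[[c hc]|hc]; apply: IH.
  exact: chart0_mult1 hg hc h0.
rewrite -(swapK h); apply: has_mult_swap.
by apply: chart0_mult1 (has_mult_swap hg) hc _; rewrite mcoeff_swap.
Qed.

(** On the exceptional divisor the strict transform restricts to the tangent cone of [g], recentred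
    at [c]. *)
Lemma chart0_quadratic c g h A B D :
  g = X0 ^+ 2 * A + X0 * X1 * B + X1 ^+ 2 * D -> chart0 c 2 g h ->
  exists E, h = (A@_(mon2 0 0))%:MP + (B@_(mon2 0 0))%:MP * (X1 + c%:MP)
                + (D@_(mon2 0 0))%:MP * (X1 + c%:MP) ^+ 2 + X0 * E.
Proof.
move=> eg; rewrite /chart0 => e.
have [a ea] := hadamard_chart c A; have [b eb] := hadamard_chart c B.
have [d ed] := hadamard_chart c D.
exists (a + (X1 + c%:MP) * b + (X1 + c%:MP) ^+ 2 * d).
have X20 : X0 ^+ 2 != 0 by rewrite expf_neq0 ?mpolyX_neq0.
apply: (mulfI X20); rewrite -e eg.
rewrite !rmorphD !rmorphM /= !comp_tupleX ea eb ed; ring.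
Qed.

Lemma chart0_exists c A B D : exists h,
  chart0 c 2 (X0 ^+ 2 * A + X0 * X1 * B + X1 ^+ 2 * D) h.
Proof.
pose t := [tuple X0; X0 * (X1 + c%:MP)].
exists ((A \mPo t) + (X1 + c%:MP) * (B \mPo t) + (X1 + c%:MP) ^+ 2 * (D \mPo t)).
rewrite /chart0 !rmorphD !rmorphM /= !comp_tupleX.
by rewrite -/t; ring.
Qed.

Lemma chart0_coefs c g h A B D :
  g = X0 ^+ 2 * A + X0 * X1 * B + X1 ^+ 2 * D -> chart0 c 2 g h ->
  [/\ h@_(mon2 0 0) = A@_(mon2 0 0) + B@_(mon2 0 0) * c + D@_(mon2 0 0) * c ^+ 2,
      h@_(mon2 0 1) = B@_(mon2 0 0) + D@_(mon2 0 0) * c *+ 2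
    & h@_(mon2 0 2) = D@_(mon2 0 0)].
Proof.
move=> eg /(chart0_quadratic eg)[E ->].
set a := A@_ _; set b := B@_ _; set d := D@_ _.
have -> : a%:MP + b%:MP * (X1 + c%:MP) + d%:MP * (X1 + c%:MP) ^+ 2 + X0 * E
  = (a + b * c + d * c ^+ 2)%:MP + X1 * ((b + d * c *+ 2)%:MP + X1 * d%:MP) + X0 * E.
  rewrite !mpolyCD !mpolyCM; ring.
split; do 4!rewrite ?mcoeffD ?mcoeff_X0M ?mcoeff_X1M ?mcoeffC /=;
  by rewrite mon2_0 !mon2_eq /= ?mulr0 ?mulr1 ?addr0 ?add0r.
Qed.

(* [x] and [y] generate the ideal of [w]. *)
Definition immersed (x y : L) : Prop := exists x1 y1,
  [/\ loc x1, loc y1, x = w * x1, y = w * y1 &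
      exists s t z, [/\ loc s, loc t, rad z & s * x1 + t * y1 = 1 + z]].

Lemma immersedC x y : immersed x y -> immersed y x.
Proof.
move=> [x1 [y1 [hx hy ex ey [s [t [z [hs ht hz e]]]]]]].
exists y1, x1; split=> //; exists t, s, z; split=> //.
by rewrite addrC.
Qed.

Lemma ord1W x : loc x -> ord 1 (w * x).
Proof. by move=> hx; exists x; rewrite ?expr1. Qed.

Lemma immersed_ord x y : immersed x y -> ord 1 x /\ ord 1 y.
Proof. by move=> [x1 [y1 [hx hy -> -> _]]]; split; apply: ord1W. Qed.

(* With a leading form [q], the coordinate [y1 / x1] on the exceptional divisor
   is a root of [q] modulo [w]. *)
Lemma leading_form_vanishes g x x1 y1 A B D : ord 1 x -> loc x1 -> loc y1 ->
  x = w * x1 -> ord 1 (w * y1) ->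
  g = X0 ^+ 2 * A + X0 * X1 * B + X1 ^+ 2 * D -> eval2 x (w * y1) g = 0 ->
  ord 1 (iota A@_(mon2 0 0) * x1 ^+ 2 + iota B@_(mon2 0 0) * (x1 * y1)
         + iota D@_(mon2 0 0) * y1 ^+ 2).
Proof.
move=> ox lx ly ex oy ->; rewrite !eval2E.
have [za ha ->] := ord_eval2 A ox oy; have [zb hb ->] := ord_eval2 B ox oy.
have [zd hd ->] := ord_eval2 D ox oy; rewrite {1 2}ex => e.
set T := (X in ord 1 X).
have -> : T = - (x1 ^+ 2 * za + x1 * y1 * zb + y1 ^+ 2 * zd).
  apply/eqP; rewrite -addr_eq0; apply/eqP.
  apply: (mulfI (wX_neq0 2)); rewrite mulr0; apply: etrans e; rewrite /T; ring.
by apply/loc_ordN/loc_ordD; [apply: loc_ordD|]; apply: loc_ordMl => //;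
  rewrite ?expr2; apply: locM.
Qed.

(** Modulo the radical [y1] equals [c x1], so the relation becomes [(s + t c) x1 = 1] there. *)
Lemma immersed_invertible x1 y1 c s t z : loc x1 -> loc y1 -> loc s -> loc t ->
  rad z -> s * x1 + t * y1 = 1 + z -> rad (y1 - iota c * x1) -> invertible x1.
Proof.
move=> lx ly ls lt hz e hr.
apply: (loc_invertible_rad (b := s + t * iota c) (z := z - t * (y1 - iota c * x1))) => //.
- by apply: locD => //; apply: locM => //; apply: loc_iota.
- by apply: radB => //; apply: radMl.
- by rewrite addrA -e; ring.
Qed.

Lemma double_root (a b c d : K) : 0 = a + b * c + d * c ^+ 2 -> 0 = b + d * c *+ 2 ->
  [\/ a != 0, b != 0 | d != 0] -> [/\ b = - (d * c *+ 2), a = d * c ^+ 2 & d != 0].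
Proof.
move=> q0 q1 h; have eb : b = - (d * c *+ 2) by apply/eqP; rewrite -addr_eq0 -q1.
have ea : a = d * c ^+ 2.
  apply/eqP; rewrite -subr_eq0; apply/eqP; rewrite [RHS]q0 eb; ring.
split=> //; apply/eqP => d0; move: h; rewrite ea eb d0 !mul0r mul0rn oppr0.
by rewrite eqxx => -[].
Qed.

(** A singular strict transform forces the tangent cone to be [d (Y - c)^2], so the square of
    [y1 - c x1] is divisible by [w] and [y1 - c x1] lies in the radical. Then [x] generates the
    ideal of [w], and the equation of [h], which starts in degree 2, improves this membership to
    divisibility by [w]. The contrapositive is used: without contact of order 2, one blow-up is
    enough. *)
Lemma chart0_singular c g h x y : immersed x y -> has_mult 2 g ->
  eval2 x y g = 0 -> chart0 c 2 g h -> h@_(mon2 0 0) = 0 ->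
  h@_(mon2 1 0) = 0 -> h@_(mon2 0 1) = 0 -> ord 2 (y - iota c * x).
Proof.
move=> im /has_mult2P[A [B [D [eg hABD]]]] e hc h00 h10 h01.
have [ox oy] := immersed_ord im.
case: im => x1 [y1 [lx ly ex ey [s [t [z [ls lt hz est]]]]]].
have [] := chart0_coefs eg hc; rewrite h00 h01.
set a := A@_ _; set b := B@_ _; set d := D@_ _ => q0 q1 hd.
have [eb ea d0] := double_root q0 q1 hABD.
have oyw : ord 1 (w * y1) by rewrite -ey.
rewrite ey in e; have := leading_form_vanishes ox lx ly ex oyw eg e.
rewrite -/a -/b -/d => ho.
set zz := y1 - iota c * x1.
have lz : loc zz by apply: locB => //; apply: locM => //; apply: loc_iota.
have hz2 : rad (zz ^+ 2).
  have : ord 1 (iota d^-1 * (iota d * zz ^+ 2)).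
    apply: loc_ordMl; first exact: loc_iota.
    rewrite -[iota d * _](_ : iota a * x1 ^+ 2 + iota b * (x1 * y1) + iota d * y1 ^+ 2
      = _) // ea eb rmorphN rmorphMn !rmorphM /zz; ring.
  by rewrite mulrA -rmorphM mulVf // rmorph1 mul1r => /ord1_rad.
have rz : rad zz by apply: rad_sqrt.
have ux := immersed_invertible lx ly ls lt hz est rz.
have [_ x10 lxi] := ux.
pose y' := zz / x1.
have ry' : rad y' by apply: radMr.
have rx : rad x by apply: ord1_rad.
have eh : eval2 x y' h = 0.
  have := congr1 (eval2 x y') hc; rewrite eval2_comp !eval2E.
  have -> : x * (y' + iota c) = w * y1.
    by rewrite ex /y' /zz; field.
  rewrite e => /esym/eqP; rewrite mulf_eq0 expf_eq0 /= ex mulf_eq0.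
  by rewrite (negPf x10) (negPf w_neq0) /= => /eqP.
have [A' [B' [D' eh']]] := taylor2 h.
have hD' : D'@_(mon2 0 0) = d.
  rewrite -hd; have [_ [_ _ <-]] := coef2 A' B' D'; congr (_@__).
  by rewrite eh' h00 h10 h01 mpolyC0 !scale0r !add0r.
move: eh; rewrite eh' h00 h10 h01 mpolyC0 !scale0r !add0r !eval2E.
have [zd hzd ->] := rad_eval2 D' rx ry'; rewrite hD' => eh.
have [lu u0 lui] := loc_invertible_iota d0 hzd.
have lA := loc_eval2 A' (rad_loc rx) (rad_loc ry').
have lB := loc_eval2 B' (rad_loc rx) (rad_loc ry').
(* Except for the term in [y' ^+ 2], each term of [h(x, y') = 0] contains [x], hence [w], times a
   further element of the radical. This is the shape that [ord1_sqrt] asks for. *)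
have : ord 1 y'.
  apply: (ord1_sqrt (u := - (x1 * x * eval2 x y' A' + x1 * y' * eval2 x y' B')
    / (iota d + zd))); first exact: rad_loc.
    apply: radMr lui; apply/radN/radD; apply: radMr => //; apply: radMl => //.
  apply: (mulIf u0); rewrite -[RHS]mulrA divfK //.
  move: eh lA lB; set la := eval2 _ _ A'; set lb := eval2 _ _ B' => eh _ _.
  by apply/eqP; rewrite -subr_eq0; apply/eqP; apply: etrans eh; rewrite ex; ring.
move=> oy'; rewrite ey; have -> : w * y1 - iota c * x = w ^+ 1 * (x1 * y').
  by rewrite ex /y' /zz; field.
by apply/(loc_ord_cancel 1 1)/loc_ordMl.
Qed.

Lemma eval2_poly x y (p : {poly K}) :
  eval2 x y (map_poly (@mpolyC 2 K) p).['X_1] = peval p y.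
Proof.
rewrite -[LHS]/((mmap iota (pair2 x y)) _) -horner_map -map_poly_comp /=.
rewrite mmapX mmap1U /peval; congr (_.[_]); apply: eq_map_poly => c /=.
exact: mmapC.
Qed.

(** Here [x] generates the ideal of [w], so a contact given as [x = q(y)] can be inverted: the
    linear coefficient of [q] is nonzero, as otherwise [x] would have order 2, and the implicit
    function theorem applies. That argument needs [k > 1]; for smaller [k] the zero polynomial
    works. *)
Lemma contact_graph k x1 y x : invertible x1 -> x = w * x1 -> ord 1 y ->
  contact k x y -> exists2 c : {poly K}, c.[0] = 0 & ord k (y - peval c x).
Proof.
move=> ux ex oy [c c0]; have ox : ord 1 x by rewrite ex; apply: ord1W; case: ux.
case: (leqP k 1) => [k1 _|k1].
  exists 0; rewrite ?horner0 // /peval rmorph0 horner0 subr0.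
  exact: loc_ord_le oy.
case=> hk; first by exists c.
have [b [c2 [_ /(_ y) ecy]]] := peval_root0_linear c0.
have [Q eQ] : exists Q, eval2 x y Q = peval c2 y.
  by exists (map_poly (@mpolyC 2 K) c2).['X_1]; apply: eval2_poly.
pose G := X0 - X1 * (b%:MP + X1 * Q).
have eG : eval2 x y G = x - peval c y by rewrite ecy /G !eval2E eQ.
apply: (contact_of_smooth (g := G)) => //.
- rewrite mcoeffB mcoeff_X1M -['X_0]mulr1 mcoeff_X0M subr0 //.
- rewrite mcoeffB mcoeff_X1M -['X_0]mulr1 mcoeff_X0M add0r oppr_eq0.
  rewrite mcoeffD mcoeff_X1M addr0 mcoeffC mon2_0 eqxx mulr1.
  apply/eqP => b0; have ox2 : ord 2 x.
    rewrite -[x](subrK (peval c y)); apply: loc_ordD; first exact: loc_ord_le hk.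
    rewrite ecy b0 rmorph0 add0r mulrA -expr2.
    apply: loc_ordMr; first exact: loc_ordX.
    by apply: loc_peval; apply: loc_ord_loc oy.
  apply: (loc_invertible_not_rad ux); apply: ord1_rad.
  by apply/(loc_ord_cancel 1 1); rewrite expr1 -ex.
- by rewrite eG.
Qed.

(** From [y = x (c + y')] follows [y - x (c + q(x)) = x (y' - q(x))], and [x] is [w] times a unit,
    so exactly one factor [w] is gained or lost. *)
Lemma contact_blowup k c x1 y1 x y y' : invertible x1 -> loc y1 -> x = w * x1 ->
  y = w * y1 -> y' = y / x - iota c -> ord 1 y' -> (0 < k)%N ->
  contact k x y' <-> contact k.+1 x y.
Proof.
move=> ux ly ex ey ey' oy' k0; have [lx x10 lxi] := ux.
have x0 : x != 0 by rewrite ex mulf_neq0 // w_neq0.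
have ox : ord 1 x by rewrite ex; apply: ord1W.
have eyx : y = x * (iota c + y') by rewrite ey'; field.
split=> [/(contact_graph ux ex oy')|/(contact_graph ux ex)].
  move=> [c' c0 hk]; exists ('X * (c%:P + c')).
    by rewrite hornerM hornerX mul0r.
  left; have -> : y - peval ('X * (c%:P + c')) x = x * (y' - peval c' x).
    rewrite eyx /peval rmorphM rmorphD /= map_polyX map_polyC !hornerE /=; ring.
  by rewrite -add1n; apply: loc_ordM.
case; first by rewrite ey; apply: ord1W.
move=> c' c0 hk; have [b [c2 [_ /(_ x) ec']]] := peval_root0_linear c0.
pose c1 := (b - c)%:P + 'X * c2.
have ec1 : peval c1 x = iota (b - c) + x * peval c2 x.
  by rewrite /peval /c1 rmorphD rmorphM /= map_polyX map_polyC !hornerE.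
have ey2 : y - peval c' x = x * (y' - peval c1 x).
  by rewrite eyx ec' ec1 rmorphB; ring.
have hk' : ord k (y' - peval c1 x).
  apply: (loc_ord_invertible ux); apply/(loc_ord_cancel 1 k).
  by rewrite expr1 mulrA -ex -ey2 add1n.
exists c1; last by left.
(* The constant term of [c1] is 0 because it lies in the radical: [y'] has order 1, and so has
   [y' - c1(x)], since [k] is positive. *)
rewrite hornerD hornerC hornerM hornerX mul0r addr0.
apply: (rad_iota (c := b - c)).
have -> : iota (b - c) = y' - (y' - peval c1 x) - x * peval c2 x by rewrite ec1; ring.
apply: ord1_rad; apply: loc_ordB; last first.
  by apply: loc_ordMr => //; apply: loc_peval; apply: loc_ord_loc ox.
by apply: loc_ordB => //; apply: loc_ord_le hk'.
Qed.

(** With contact of order 2 along [y = c x], the strict transform at [c] is again a double point: if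
    it were smooth, the implicit function theorem would give contact of every order. Hence the
    tangent cone is [d (Y - c)^2], so [c] is the only point in the first chart, while a point [c']
    of the exchanged chart satisfies [c * c' = 1], which excludes its origin. *)
Lemma blowup_step (c : K) g x y :
  immersed x y -> has_mult 2 g -> eval2 x y g = 0 ->
  ord 2 (y - iota c * x) -> (exists M, ~ contact M x y) ->
  exists (h : {mpoly K[2]}) (y' : L),
  ([/\ chart0 c 2 g h /\ h@_(mon2 0 0) = 0, has_mult 2 h, eval2 x y' h = 0,
      immersed x y' & exists M, ~ contact M x y']) /\
  ((forall k, (0 < k)%N -> (contact k x y' <-> contact k.+1 x y)) /\
   (forall h', h'@_(mon2 0 0) = 0 ->
      (forall c', chart0 c' 2 g h' -> h' = h) /\
      (forall c', chart0 c' 2 (swap g) h' -> c * c' = 1))).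
Proof.
move=> im /has_mult2P[A [B [D [eg hABD]]]] e o2 [M hM].
have [ox oy] := immersed_ord im.
case: im => x1 [y1 [lx ly ex ey [s [t [z [ls lt hz est]]]]]].
have o1 : ord 1 (y1 - iota c * x1).
  apply/(loc_ord_cancel 1 1); rewrite mulrBr expr1 -ey.
  by rewrite mulrCA -ex.
have ux := immersed_invertible lx ly ls lt hz est (ord1_rad o1).
have [_ x10 lxi] := ux.
have x0 : x != 0 by rewrite ex mulf_neq0 // w_neq0.
pose y' := y / x - iota c.
have oy' : ord 1 y'.
  have -> : y' = (y1 - iota c * x1) * x1^-1.
    by rewrite /y' ex ey; field; rewrite x10 w_neq0.
  exact: loc_ordMr.
have im' : immersed x y'.
  have [y1' ly1' ey1'] := oy'; exists x1, y1'; split=> //.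
  exists x1^-1, 0, 0; split=> //; first exact: loc0.
    by rewrite -(mulr0 w); apply/ord1_rad/ord1W/loc0.
  by rewrite mulVf // mul0r.
have hc k : (0 < k)%N -> (contact k x y' <-> contact k.+1 x y).
  by move=> k0; apply: (contact_blowup ux ly ex ey).
have fin : exists M, ~ contact M x y'.
  exists M.+1; apply: contra_not hM => /(hc _ (ltn0Sn _)).
  by apply: contact_le; rewrite ltnW.
have [h ch] := chart0_exists c A B D; rewrite -eg in ch.
have [h00 h01 h02] := chart0_coefs eg ch.
have eh : eval2 x y' h = 0.
  have := congr1 (eval2 x y') ch; rewrite eval2_comp !eval2E.
  have -> : x * (y' + iota c) = y by rewrite /y'; field.
  rewrite e => /esym/eqP; rewrite mulf_eq0 expf_eq0 /= (negPf x0) /=.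
  by move/eqP.
have h000 : h@_(mon2 0 0) = 0.
  have [zz hzz] := ord_eval2 h ox oy'; rewrite eh => /esym/eqP.
  rewrite addr_eq0 => /eqP ez; apply: rad_iota; rewrite ez.
  by apply/radN/ord1_rad.
have nm1 : ~ has_mult 1 h.
  move=> m1; case: fin => N; apply.
  by apply: contact_of_mult1 m1 ox oy' _; rewrite eh; apply: loc_ord_zero.
have h0 : h@_(mon2 1 0) = 0 /\ h@_(mon2 0 1) = 0.
  split; apply/eqP/negP => hn; apply: nm1; apply/has_mult1P; split=> //.
    by left; apply/negP.
  by right; apply/negP.
case: h0 => h100 h010.
move: h00 h01; rewrite h000 h010; set a := A@_ _; set b := B@_ _.
move: h02; set d := D@_ _ => h02 q0 q1.
have [eb ea d0] := double_root q0 q1 hABD.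
exists h, y'; split; first split=> //.
  have [A' [B' [D' eh']]] := taylor2 h.
  rewrite h000 h100 h010 mpolyC0 !scale0r !add0r in eh'.
  apply/has_mult2P; exists A', B', D'; split=> //; constructor 3.
  by have [_ [_ _ <-]] := coef2 A' B' D'; rewrite -eh' h02.
split=> // h' h'0; split=> c' ch'.
  have [] := chart0_coefs eg ch'; rewrite h'0 -/a -/b -/d ea eb => q _ _.
  have : d * (c' - c) ^+ 2 = 0 by rewrite [RHS]q; ring.
  move/eqP; rewrite mulf_eq0 (negPf d0) expf_eq0 /= subr_eq0 => /eqP ec.
  by apply: chart0_inj ch' _; rewrite ec.
have eg' : swap g = X0 ^+ 2 * swap D + X0 * X1 * swap B + X1 ^+ 2 * swap A.
  rewrite eg !swapD !swapM swapX0 swapX1; ring.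
have [] := chart0_coefs eg' ch'; rewrite h'0 !mcoeff_swap -/a -/b -/d ea eb => q _ _.
have : d * (1 - c * c') ^+ 2 = 0 by rewrite [RHS]q; ring.
move/eqP; rewrite mulf_eq0 (negPf d0) expf_eq0 /= subr_eq0 => /eqP.
by move=> <-.
Qed.

(** A tangent [x = d y] with [d] nonzero is also [y = d^-1 x]; only the tangent [x = 0] is left for
    the exchanged chart. *)
Lemma contact2_cases x y : ord 1 x -> ord 1 y -> contact 2 x y ->
  (exists c, ord 2 (y - iota c * x)) \/ ord 2 (x - iota 0 * y).
Proof.
have key (u v : L) (c : {poly K}) : c.[0] = 0 -> ord 1 u -> ord 2 (v - peval c u) ->
    exists d, ord 2 (v - iota d * u).
  move=> c0 ou hk; have [d [c2 [_ /(_ u) ec]]] := peval_root0_linear c0.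
  exists d; have -> : v - iota d * u = (v - peval c u) + u ^+ 2 * peval c2 u.
    by rewrite ec; ring.
  apply: loc_ordD => //; apply: loc_ordMr; first exact: loc_ordX.
  by apply: loc_peval; apply: loc_ord_loc ou.
move=> ox oy [c c0 [] hk]; first by left; apply: key hk.
have [d hd] := key _ _ _ c0 oy hk.
case: (eqVneq d 0) => [d0|d0]; first by right; rewrite -d0.
left; exists d^-1.
have -> : y - iota d^-1 * x = - iota d^-1 * (x - iota d * y).
  by rewrite fmorphV; field; rewrite iota_eq0.
by apply: loc_ordMl => //; apply/locN/loc_iota.
Qed.

(** The shift to [k.+1] is due to contact of order 1, which always holds since [y] has order 1.
    Without contact of order 2 all germs of the blow-up are smooth by [chart0_singular]; with it,
    [blowup_step] leaves a single germ, to which the induction hypothesis applies. *)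
Theorem smooth_after_contact k g x y : immersed x y -> has_mult 2 g ->
  eval2 x y g = 0 -> (exists M, ~ contact M x y) ->
  smooth_after k g <-> ~ contact k.+1 x y.
Proof.
elim: k g x y => [|k IH] g x y im m2 e fin.
  split=> [/= m1|[]]; first by have := has_mult_uniq m1 m2.
  by apply: contact1; case: (immersed_ord im).
have [ox oy] := immersed_ord im.
have [c2|nc2] := pselect (contact 2 x y); last first.
  split=> _.
    by apply: contra_not nc2; apply: contact_le.
  move=> h /blowup_germE[j [hj h0]].
  rewrite -(has_mult_uniq m2 hj) => hc; apply: smooth_after_mult1.
  case: hc => [[c hc]|hc].
    apply/has_mult1P; split=> //.
    case: (eqVneq h@_(mon2 1 0) 0) => [h10|]; last by left.
    case: (eqVneq h@_(mon2 0 1) 0) => [h01|]; last by right.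
    have := chart0_singular im m2 e hc h0 h10 h01 => o2; case: nc2.
    exists (c *: 'X); first by rewrite hornerZ hornerX mulr0.
    by left; rewrite pevalZ pevalX.
  rewrite -(swapK h); apply: has_mult_swap; rewrite -mcoeff_swap in h0.
  apply/has_mult1P; split=> //.
  case: (eqVneq (swap h)@_(mon2 1 0) 0) => [h10|]; last by left.
  case: (eqVneq (swap h)@_(mon2 0 1) 0) => [h01|]; last by right.
  rewrite -eval2_swap in e.
  have := chart0_singular (immersedC im) (has_mult_swap m2) e hc h0 h10 h01.
  move=> o2; case: nc2; exists (0 *: 'X); first by rewrite hornerZ hornerX mulr0.
  by right; rewrite pevalZ pevalX.
case: (contact2_cases ox oy c2) => [[c o2]|o2].
  have [h [y' [[[hc h0] mh eh im' fin'] [hct hu]]]] := blowup_step im m2 e o2 fin.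
  rewrite -hct // -(IH h) //; split.
    apply; apply/blowup_germE; exists 2; split=> //.
    by left; exists c.
  move=> hs h' /blowup_germE[j [hj h0']]; rewrite -(has_mult_uniq m2 hj).
  have [hu1 _] := hu h' h0'; rewrite -mcoeff_swap in h0'.
  have [_ hu2] := hu _ h0'.
  case=> [[c' /hu1 ->]//|/hu2 /eqP]; by rewrite mulr0 eq_sym oner_eq0.
have fin2 : exists M, ~ contact M y x.
  by case: fin => M hM; exists M => /contactC.
rewrite -eval2_swap in e.
have [h [y' [[[hc h0] mh eh im' fin'] [hct hu]]]] :=
  blowup_step (immersedC im) (has_mult_swap m2) e o2 fin2.
have -> : ~ contact k.+2 x y <-> ~ contact k.+1 y' y.
  by split; apply: contra_not => /contactC /(hct _ (ltn0Sn _)) /contactC.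
rewrite -(IH (swap h)); first last.
- by case: fin' => M hM; exists M => /contactC.
- by rewrite eval2_swap.
- exact: has_mult_swap.
- exact: immersedC.
split.
  apply; apply/blowup_germE; exists 2; split=> //; first by rewrite mcoeff_swap.
  by right; rewrite swapK.
move=> hs h' /blowup_germE[j [hj h0']]; rewrite -(has_mult_uniq m2 hj).
have [_ hu2] := hu h' h0'; rewrite -mcoeff_swap in h0'.
have [hu1 _] := hu _ h0'.
rewrite swapK in hu2; case=> [[c' /hu2 /eqP]|/hu1 ehh].
  by rewrite mul0r eq_sym oner_eq0.
by rewrite -(swapK h') ehh.
Qed.

End LocalRing.

(** * Dimension count for forms *)

Section Codimension.
Variable K : closedFieldType.

Definition mon3 (i j k : nat) : 'X_{1..3} := [multinom [tuple i; j; k]].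

Lemma mon3E i j k (u : 'I_3) : mon3 i j k u = nth 0%N [:: i; j; k] u.
Proof. by rewrite multinomE (tnth_nth 0%N). Qed.

Lemma mdeg_mon3 i j k : mdeg (mon3 i j k) = (i + j + k)%N.
Proof. by rewrite mdegE !big_ord_recl big_ord0 !mon3E /= addn0 addnA. Qed.

Lemma mon3_inj i j k i' j' k' : mon3 i j k = mon3 i' j' k' -> [/\ i = i', j = j' & k = k'].
Proof.
move/mnmP => h.
by have := h 0; have := h 1; have := h 2%:R; rewrite !mon3E.
Qed.

Lemma mnm_le_mon3 (m : 'X_{1..3}) i j k : (m <= mon3 i j k)%MM ->
  [/\ m 0%R <= i, m 1%R <= j & m 2%:R <= k]%N.
Proof.
move/mnm_lepP => h.
by have := h 0; have := h 1; have := h 2%:R; rewrite !mon3E.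
Qed.

(* [n * (d - n + 1)] distinct monomials of degree [d] that are not divisible by
   a given monomial [m] of degree [n]. *)
Definition standard_monomial (m : 'X_{1..3}) (d u v : nat) : 'X_{1..3} :=
  let a := m 0%R in let b := m 1%R in
  if (u < a)%N then mon3 u v (d - u - v)
  else if (u < a + b)%N then mon3 (a + v) (u - a) (d - (a + v) - (u - a))
  else mon3 (a + v) (d - (a + v) - (u - a - b)) (u - a - b).

Lemma mdeg3 (m : 'X_{1..3}) : mdeg m = (m 0%R + m 1%R + m 2%:R)%N.
Proof.
rewrite mdegE !big_ord_recl big_ord0 addn0 addnA.
by congr (m _ + m _ + m _)%N; apply/val_inj.
Qed.

Lemma standard_monomial_mdeg m d u v : (u < mdeg m)%N -> (v < (d - mdeg m).+1)%N ->
  (mdeg m <= d)%N -> mdeg (standard_monomial m d u v) = d.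
Proof.
rewrite mdeg3 /standard_monomial => hu hv hd.
by case: ifP => h1; [|case: ifP => h2]; rewrite mdeg_mon3; lia.
Qed.

Lemma standard_monomial_ndiv m d u v : (u < mdeg m)%N -> (v < (d - mdeg m).+1)%N ->
  (mdeg m <= d)%N -> ~~ (m <= standard_monomial m d u v)%MM.
Proof.
rewrite mdeg3 /standard_monomial => hu hv hd; apply/negP.
by case: ifP => h1; [|case: ifP => h2] => /mnm_le_mon3[]; lia.
Qed.

Lemma standard_monomial_inj m d u v u' v' :
  (u < mdeg m)%N -> (v < (d - mdeg m).+1)%N ->
  (u' < mdeg m)%N -> (v' < (d - mdeg m).+1)%N -> (mdeg m <= d)%N ->
  standard_monomial m d u v = standard_monomial m d u' v' -> u = u' /\ v = v'.
Proof.
rewrite mdeg3 /standard_monomial => hu hv hu' hv' hd.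
by case: ifP => h1; [|case: ifP => h2]; (case: ifP => h1'; [|case: ifP => h2']);
  move/mon3_inj => []; lia.
Qed.

Variables (n : nat) (F : {mpoly K[3]}) (f : 'I_3 -> {poly K}).
Hypothesis n_gt0 : (0 < n)%N.
Hypothesis F_homog : F \is n.-homog.
Hypothesis F_neq0 : F != 0.
Hypothesis size_f : forall u, (size (f u) <= n.+1)%N.
Hypothesis F_generates : forall d G, G \is d.-homog -> mmap polyC f G = 0 ->
  exists A, G = A * F.

Lemma size_mmap_mon (m : 'X_{1..3}) :
  (size (mmap polyC f 'X_[m]) <= (n * mdeg m).+1)%N.
Proof.
rewrite mmapX /mmap1 mdegE big_distrr /=.
elim/big_rec2: _ => [|i k p _ hp]; first by rewrite size_poly1.
apply: leq_trans (size_polyMleq _ _) _.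
have : (size (f i ^+ m i) <= (n * m i).+1)%N.
  apply: leq_trans (size_poly_exp_leq _ _) _; rewrite ltnS leq_mul2r.
  by rewrite -ltnS; case: (m i == 0%N) => //=; have := size_f i; case: size.
by move=> h; have := leq_add h hp; rewrite addSn addnS; case: (X in (X <= _)%N) => /=.
Qed.

Lemma nontrivial_kernel (p q : nat) (M : 'M[K]_(p, q)) : (q < p)%N ->
  exists2 a : 'rV[K]_p, a != 0 & a *m M = 0.
Proof.
move=> qp; exists (nz_row (kermx M)).
  rewrite nz_row_eq0 -mxrank_eq0 mxrank_ker subn_eq0 -ltnNge.
  exact: leq_ltn_trans (rank_leq_col _) qp.
by apply/sub_kermxP; apply: nz_row_sub.
Qed.

(* If the forms of degree [d] span at most [r] dimensions modulo [W ^+ k], then a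
   form with [n * (d - n + 1)] free coefficients which is not divisible by [F]
   would vanish on the curve as soon as [e * k] is large. *)
Lemma codim_bound (W : {poly K}) (e k r : nat) : size W = e.+1 ->
  (forall d, exists Phi : 'X_{1..3} -> 'rV[K]_r,
     forall N (a : 'I_N -> K) (m : 'I_N -> 'X_{1..3}),
     (forall i, mdeg (m i) = d) -> \sum_i a i *: Phi (m i) = 0 ->
     W ^+ k %| \sum_i a i *: mmap polyC f 'X_[m i]) ->
  (e * k <= r + n * n + 1)%N.
Proof.
move=> sW hPhi'; rewrite leqNgt; apply/negP => hk.
have W0 : W != 0 by rewrite -size_poly_gt0 sW.
(* In this degree there are [n * D] unknown coefficients. [Phi] imposes [r] conditions, the quotient
   of the pull-back by [W ^+ k] has at most [q] coefficients, and [r + q < n * D] follows from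
   [hk]. *)
pose d := (n + e * k)%N; pose D := (d - n).+1.
pose q := (n * d + 1 - e * k)%N.
have [Phi hPhi] := hPhi' d.
have mF : mdeg (mlead F) = n by apply: (dhomog_mf F_homog); apply: mlead_supp.
have hd : (n <= d)%N by rewrite leq_addr.
have D0 : (0 < D)%N by [].
pose mm (i : 'I_(n * D)) := standard_monomial (mlead F) d (i %/ D) (i %% D).
have hu (i : 'I_(n * D)) : (i %/ D < mdeg (mlead F))%N.
  by rewrite mF ltn_divLR.
have hv (i : 'I_(n * D)) : (i %% D < (d - mdeg (mlead F)).+1)%N.
  by rewrite mF ltn_mod.
have hd' : (mdeg (mlead F) <= d)%N by rewrite mF.
have mm_inj : injective mm.
  move=> i j /(standard_monomial_inj (hu i) (hv i) (hu j) (hv j) hd') [e1 e2].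
  by apply/val_inj; rewrite /= (divn_eq i D) e1 e2 -divn_eq.
have mm_deg i : mdeg (mm i) = d by apply: standard_monomial_mdeg.
pose Q i := mmap polyC f 'X_[mm i].
have [a a0 ha] : exists2 a : 'rV[K]_(n * D), a != 0 &
    a *m \matrix_i row_mx (Phi (mm i)) (poly_rV (Q i %/ W ^+ k) : 'rV_q) = 0.
  apply: nontrivial_kernel; rewrite /q /D /d; nia.
pose G : {mpoly K[3]} := \sum_i a 0 i *: 'X_[mm i].
have fG : mmap polyC f G = \sum_i a 0 i *: Q i.
  by rewrite /G raddf_sum; apply: eq_bigr => i _; rewrite /= mmapZ /= mul_polyC.
have [ha1 ha2] : \sum_i a 0 i *: Phi (mm i) = 0 /\
    \sum_i a 0 i *: (poly_rV (Q i %/ W ^+ k) : 'rV_q) = 0.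
  move: ha; rewrite mulmx_sum_row; under eq_bigr => i _ do
    rewrite rowK scale_row_mx.
  have -> : \sum_i row_mx (a 0 i *: Phi (mm i)) (a 0 i *: (poly_rV (Q i %/ W ^+ k) : 'rV_q))
    = row_mx (\sum_i a 0 i *: Phi (mm i)) (\sum_i a 0 i *: (poly_rV (Q i %/ W ^+ k) : 'rV_q)).
    elim/big_rec3: _ => [|i x y z _ ->]; first by rewrite row_mx0.
    by rewrite add_row_mx.
  by rewrite -row_mx0 => /eq_row_mx.
have fG0 : mmap polyC f G = 0.
  have div : W ^+ k %| mmap polyC f G by rewrite fG; apply: hPhi.
  rewrite -(divpK div); suff -> : mmap polyC f G %/ W ^+ k = 0 by rewrite mul0r.
  have -> : mmap polyC f G %/ W ^+ k = \sum_i a 0 i *: (Q i %/ W ^+ k).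
    rewrite fG (big_morph (fun p => p %/ W ^+ k) (id1 := 0) (op1 := +%R)).
    - by apply: eq_bigr => i _; rewrite divpZl.
    - by move=> x y; rewrite divpD.
    - by rewrite div0p.
  suff : poly_rV (\sum_i a 0 i *: (Q i %/ W ^+ k)) = 0 :> 'rV_q.
    move/(congr1 rVpoly); rewrite linear0 poly_rV_K //.
    apply: leq_trans (size_sum _ _ _) _; apply/bigmax_leqP => i _.
    apply: leq_trans (size_scale_leq _ _) _.
    rewrite size_divp ?expf_neq0 // size_exp sW /=.
    have := size_mmap_mon (mm i); rewrite mm_deg -/(Q i) /q.
    by rewrite addn1; apply: leq_sub2r.
  by rewrite linear_sum /= -[RHS]ha2; apply: eq_bigr => i _; rewrite linearZ.
have hG : G \is d.-homog.
  by apply: rpred_sum => i _; apply: rpredZ; rewrite dhomogX; apply/eqP/mm_deg.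
have [A eA] := F_generates hG fG0.
have cG i : G@_(mm i) = a 0 i.
  rewrite /G raddf_sum (bigD1 i) //= mcoeffZ mcoeffX eqxx mulr1 big1 ?addr0 // => j ji.
  by rewrite mcoeffZ mcoeffX (inj_eq mm_inj) (negPf ji) mulr0.
have G0 : G != 0.
  apply: contraNneq a0 => G0; apply/eqP/rowP => i; rewrite -cG G0 mcoeff0 mxE //.
have A0 : A != 0 by apply: contraNneq G0; rewrite eA => ->; rewrite mul0r.
(* The leading monomial of [F] divides that of its multiple [G], but [G] involves only standard
   monomials. *)
have : mlead G \in msupp G by apply: mlead_supp.
move/msupp_sum_le; case/flattenP => s /mapP[i _ ->] /msuppZ_le.
rewrite msuppX inE => /eqP eG.
have := standard_monomial_ndiv (hu i) (hv i) hd'; rewrite -/(mm i) -eG eA.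
by rewrite mleadM // lem_addl.
Qed.

End Codimension.

(** * Formal power series and branches *)

(** The wrapper gives coefficient functions a type on which equality is extensional and a ring
    structure can be declared; iterating it gives series in two variables. *)
Record fps (R : Type) := Fps { fcoef : nat -> R }.

Lemma fpsP (R : Type) (a b : fps R) : fcoef a =1 fcoef b <-> a = b.
Proof. by split=> [|->//]; case: a b => [a] [b] /= /funext ->. Qed.

HB.instance Definition _ (R : Type) := gen_eqMixin (fps R).
HB.instance Definition _ (R : Type) := gen_choiceMixin (fps R).

Section FpsRing.
Variable R : comNzRingType.
Implicit Types a b c : fps R.

Definition fps0 : fps R := Fps (fun _ => 0).
Definition fpsC (r : R) : fps R := Fps (fun n => if n is 0 then r else 0).
Definition fps_add a b : fps R := Fps (fun n => fcoef a n + fcoef b n).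
Definition fps_opp a : fps R := Fps (fun n => - fcoef a n).
Definition fps_mul a b : fps R :=
  Fps (fun n => \sum_(i < n.+1) fcoef a i * fcoef b (n - i)).

Definition fps_trunc (N : nat) a : {poly R} := \poly_(i < N) fcoef a i.

Lemma fps_mul_trunc N a b n : (n < N)%N ->
  fcoef (fps_mul a b) n = (fps_trunc N a * fps_trunc N b)`_n.
Proof.
move=> nN; rewrite coefM; apply: eq_bigr => i _; rewrite !coef_poly.
have iN : (i < N)%N by apply: leq_trans nN; rewrite ltn_ord.
by rewrite iN (leq_ltn_trans (leq_subr _ _) nN).
Qed.

Lemma fps_addA : associative fps_add.
Proof. by move=> a b c; apply/fpsP => n /=; rewrite addrA. Qed.
Lemma fps_addC : commutative fps_add.
Proof. by move=> a b; apply/fpsP => n /=; rewrite addrC. Qed.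
Lemma fps_add0 : left_id fps0 fps_add.
Proof. by move=> a; apply/fpsP => n /=; rewrite add0r. Qed.
Lemma fps_addN : left_inverse fps0 fps_opp fps_add.
Proof. by move=> a; apply/fpsP => n /=; rewrite addNr. Qed.

HB.instance Definition _ :=
  GRing.isZmodule.Build (fps R) fps_addA fps_addC fps_add0 fps_addN.

Lemma fps_mulC : commutative fps_mul.
Proof.
move=> a b; apply/fpsP => n.
by rewrite !(fps_mul_trunc _ _ (ltnSn n)) mulrC.
Qed.

Lemma fps_mulA : associative fps_mul.
Proof.
move=> a b c; apply/fpsP => n; rewrite !(fps_mul_trunc _ _ (ltnSn n)).
have h u v (i : nat) : (i < n.+1)%N -> (fps_trunc n.+1 (fps_mul u v))`_i =
    (fps_trunc n.+1 u * fps_trunc n.+1 v)`_i.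
  by move=> hi; rewrite coef_poly hi; apply: fps_mul_trunc.
have -> : (fps_trunc n.+1 a * fps_trunc n.+1 (fps_mul b c))`_n
    = (fps_trunc n.+1 a * (fps_trunc n.+1 b * fps_trunc n.+1 c))`_n.
  rewrite coefM [RHS]coefM; apply: eq_bigr => i _; congr (_ * _).
  by apply: h; rewrite ltnS leq_subr.
rewrite mulrA coefM [RHS]coefM; apply: eq_bigr => i _; congr (_ * _).
by rewrite h.
Qed.

Lemma fps_mul1 : left_id (fpsC 1) fps_mul.
Proof.
move=> a; apply/fpsP => n /=; rewrite big_ord_recl /= subn0 mul1r big1 ?addr0 //.
by move=> i _; rewrite mul0r.
Qed.

Lemma fps_mulDl : left_distributive fps_mul fps_add.
Proof.
move=> a b c; apply/fpsP => n /=; rewrite -big_split /=.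
by apply: eq_bigr => i _; rewrite mulrDl.
Qed.

Lemma fps_1neq0 : fpsC 1 != 0 :> fps R.
Proof. by apply/eqP => /fpsP/(_ 0%N) /= /eqP; rewrite oner_eq0. Qed.

HB.instance Definition _ := GRing.Zmodule_isComNzRing.Build (fps R)
  fps_mulA fps_mulC fps_mul1 fps_mulDl fps_1neq0.

Lemma fcoefD a b n : fcoef (a + b) n = fcoef a n + fcoef b n. Proof. by []. Qed.
Lemma fcoefB a b n : fcoef (a - b) n = fcoef a n - fcoef b n. Proof. by []. Qed.
Lemma fcoefM a b n :
  fcoef (a * b) n = \sum_(i < n.+1) fcoef a i * fcoef b (n - i).
Proof. by []. Qed.
Lemma fcoef_sum (I : Type) (r : seq I) (P : pred I) (f : I -> fps R) n :
  fcoef (\sum_(i <- r | P i) f i) n = \sum_(i <- r | P i) fcoef (f i) n.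
Proof. by elim/big_rec2: _ => // i y z _ <-. Qed.

Lemma fcoef0M a b : fcoef (a * b) 0 = fcoef a 0 * fcoef b 0.
Proof. by rewrite fcoefM big_ord_recl big_ord0 addr0. Qed.

Lemma fcoef1M a b :
  fcoef (a * b) 1 = fcoef a 0 * fcoef b 1 + fcoef a 1 * fcoef b 0.
Proof. by rewrite fcoefM !big_ord_recl big_ord0 addr0. Qed.

Lemma fcoef2M a b : fcoef (a * b) 2 =
  fcoef a 0 * fcoef b 2 + (fcoef a 1 * fcoef b 1 + fcoef a 2 * fcoef b 0).
Proof. by rewrite fcoefM !big_ord_recl big_ord0 addr0. Qed.

Lemma fcoefM_low a b k l n : (forall i, (i < k)%N -> fcoef a i = 0) ->
  (forall i, (i < l)%N -> fcoef b i = 0) -> (n < k + l)%N -> fcoef (a * b) n = 0.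
Proof.
move=> ha hb hn; rewrite fcoefM big1 // => i _.
case: (ltnP i k) => ik; first by rewrite ha ?mul0r.
by rewrite hb ?mulr0 //; have := ltn_ord i; lia.
Qed.

Lemma fcoefX_low a k n : fcoef a 0 = 0 -> (n < k)%N -> fcoef (a ^+ k) n = 0.
Proof.
move=> a0; elim: k n => [|k IH] n // hn; rewrite exprS.
apply: (@fcoefM_low _ _ 1 k) => //; by case.
Qed.

(** Geometric series: [v = 1 - u a] has no constant term, so [v ^+ k] contributes nothing below
    index [k], and each coefficient of the sum of all powers is a finite sum. *)
Lemma fps_inverse a (u : R) : fcoef a 0 * u = 1 -> exists b, a * b = 1.
Proof.
move=> hu; pose v : fps R := 1 - fpsC u * a.
have v0 : fcoef v 0 = 0 by rewrite fcoefB fcoef0M /= mulrC hu subrr.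
pose s N := \sum_(k < N) v ^+ k.
have sE N : fpsC u * a * s N = 1 - v ^+ N.
  have -> : fpsC u * a = 1 - v by rewrite /v subKr.
  by rewrite -[1 in RHS](expr1n _ N) subrXX; congr (_ * _); apply: eq_bigr => i _;
    rewrite expr1n mul1r.
have sN N n : (n < N)%N -> fcoef (s N) n = fcoef (s n.+1) n.
  move=> nN; rewrite /s -(subnKC nN) big_split_ord fcoefD [X in _ + X](_ : _ = 0) ?addr0 //.
  by rewrite fcoef_sum big1 // => i _; apply: fcoefX_low => //; rewrite ltn_addr.
exists (fpsC u * Fps (fun n => fcoef (s n.+1) n)).
rewrite mulrA [a * _]mulrC; apply/fpsP => n.
have -> : fcoef (fpsC u * a * Fps (fun n => fcoef (s n.+1) n)) n
    = fcoef (fpsC u * a * s n.+1) n.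
  rewrite !fcoefM; apply: eq_bigr => i _; congr (_ * _) => /=.
  by rewrite (sN n.+1) // ltnS leq_subr.
by rewrite sE fcoefB fcoefX_low // subr0.
Qed.

End FpsRing.

(** * Division by the equation [y - gam(x)] of a smooth branch *)

Section Weierstrass.
Variable K : comNzRingType.
Implicit Types (c : fps (fps K)) (gam : fps K).

Definition graph_eq gam : fps (fps K) :=
  Fps (fun n => match n with 0 => - gam | 1 => 1 | _ => 0 end).

Lemma fcoef_graphM gam c n : fcoef (graph_eq gam * c) n =
  (if n is n'.+1 then fcoef c n' else 0) - gam * fcoef c n.
Proof.
rewrite fcoefM big_ord_recl /= subn0 mulNr addrC; congr (_ - _).
case: n => [|n]; first by rewrite big_ord0.
rewrite big_ord_recl /= mul1r subSS subn0 big1 ?addr0 // => i _.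
by rewrite mul0r.
Qed.

(* The quotient has coefficients [sum_b c_(a+b+1) gam^b], a sum which converges
   because [gam] has no constant term. *)
Lemma graph_division gam c : fcoef gam 0 = 0 -> exists (r : fps (fps K)) (rho : fps K),
  c = graph_eq gam * r + fpsC rho.
Proof.
move=> g0; pose s a N := \sum_(b < N) fcoef c (a + b) * gam ^+ b.
pose S a : fps K := Fps (fun n => fcoef (s a n.+1) n).
have sN a N n : (n < N)%N -> fcoef (s a N) n = fcoef (S a) n.
  move=> nN; rewrite /S /= /s -(subnKC nN) big_split_ord fcoefD.
  rewrite [X in _ + X](_ : _ = 0) ?addr0 //.
  rewrite fcoef_sum big1 // => i _.
  apply: (@fcoefM_low _ _ _ 0 n.+1) => // j hj.
  by apply: fcoefX_low => //; rewrite (leq_trans hj) // leq_addr.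
have rec a : S a = fcoef c a + gam * S a.+1.
  apply/fpsP => n; rewrite -(sN a n.+2 n) ?ltnS // /s big_ord_recl addn0 expr0 mulr1.
  rewrite !fcoefD; congr (_ + _).
  have -> : \sum_(i < n.+1) fcoef c (a + bump 0 i) * gam ^+ bump 0 i = gam * s a.+1 n.+1.
    rewrite /s mulr_sumr; apply: eq_bigr => i _.
    by rewrite /bump /= add1n exprS mulrCA addnS addSn.
  rewrite !fcoefM; apply: eq_bigr => i _; congr (_ * _).
  by rewrite sN // ltnS leq_subr.
exists (Fps (fun a => S a.+1)), (S 0%N); apply/fpsP => n.
rewrite fcoefD fcoef_graphM /=; case: n => [|n].
  by rewrite add0r (rec 0%N) addrC addrK.
by rewrite addr0 (rec n.+1) addrK.
Qed.

(** The equation gives $c_a=\gamma c_{a+1}$, hence $c_a=\gamma^kc_{a+k}$ for every [k], and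
    $\gamma^k$ has no terms of index below [k]. *)
Lemma graph_lreg gam c : fcoef gam 0 = 0 -> graph_eq gam * c = 0 -> c = 0.
Proof.
move=> g0 e.
have h a : fcoef c a = gam * fcoef c a.+1.
  have := fcoef_graphM gam c a.+1; rewrite e => /esym/eqP; rewrite subr_eq0.
  by move/eqP.
have hk a k : fcoef c a = gam ^+ k * fcoef c (a + k).
  elim: k a => [|k IH] a; first by rewrite expr0 mul1r addn0.
  by rewrite h (IH a.+1) mulrA -exprS addSnnS.
apply/fpsP => a; apply/fpsP => n; rewrite (hk a n.+1).
by apply: (@fcoefM_low _ _ _ n.+1 0); rewrite ?addn0 // => i hi; apply: fcoefX_low.
Qed.

End Weierstrass.

(** * Factorization of power series in two variables *)

Section BivariateSeries.
Variable K : closedFieldType.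
Local Notation S := (fps (fps K)).
Implicit Types (a b c s t : S) (p q : {mpoly K[2]}).

(** The outer variable is [y]: a series is expanded in powers of [y] over [K[[x]]], as division by
    [y - gam(x)] requires. The indices keep the order used in [ps2]. *)
Definition coef2f (s : S) (i j : nat) : K := fcoef (fcoef s j) i.

Lemma coef2f_ext s t : coef2f s =2 coef2f t -> s = t.
Proof. by move=> h; apply/fpsP => j; apply/fpsP => i; apply: h. Qed.

Lemma coef2fM s t i j : coef2f (s * t) i j =
  \sum_(k < i.+1) \sum_(l < j.+1) coef2f s k l * coef2f t (i - k) (j - l).
Proof.
by rewrite /coef2f fcoefM fcoef_sum exchange_big; apply: eq_bigr => l _.
Qed.

Lemma coef2fM00 a b : coef2f (a * b) 0 0 = coef2f a 0 0 * coef2f b 0 0.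
Proof. by rewrite /coef2f !fcoef0M. Qed.

Lemma coef2fM10 a b : coef2f (a * b) 1 0 =
  coef2f a 0 0 * coef2f b 1 0 + coef2f a 1 0 * coef2f b 0 0.
Proof. by rewrite /coef2f fcoef0M fcoef1M. Qed.

Lemma coef2fM01 a b : coef2f (a * b) 0 1 =
  coef2f a 0 0 * coef2f b 0 1 + coef2f a 0 1 * coef2f b 0 0.
Proof. by rewrite /coef2f fcoef1M fcoefD !fcoef0M. Qed.

Lemma coef2fM_deg2 a b : coef2f a 0 0 = 0 -> coef2f b 0 0 = 0 ->
  coef2f b 1 0 = 0 -> coef2f b 0 1 = 0 ->
  [/\ coef2f (a * b) 2 0 = 0, coef2f (a * b) 1 1 = 0 & coef2f (a * b) 0 2 = 0].
Proof.
rewrite /coef2f => a0 b0 b1 b2; split.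
- by rewrite fcoef0M fcoef2M a0 b0 b1 !mulr0 mul0r !addr0.
- by rewrite fcoef1M fcoefD !fcoef1M a0 b0 b1 b2 !mulr0 mul0r !addr0.
- by rewrite fcoef2M !fcoefD !fcoef0M a0 b0 b2 !mulr0 mul0r !addr0.
Qed.

Definition s_unit s := exists t, s * t = 1.

Lemma s_unitP s : s_unit s <-> coef2f s 0 0 != 0.
Proof.
split=> [[t e]|s0].
  apply/eqP => s0; have := coef2fM00 s t; rewrite e s0 mul0r => /eqP.
  by rewrite oner_eq0.
have [u hu] := fps_inverse (divff s0); exact: fps_inverse hu.
Qed.

Lemma s_unitM s t : s_unit s -> s_unit t -> s_unit (s * t).
Proof. by rewrite !s_unitP coef2fM00 => hs ht; rewrite mulf_neq0. Qed.

Definition s_irreducible s :=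
  ~ s_unit s /\ forall b c, b * c = s -> s_unit b \/ s_unit c.

Definition s_assoc s t := exists2 u, s_unit u & u * s = t.

Lemma s_assoc_sym s t : s_assoc s t -> s_assoc t s.
Proof.
move=> [u [v e] <-]; exists v; first by exists u; rewrite mulrC.
by rewrite mulrA [v * u]mulrC e mul1r.
Qed.

Lemma s_assoc_trans s t c : s_assoc s t -> s_assoc t c -> s_assoc s c.
Proof.
by move=> [u hu <-] [v hv <-]; exists (v * u); rewrite ?mulrA //; apply: s_unitM.
Qed.

Definition s_mult1 s := coef2f s 0 0 = 0 /\ (coef2f s 1 0 != 0 \/ coef2f s 0 1 != 0).

Lemma mult1_irreducible s : s_mult1 s -> s_irreducible s.
Proof.
move=> [s0 s1]; split; first by rewrite s_unitP s0 eqxx.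
move=> b c e; have [hb|hb] := pselect (s_unit b); first by left.
have [hc|hc] := pselect (s_unit c); first by right.
move: hb hc; rewrite !s_unitP => /negP; rewrite negbK => /eqP b0 /negP.
rewrite negbK => /eqP c0; move: s1.
by rewrite -e coef2fM10 coef2fM01 b0 c0 !mulr0 !mul0r !addr0 eqxx => -[].
Qed.

Definition s_branches (r : nat) (s : S) : Prop :=
  exists b : 'I_r -> S,
    [/\ forall i, s_irreducible (b i) /\ (exists c, b i * c = s),
        forall i j, i != j -> ~ s_assoc (b i) (b j) &
        forall c, s_irreducible c -> (exists d, c * d = s) ->
          exists i, s_assoc c (b i)].

(** Two distinct branches would both be associated with the single one. This turns the implications
    from the roots to the number of branches into equivalences. *)
Lemma s_branches_uniq s : s_branches 1 s -> ~ s_branches 2 s.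
Proof.
move=> [b [hb _ ub]] [c [hc nc _]].
have [i hi] : exists i, s_assoc (c 0) (b i) by case: (hc 0) => h1 h2; apply: ub.
have [j hj] : exists i, s_assoc (c 1) (b i) by case: (hc 1) => h1 h2; apply: ub.
apply: (nc 0 1) => //; apply: s_assoc_trans hi _; apply: s_assoc_sym.
by rewrite [i]ord1 -[0](ord1 j).
Qed.

Lemma s_branches_irreducible s : s_irreducible s -> s_branches 1 s.
Proof.
move=> [s0 s1]; exists (fun=> s); split.
- by move=> i; split=> //; exists 1; rewrite mulr1.
- by move=> i j; rewrite [i]ord1 [j]ord1 eqxx.
- move=> c [c0 _] [d e]; exists 0.
  by case: (s1 _ _ e) => // hd; exists d => //; rewrite mulrC.
Qed.

Lemma s_branches_two s b h : s_mult1 b -> s_mult1 h -> s = b * h ->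
  ~ s_assoc b h ->
  (forall c, s_irreducible c -> (exists d, c * d = s) ->
     s_assoc c b \/ s_assoc c h) -> s_branches 2 s.
Proof.
move=> mb mh es nbh hc; pose B (i : 'I_2) := if i == 0 then b else h.
exists B; split.
- move=> i; rewrite /B; case: ifP => _; split; try exact: mult1_irreducible.
    by exists h.
  by exists b; rewrite mulrC.
- case=> [[|[|[]]]] // ? [[|[|[]]]] // ? _; rewrite /B //=.
  by move/s_assoc_sym.
- move=> c ic dc; case: (hc c ic dc) => hcc; first by exists 0.
  by exists 1.
Qed.

Definition embed (a : ps2 K) : S := Fps (fun j => Fps (fun i => a i j)).

Lemma coef2f_embed (a : ps2 K) i j : coef2f (embed a) i j = a i j. Proof. by []. Qed.

Section Transfer.
Variable theta : ps2 K -> S.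
Hypothesis thetaM : forall a b : ps2 K, theta (ps_mul a b) = theta a * theta b.
Hypothesis theta1 : theta (@ps_one K) = 1.
Hypothesis thetaE : forall a b : ps2 K, theta a = theta b <-> a =2 b.
Hypothesis theta_surj : forall s, exists a : ps2 K, theta a = s.

Lemma ps_unit_transfer (a : ps2 K) : ps_unit a <-> s_unit (theta a).
Proof.
split=> [[b /thetaE e]|[t]]; first by exists (theta b); rewrite -thetaM e.
by have [b <-] := theta_surj t; rewrite -thetaM -theta1 => /thetaE e; exists b.
Qed.

Lemma ps_dvd_transfer (a b : ps2 K) : ps_dvd a b <-> exists c, theta a * c = theta b.
Proof.
split=> [[c /thetaE e]|[t]]; first by exists (theta c); rewrite -thetaM.
by have [c <-] := theta_surj t; rewrite -thetaM => /thetaE e; exists c.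
Qed.

Lemma ps_irreducible_transfer (a : ps2 K) : ps_irreducible a <-> s_irreducible (theta a).
Proof.
rewrite /ps_irreducible /s_irreducible ps_unit_transfer; split=> -[h1 h2]; split=> //.
  move=> b c; have [b' <-] := theta_surj b; have [c' <-] := theta_surj c.
  by rewrite -thetaM -!ps_unit_transfer => /thetaE; apply: h2.
by move=> b c /thetaE; rewrite thetaM !ps_unit_transfer; apply: h2.
Qed.

Lemma ps_assoc_transfer (a b : ps2 K) : ps_assoc a b <-> s_assoc (theta a) (theta b).
Proof.
split=> [[u /ps_unit_transfer hu /thetaE e]|[t]].
  by exists (theta u); rewrite -?thetaM.
have [u <-] := theta_surj t; rewrite -ps_unit_transfer -thetaM => hu /thetaE e.
by exists u.
Qed.

(** The bijection [theta] is abstract because two of them are used: [embed], and [embed_swap], which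
    exchanges the variables so that a branch tangent to the [y]-axis becomes a graph. *)
Lemma has_branches_transfer r (g : {mpoly K[2]}) :
  has_branches r g <-> s_branches r (theta (ps_of_mpoly g)).
Proof.
split=> -[b [h1 h2 h3]].
  exists (theta \o b); split.
  - by move=> i; rewrite -ps_irreducible_transfer -ps_dvd_transfer.
  - by move=> i j ij; rewrite -ps_assoc_transfer; apply: h2.
  - move=> c; have [c' <-] := theta_surj c.
    rewrite -ps_irreducible_transfer -ps_dvd_transfer => ic dc.
    by have [i] := h3 _ ic dc; exists i; rewrite -ps_assoc_transfer.
have [b' hb'] : exists b' : 'I_r -> ps2 K, forall i, theta (b' i) = b i.
  by have [f hf] := choice (fun i => theta_surj (b i)); exists f.
exists b'; split.
- by move=> i; rewrite ps_irreducible_transfer ps_dvd_transfer hb'; apply: h1.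
- by move=> i j ij; rewrite ps_assoc_transfer !hb'; apply: h2.
- move=> c; rewrite ps_irreducible_transfer ps_dvd_transfer => ic dc.
  by have [i] := h3 _ ic dc; exists i; rewrite ps_assoc_transfer hb'.
Qed.

End Transfer.

Lemma embedM (a b : ps2 K) : embed (ps_mul a b) = embed a * embed b.
Proof. by apply: coef2f_ext => i j; rewrite coef2fM. Qed.

Lemma embed1 : embed (@ps_one K) = 1.
Proof. by apply: coef2f_ext => -[|i] [|j]. Qed.

Lemma embedE (a b : ps2 K) : embed a = embed b <-> a =2 b.
Proof.
split=> [e i j|e]; first by rewrite -(coef2f_embed a) e.
by apply: coef2f_ext => i j; rewrite !coef2f_embed.
Qed.

Lemma embed_surj s : exists a : ps2 K, embed a = s.
Proof. by exists (coef2f s); apply: coef2f_ext. Qed.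

Definition embed_swap (a : ps2 K) : S := embed (fun i j => a j i).

Lemma embed_swapM (a b : ps2 K) : embed_swap (ps_mul a b) = embed_swap a * embed_swap b.
Proof. by rewrite -embedM; apply/embedE => i j; rewrite /ps_mul exchange_big. Qed.

Lemma embed_swap1 : embed_swap (@ps_one K) = 1.
Proof. by apply: coef2f_ext => -[|i] [|j]. Qed.

Lemma embed_swapE (a b : ps2 K) : embed_swap a = embed_swap b <-> a =2 b.
Proof. by rewrite embedE; split=> e i j; apply: e. Qed.

Lemma embed_swap_surj s : exists a : ps2 K, embed_swap a = s.
Proof. by exists (fun i j => coef2f s j i); apply: coef2f_ext. Qed.

Definition series_of (g : {mpoly K[2]}) : S := embed (ps_of_mpoly g).

Lemma coef2f_series_of g i j : coef2f (series_of g) i j = g@_(mon2 i j).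
Proof. by []. Qed.

Lemma has_branchesE r g : has_branches r g <-> s_branches r (series_of g).
Proof. exact: (has_branches_transfer embedM embed1 embedE embed_surj). Qed.

Lemma has_branches_swap r g : has_branches r g <-> s_branches r (series_of (swap g)).
Proof.
rewrite (has_branches_transfer embed_swapM embed_swap1 embed_swapE embed_swap_surj).
suff -> : embed_swap (ps_of_mpoly g) = series_of (swap g) by [].
by apply: coef2f_ext => i j; rewrite coef2f_series_of mcoeff_swap.
Qed.

(** A series has no value in [L]. It is evaluated through polynomials with the same coefficients in
    the box [i, j < N]; since [x] and [y] have order 1, the choice among them changes the value by
    an element of order [N]. *)
Definition agree (N : nat) p s := forall i j, (i < N)%N -> (j < N)%N ->
  p@_(mon2 i j) = coef2f s i j.

Lemma mcoeffM2 p q i j : (p * q)@_(mon2 i j) =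
  \sum_(k < i.+1) \sum_(l < j.+1) p@_(mon2 k l) * q@_(mon2 (i - k) (j - l)).
Proof.
elim/mpolyind: p => [|c m p _ _ IH].
  rewrite mul0r mcoeff0 big1 // => k _; rewrite big1 // => l _.
  by rewrite mcoeff0 mul0r.
rewrite mulrDl mcoeffD {}IH.
under [RHS]eq_bigr => k _ do under eq_bigr => l _ do rewrite mcoeffD mulrDl.
under [RHS]eq_bigr => k _ do rewrite big_split.
rewrite [RHS]big_split /=; congr (_ + _).
rewrite (mon2P m); move: (m 0%R) (m 1%R) => u v.
rewrite -scalerAl mcoeffZ mulrC [_ * q]mulrC mcoeffM_mon2.
case: ifP => [/andP[ui vj]|uv]; last first.
  rewrite mul0r big1 // => k _; rewrite big1 // => l _.
  rewrite mcoeffZ mcoeffX mon2_eq; case: eqP => [eu|]; last by rewrite mulr0 mul0r.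
  case: eqP => [ev|]; last by rewrite mulr0 mul0r.
  by move: uv; rewrite eu ev -[(k <= i)%N]ltnS -[(l <= j)%N]ltnS !ltn_ord.
rewrite -ltnS in ui; rewrite -ltnS in vj.
rewrite (bigD1 (Ordinal ui)) //= (bigD1 (Ordinal vj)) //= mcoeffZ mcoeffX eqxx mulr1.
rewrite mulrC big1 ?addr0 => [|l lv]; last first.
  rewrite mcoeffZ mcoeffX mon2_eq eqxx /= [v == _]eq_sym.
  by rewrite (_ : (nat_of_ord l == v) = false) ?mulr0 ?mul0r //; apply: negPf lv.
rewrite big1 ?addr0 // => k ku; rewrite big1 // => l _.
rewrite mcoeffZ mcoeffX mon2_eq [u == _]eq_sym.
by rewrite (_ : (nat_of_ord k == u) = false) ?mulr0 ?mul0r //; apply: negPf ku.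
Qed.

Lemma agreeM N p q s t : agree N p s -> agree N q t -> agree N (p * q) (s * t).
Proof.
move=> hp hq i j iN jN; rewrite mcoeffM2 coef2fM.
apply: eq_bigr => k _; apply: eq_bigr => l _; rewrite hp ?hq //.
- exact: leq_ltn_trans (leq_subr _ _) iN.
- exact: leq_ltn_trans (leq_subr _ _) jN.
- by apply: leq_trans iN; rewrite ltn_ord.
- by apply: leq_trans jN; rewrite ltn_ord.
Qed.

Lemma agreeB N p q s t : agree N p s -> agree N q t -> agree N (p - q) (s - t).
Proof. by move=> hp hq i j iN jN; rewrite mcoeffB hp ?hq. Qed.

Lemma agree_exists N s : exists p, agree N p s.
Proof.
exists (\sum_(i < N) \sum_(j < N) coef2f s i j *: 'X_[mon2 i j]) => i j iN jN.
rewrite raddf_sum (bigD1 (Ordinal iN)) //= raddf_sum (bigD1 (Ordinal jN)) //=.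
rewrite mcoeffZ mcoeffX eqxx mulr1 !big1 ?addr0 // => [k ki|l lj].
  rewrite raddf_sum big1 // => l _ /=; rewrite mcoeffZ mcoeffX mon2_eq.
  by rewrite (_ : (nat_of_ord k == i) = false) ?mulr0 //; apply: negPf ki.
rewrite mcoeffZ mcoeffX mon2_eq.
by rewrite (_ : (nat_of_ord l == j) = false) ?andbF ?mulr0 //; apply: negPf lj.
Qed.

End BivariateSeries.

(** * Series that vanish along a parametrized branch *)

Section VanishingSeries.
Variables (K : closedFieldType) (L : fieldType).
Variable phi : {rmorphism {poly K} -> L}.
Hypothesis phi_inj : injective phi.
Variable rs : seq K.
Variables x y : L.
Hypothesis ox : loc_ord phi rs 1 x.
Hypothesis oy : loc_ord phi rs 1 y.
Local Notation S := (fps (fps K)).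
Implicit Types (a b c s t : S) (p q : {mpoly K[2]}).
Local Notation ord := (loc_ord phi rs).

Lemma ord_low_terms N p : agree N p 0 -> ord N (eval2 phi x y p).
Proof.
move=> hp; rewrite /eval2 /mmap; rewrite big_seq_cond; apply: loc_ord_sum => // m.
rewrite andbT mcoeff_msupp (mon2P m) => pm.
rewrite -(mmapX (pair2 x y) (iota phi)) mpolyX_mon2 -/(eval2 phi x y _) !eval2E.
have [iN|iN] := leqP N (m 0%R).
  apply: loc_ordMl => //; first exact: loc_iota.
  apply: loc_ordMr => //; last by apply/locX/loc_ord_loc/oy.
  by apply: (loc_ord_le phi_inj iN); apply: loc_ordX.
have [jN|jN] := leqP N (m 1%R); last by rewrite hp ?eqxx in pm.
apply: loc_ordMl => //; first exact: loc_iota.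
apply: loc_ordMl => //; first by apply/locX/loc_ord_loc/ox.
by apply: (loc_ord_le phi_inj jN); apply: loc_ordX.
Qed.

(* [s] vanishes on the branch parametrized by [(x, y)]. *)
Definition vanishes s := forall N, exists2 p, agree N p s & ord N (eval2 phi x y p).

Lemma vanishes_ord s N p : vanishes s -> agree N p s -> ord N (eval2 phi x y p).
Proof.
move=> /(_ N)[q hq oq] hp; rewrite -[eval2 _ _ _ _](subrK (eval2 phi x y q)).
apply: loc_ordD => //; rewrite -eval2B; apply: ord_low_terms.
by rewrite -(subrr s); apply: agreeB.
Qed.

Lemma vanishesB s t : vanishes s -> vanishes t -> vanishes (s - t).
Proof.
move=> hs ht N; have [p hp op] := hs N; have [q hq oq] := ht N.
by exists (p - q); [apply: agreeB|rewrite eval2B; apply: loc_ordB].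
Qed.

Lemma vanishesMr s t : vanishes s -> vanishes (s * t).
Proof.
move=> hs N; have [p hp op] := hs N; have [q hq] := agree_exists N t.
exists (p * q); first exact: agreeM.
rewrite eval2M; apply: loc_ordMr => //; apply: loc_eval2 => //.
  exact: loc_ord_loc ox.
exact: loc_ord_loc oy.
Qed.

Lemma vanishes_series_of g : eval2 phi x y g = 0 -> vanishes (series_of g).
Proof. by move=> e N; exists g => //; rewrite e; apply: loc_ord_zero. Qed.

End VanishingSeries.

Section OneBranch.
Variables (K : closedFieldType) (L : fieldType).
Variable phi : {rmorphism {poly K} -> L}.
Hypothesis phi_inj : injective phi.
Variable tau : K.
Local Notation ord := (loc_ord phi [:: tau]).
Local Notation loc := (loc phi [:: tau]).
Local Notation rad := (rad phi [:: tau]).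
Local Notation invertible := (loc_invertible phi [:: tau]).
Local Notation w := (phi (root_poly [:: tau])).
Local Notation S := (fps (fps K)).

Lemma root_poly1 : root_poly [:: tau] = 'X - tau%:P.
Proof. by rewrite /root_poly big_seq1. Qed.

Lemma rad1_ord1 z : rad z -> ord 1 z.
Proof.
move=> [p [q [hq hp ->]]].
have /factor_theorem[p' ->] : root p tau by apply/rootP/hp; rewrite inE.
exists (phi p' / phi q); first by exists p', q.
by rewrite root_poly1 expr1 rmorphM mulrA [phi p' * _]mulrC.
Qed.

Lemma loc1_invertible z : loc z -> ~ rad z -> invertible z.
Proof.
move=> [p [q [hq ->]]] nr; have p0 : p.[tau] != 0.
  apply/eqP => p0; apply: nr; exists p, q; split=> // r.
  by rewrite inE => /eqP ->.
have hp : loc_unit [:: tau] p.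
  split=> [|r]; last by rewrite inE => /eqP ->.
  by apply: contraNneq p0 => ->; rewrite horner0.
split; first by exists p, q.
  by rewrite mulf_neq0 ?invr_eq0 ?(loc_unit_phi phi_inj hp) ?(loc_unit_phi phi_inj hq).
by exists q, p; rewrite invf_div.
Qed.

Lemma loc1_valuation z : loc z -> z != 0 ->
  exists k u, invertible u /\ z = w ^+ k * u.
Proof.
move=> [p [q [hq ->]]]; rewrite mulf_eq0 negb_or => /andP[p0 _].
rewrite (phi_eq0 phi_inj) in p0.
have [k [p' hp' ->]] := multiplicity_XsubC p tau; rewrite p0 /= in hp'.
exists k, (phi p' / phi q); split; last first.
  by rewrite root_poly1 rmorphM rmorphXn [phi p' * _]mulrC mulrA.
apply: loc1_invertible; first by exists p', q.
move=> [p1 [q1 [hq1 hp1 e]]]; move: hp'; rewrite /root.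
have {}e : p' * q1 = p1 * q.
  apply: phi_inj; rewrite !rmorphM.
  have -> : phi p' = phi p' / phi q * phi q.
    by rewrite divfK // (loc_unit_phi phi_inj hq).
  by rewrite e; field; rewrite (loc_unit_phi phi_inj hq1).
have ht : tau \in [:: tau] by rewrite inE.
have := congr1 (horner^~ tau) e; rewrite !hornerM hp1 // mul0r => /eqP.
rewrite mulf_eq0 => /orP[->//|]; case: hq1 => _ /(_ _ ht).
by move/negPf ->.
Qed.

Lemma ord_bound N k u : invertible u -> ord N (w ^+ k * u) -> (N <= k)%N.
Proof.
move=> hu; rewrite leqNgt => h; apply/negP => kN; move: h.
rewrite -(subnKC (ltnW kN)) => /(loc_ord_cancel phi_inj) ho.
apply: (loc_invertible_not_rad phi_inj _ hu) => //.
by apply: (ord1_rad phi_inj); apply: (loc_ord_le phi_inj) ho; rewrite subn_gt0.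
Qed.

Variables x y : L.
Hypothesis ox : ord 1 x.
Hypothesis oy : ord 1 y.
Local Notation vanishes := (vanishes phi [:: tau] x y).

(** At a single point every nonzero element of [loc] is a power of [w] times a unit. If neither [s]
    nor [t] vanishes, their approximations have orders below fixed bounds [N1] and [N2], so those of
    the product have order below [N1 + N2]. *)
Lemma vanishes_prime (s t : S) : vanishes (s * t) -> vanishes s \/ vanishes t.
Proof.
have key (a : S) : ~ vanishes a -> exists N0, forall N p, (N0 <= N)%N -> agree N p a ->
    exists k u, [/\ invertible u, eval2 phi x y p = w ^+ k * u & (k < N0)%N].
  move=> na; have [N0 hN0] : exists N0, ~ exists2 p, agree N0 p a & ord N0 (eval2 phi x y p).
    by apply/existsNP.
  exists N0 => N p hN hp.
  have hp0 : agree N0 p a by move=> i j iN jN; apply: hp; apply: leq_trans hN.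
  have np : ~ ord N0 (eval2 phi x y p) by move=> op; apply: hN0; exists p.
  have lp : loc (eval2 phi x y p).
    by apply: (loc_eval2 phi_inj); [apply: loc_ord_loc ox|apply: loc_ord_loc oy].
  have p0 : eval2 phi x y p != 0.
    by apply/eqP => p0; apply: np; rewrite p0; apply: loc_ord_zero.
  have [k [u [hu e]]] := loc1_valuation lp p0; exists k, u; split=> //.
  rewrite ltnNge; apply/negP => hk; apply: np; rewrite e.
  apply: (loc_ord_le phi_inj hk); exists u => //; by case: hu.
move=> hst; have [|ns] := pselect (vanishes s); first by left.
have [|nt] := pselect (vanishes t); first by right.
have [N1 h1] := key _ ns; have [N2 h2] := key _ nt.
have [p hp] := agree_exists (N1 + N2) s; have [q hq] := agree_exists (N1 + N2) t.
have [k [u [hu eu hk]]] := h1 _ _ (leq_addr _ _) hp.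
have [l [v [hv ev hl]]] := h2 _ _ (leq_addl _ _) hq.
have := vanishes_ord phi_inj ox oy hst (agreeM hp hq).
rewrite eval2M eu ev mulrACA -exprD.
have huv : invertible (u * v).
  case: hu => [lu u0 iu]; case: hv => [lv v0 iv]; split.
  - exact: (locM phi_inj).
  - by rewrite mulf_neq0.
  - by rewrite invfM; apply: (locM phi_inj).
by move/(ord_bound huv); rewrite leqNgt -addSn leq_add // ltnW.
Qed.

Variable x1 : L.
Hypothesis ix1 : invertible x1.
Hypothesis ex : x = w * x1.

(** Since [x] has order exactly 1, the first nonzero term of [rho(x)] has order equal to its index
    and cannot be cancelled by later terms. *)
Lemma vanishes_const (rho : fps K) : vanishes (fpsC rho) -> rho = 0.
Proof.
move=> hv; apply/fpsP => m; elim/ltn_ind: m => m IH.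
have := vanishes_ord phi_inj ox oy hv (N := m.+1) (p := fcoef rho m *: 'X_[mon2 m 0]).
have hag : agree m.+1 (fcoef rho m *: 'X_[mon2 m 0]) (fpsC rho).
  move=> i j im _; rewrite mcoeffZ mcoeffX mon2_eq.
  case: j => [|j]; last by rewrite eq_sym andbF mulr0 /coef2f /=.
  rewrite andbT /coef2f /=; case: eqP => [->|/eqP mi]; first by rewrite mulr1.
  by rewrite mulr0 IH // ltn_neqAle eq_sym mi -ltnS.
move=> /(_ hag); rewrite mpolyX_mon2 !eval2E expr0 mulr1 ex exprMn mulrCA.
have [//|r0] := eqVneq (fcoef rho m) 0.
move/ord_bound; rewrite ltnn => h; suff : false by [].
apply: h; case: ix1 => l1 n1 i1; split.
- by apply: (locM phi_inj); [apply: loc_iota|apply: (locX phi_inj)].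
- by rewrite mulf_neq0 ?expf_neq0 ?(iota_eq0 phi_inj).
- rewrite invfM -exprVn; apply: (locM phi_inj); last exact: (locX phi_inj).
  by rewrite -fmorphV; apply: loc_iota.
Qed.

Lemma expansion z : loc z -> exists cu : K * L, z = iota phi cu.1 + x * cu.2 /\ loc cu.2.
Proof.
move=> [p [q [hq ->]]]; pose c := p.[tau] / q.[tau].
have q0 : q.[tau] != 0 by case: hq => _; apply; rewrite inE.
have : rad (phi p / phi q - iota phi c).
  exists (p - c%:P * q), q; split=> //.
    move=> r; rewrite inE => /eqP ->.
    by rewrite hornerD hornerN hornerM hornerC /c divfK ?subrr.
  rewrite rmorphB [phi (_ * q)]rmorphM -[phi c%:P]/(iota phi c); move: (iota phi c) => v.
  by field; rewrite (loc_unit_phi phi_inj hq).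
case/rad1_ord1 => u lu; rewrite expr1 => e; case: (ix1) => l1 n1 i1.
exists (c, u / x1); split=> /=; last exact: (locM phi_inj).
by rewrite ex -mulrA [x1 * _]mulrC divfK // -e addrC subrK.
Qed.

(** Repeated use of [expansion] develops [y] in powers of the uniformizer [x]. The coefficients form
    [gam], whose constant term is 0 because [y] lies in the radical. *)
Lemma branch_series : exists2 gam : fps K, fcoef gam 0 = 0 & vanishes (graph_eq gam).
Proof.
have [f hf] : exists f : L -> K * L, forall z, loc z ->
    z = iota phi (f z).1 + x * (f z).2 /\ loc (f z).2.
  have [|f hf] := @choice L (K * L) (fun z cu => loc z -> z = iota phi cu.1 + x * cu.2 /\ loc cu.2).
    move=> z; have [/expansion[cu hcu]|nl] := pselect (loc z); first by exists cu.
    by exists (0, 0) => /nl.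
  by exists f.
pose Z k := iter k (fun z => (f z).2) y.
have lZ k : loc (Z k).
  by elim: k => [|k IH] /=; [apply: loc_ord_loc oy|case: (hf _ IH)].
pose gam : fps K := Fps (fun k => (f (Z k)).1).
have eZ N : y = \sum_(i < N) iota phi (fcoef gam i) * x ^+ i + x ^+ N * Z N.
  elim: N => [|N IH]; first by rewrite big_ord0 add0r expr0 mul1r.
  rewrite [LHS]IH big_ord_recr /= -addrA; congr (_ + _).
  have [e _] := hf _ (lZ N); move: e.
  by case: (f (Z N)) => c u /= ->; rewrite exprSr; ring.
exists gam.
  apply: (rad_iota phi_inj (rs := [:: tau])) => //; apply: (ord1_rad phi_inj).
  have := eZ 1%N; rewrite big_ord1 expr0 mulr1 expr1 => e.
  have -> : iota phi (fcoef gam 0) = y - x * Z 1%N by rewrite [in RHS]e addrK.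
  by apply: (loc_ordB phi_inj) => //; apply: (loc_ordMr phi_inj).
move=> N; exists ('X_[mon2 0 1] - \sum_(i < N) fcoef gam i *: 'X_[mon2 i 0]).
  move=> i j iN jN; rewrite mcoeffB mcoeffX mon2_eq raddf_sum (bigD1 (Ordinal iN)) //=.
  rewrite mcoeffZ mcoeffX mon2_eq eqxx /= big1 ?addr0 => [|k ki]; last first.
    rewrite mcoeffZ mcoeffX mon2_eq.
    by rewrite (_ : (nat_of_ord k == i) = false) ?mulr0 //; apply: negPf ki.
  rewrite /coef2f; case: j {jN} => [|[|j]] /=.
  - by rewrite andbF sub0r mulr1.
  - by rewrite andbT mulr0 subr0; case: i {iN}.
  - by rewrite andbF mulr0 subr0.
rewrite eval2B mpolyX_mon2 !eval2E expr0 mul1r expr1.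
have -> : eval2 phi x y (\sum_(i < N) fcoef gam i *: 'X_[mon2 i 0])
    = \sum_(i < N) iota phi (fcoef gam i) * x ^+ i.
  rewrite /eval2 raddf_sum; apply: eq_bigr => i _ /=.
  by rewrite -/(eval2 phi x y _) mpolyX_mon2 !eval2E expr0 mulr1.
rewrite [X in X - _](eZ N) addrC addKr.
by apply: (loc_ordMr phi_inj) => //; apply: (loc_ordX phi_inj).
Qed.

(** The remainder of the division by [y - gam(x)] is a series in [x] alone that vanishes on the
    branch, hence is 0. *)
Lemma vanishes_division (gam : fps K) (c : S) : fcoef gam 0 = 0 ->
  vanishes (graph_eq gam) -> vanishes c -> exists r, c = graph_eq gam * r.
Proof.
move=> g0 hg hc; have [r [rho e]] := graph_division c g0; exists r.
suff rho0 : rho = 0 by rewrite e rho0; apply/fpsP => -[|n]; rewrite fcoefD addr0.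
apply: vanishes_const; have -> : fpsC rho = c - graph_eq gam * r.
  by rewrite e addrC addKr.
by apply: vanishesB => //; apply: vanishesMr.
Qed.

(** The graph [b] of the branch at the first point divides the equation, and the cofactor [h] is
    smooth because the multiplicity is 2. [vanishes2] stands for vanishing at the second point: if
    [b] and [h] were associated, [b] would vanish at both points, which [fin] forbids. An
    irreducible factor is identified by whether it or its cofactor vanishes at the first point. *)
Lemma s_branches_two_of_graph (vanishes2 : S -> Prop) (g : {mpoly K[2]}) :
  has_mult 2 g -> eval2 phi x y g = 0 ->
  vanishes2 (series_of g) ->
  (forall s t, vanishes2 (s * t) -> vanishes2 s \/ vanishes2 t) ->
  (forall s t, s_unit t -> vanishes2 (s * t) -> vanishes2 s) ->
  (forall s, s_mult1 s -> vanishes s -> vanishes2 s -> False) ->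
  s_branches 2 (series_of g).
Proof.
move=> m2 eg vg prime2 unit2 fin.
have [gam g0 vgam] := branch_series.
have [h eh] := vanishes_division g0 vgam (vanishes_series_of _ eg).
have mb : s_mult1 (graph_eq gam).
  by split; [rewrite /coef2f /= g0 oppr0|right; rewrite /coef2f /= oner_neq0].
have [A [B [D [eg2 hABD]]]] := (iffLR (has_mult2P g)) m2.
have [[z0 z1 z2] [c20 c11 c02]] := coef2 A B D; rewrite -eg2 in z0 z1 z2 c20 c11 c02.
have h00 : coef2f h 0 0 = 0.
  have := coef2fM01 (graph_eq gam) h; rewrite -eh coef2f_series_of z2.
  by case: mb => -> _; rewrite mul0r add0r /coef2f /= mul1r.
have mh : s_mult1 h.
  split=> //; have [h10|] := eqVneq (coef2f h 1 0) 0; last by left.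
  have [h01|] := eqVneq (coef2f h 0 1) 0; last by right.
  case: mb => b0 _; have [] := coef2fM_deg2 b0 h00 h10 h01.
  rewrite -eh !coef2f_series_of c20 c11 c02 => a b d.
  by move: hABD; rewrite a b d eqxx => -[].
apply: (s_branches_two mb mh eh).
  move=> [u hu e]; apply: (fin _ mb vgam).
  move: vg; rewrite eh -e [u * _]mulrC mulrA => /(unit2 _ _ hu).
  by move/prime2 => [].
move=> c ic [d e].
have /vanishes_prime[vc|vd] : vanishes (c * d).
  by rewrite e; apply: vanishes_series_of.
  have [r er] := vanishes_division g0 vgam vc; left.
  apply: s_assoc_sym; case: ic => _ /(_ _ _ (esym er)) [ub|ur].
    by case: (mult1_irreducible mb) => /(_ ub).
  by exists r; rewrite // mulrC.
have [r er] := vanishes_division g0 vgam vd; right.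
have ehr : r * c = h.
  apply/eqP; rewrite -subr_eq0; apply/eqP; apply: (graph_lreg g0).
  by rewrite mulrBr -eh -e er; ring.
exists r => //; have [_ /(_ _ _ ehr) [//|uc]] := mult1_irreducible mh.
by case: ic.
Qed.

End OneBranch.

(** * The number of branches from the roots of [W] *)

Section Branches.
Variables (K : closedFieldType) (L : fieldType).
Variable phi : {rmorphism {poly K} -> L}.
Hypothesis phi_inj : injective phi.
Variables tau1 tau2 : K.
Local Notation rs := [:: tau1; tau2].
Variables x y : L.
Hypothesis im : immersed phi rs x y.
Hypothesis fin : exists M, ~ contact phi rs M x y.
Variable g : {mpoly K[2]}.
Hypothesis m2 : has_mult 2 g.
Hypothesis eg : eval2 phi x y g = 0.

Lemma loc_sub (r1 r2 : seq K) z : {subset r1 <= r2} -> loc phi r2 z -> loc phi r1 z.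
Proof.
move=> h [p [q [[q0 hq] ->]]]; exists p, q; split=> //; split=> // r hr.
by apply/hq/h.
Qed.

Lemma ord_sub tau z : tau \in rs -> loc_ord phi rs 1 z -> loc_ord phi [:: tau] 1 z.
Proof.
move=> ht /(ord1_rad phi_inj) [p [q [[q0 hq] hp ->]]].
apply: rad1_ord1; exists p, q; split.
- by split=> // r; rewrite inE => /eqP ->; apply: hq.
- by move=> r; rewrite inE => /eqP ->; apply: hp.
- by [].
Qed.

(** In lowest terms the denominator divides the local denominator at each point, and the numerator
    carries the full power of ['X - tau]. Conditions at two distinct points can thus be combined on
    one fraction. *)
Lemma ord_reduced tau N z (a b : {poly K}) : coprimep a b -> b != 0 ->
  z = phi a / phi b -> loc_ord phi [:: tau] N z ->
  b.[tau] != 0 /\ ('X - tau%:P) ^+ N %| a.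
Proof.
move=> cab b0 -> [u [p [q [hq ->]]]]; rewrite root_poly1 => e.
have qt : q.[tau] != 0 by case: hq => _; apply; rewrite inE.
have {}e : a * q = ('X - tau%:P) ^+ N * p * b.
  apply: phi_inj; rewrite !rmorphM rmorphXn.
  have -> : phi a = phi a / phi b * phi b by rewrite divfK // (phi_eq0 phi_inj).
  by rewrite e; field; apply: (loc_unit_phi phi_inj hq).
split.
  have /dvdpP[r er] : b %| q.
    by move: cab; rewrite coprimep_sym => /(Gauss_dvdpr q) <-; rewrite e dvdp_mull.
  by apply: contraNneq qt => bt; rewrite er hornerM bt mulr0.
have cq : coprimep (('X - tau%:P) ^+ N) q.
  by apply/coprimep_expl; rewrite coprimep_sym coprimep_XsubC.
by rewrite -(Gauss_dvdpl _ cq) e -mulrA dvdp_mulr.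
Qed.

(* The factor [2] is needed only when [tau1 = tau2], where [root_poly rs] has a
   double root. *)
Lemma ord_pair N z : loc_ord phi [:: tau1] (2 * N) z -> loc_ord phi [:: tau2] (2 * N) z ->
  loc_ord phi rs N z.
Proof.
have root_poly2 : root_poly rs = ('X - tau1%:P) * ('X - tau2%:P).
  by rewrite /root_poly big_cons big_seq1.
have [e12|ne] := eqVneq tau1 tau2.
  move=> [u [p [q [[q0 hq] ->]]]]; rewrite root_poly1 => -> _.
  exists (phi p / phi q); last by rewrite root_poly2 -e12 rmorphM -expr2 -exprM.
  by exists p, q; split=> //; split=> // r; rewrite !inE -e12 orbb => /eqP ->;
    apply: hq; rewrite inE.
have N2 : (N <= 2 * N)%N by rewrite leq_pmull.
move=> /(loc_ord_le phi_inj N2) h1 /(loc_ord_le phi_inj N2) h2.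
have [p [q [[q0 _] ez]]] := loc_ord_loc phi_inj h1.
pose d := gcdp p q; pose a := p %/ d; pose b := q %/ d.
have d0 : d != 0 by rewrite gcdp_eq0 negb_and q0 orbT.
have [ep eq] : p = a * d /\ q = b * d by rewrite !divpK // ?dvdp_gcdl ?dvdp_gcdr.
have b0 : b != 0 by apply: contraNneq q0 => b0; rewrite eq b0 mul0r.
have cab : coprimep a b by rewrite coprimep_div_gcd // q0 orbT.
have {}ez : z = phi a / phi b.
  by rewrite ez ep eq !rmorphM -mulf_div divff ?mulr1 // (phi_eq0 phi_inj).
have [b1 a1] := ord_reduced cab b0 ez h1; have [b2 a2] := ord_reduced cab b0 ez h2.
have cop12 : coprimep (('X - tau1%:P) ^+ N) (('X - tau2%:P) ^+ N).
  by apply/coprimep_expl/coprimep_expr; rewrite coprimep_XsubC root_XsubC eq_sym.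
have /dvdpP[r er] : root_poly rs ^+ N %| a by rewrite root_poly2 exprMn Gauss_dvdp ?a1.
exists (phi r / phi b); last by rewrite ez er rmorphM rmorphXn mulrAC mulrC mulrA.
by exists r, b; split=> //; split=> // t; rewrite !inE => /orP[] /eqP ->.
Qed.

(** A truncation of [s] is a smooth germ that has high order at both points; by [ord_pair] and the
    implicit function theorem it would give contact of any prescribed order. *)
Lemma no_smooth_series (s : fps (fps K)) : s_mult1 s ->
  vanishes phi [:: tau1] x y s -> vanishes phi [:: tau2] x y s -> False.
Proof.
move=> ms v1 v2; have [M hM] := fin; apply: hM.
have [ox oy] := immersed_ord im.
have h1 : tau1 \in rs by rewrite !inE eqxx.
have h2 : tau2 \in rs by rewrite !inE eqxx orbT.
(* The factor 2 pays for the loss in [ord_pair]; the successor keeps the linear coefficients inside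
   the box even for [M = 0]. *)
have [p hp] := agree_exists (2 * M.+1) s.
have m1 : has_mult 1 p.
  have M1 : (1 < 2 * M.+1)%N by rewrite mulnS.
  by apply/has_mult1P; rewrite !hp // (ltn_trans _ M1).
apply: (contact_le phi_inj (leqnSn M)).
apply: (contact_of_mult1 phi_inj m1) => //.
apply: ord_pair.
  exact: (vanishes_ord phi_inj (ord_sub h1 ox) (ord_sub h1 oy) v1 hp).
exact: (vanishes_ord phi_inj (ord_sub h2 ox) (ord_sub h2 oy) v2 hp).
Qed.

(** In a factorization into two nonunits both factors would be smooth, the multiplicity being 2. The
    branch lies on one of them by primality, which [no_smooth_series] excludes. *)
Lemma branches_eq : tau1 = tau2 -> has_branches 1 g.
Proof.
move=> e12; apply/has_branchesE/s_branches_irreducible.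
have [ox oy] := immersed_ord im.
have h1 : tau1 \in rs by rewrite !inE eqxx.
have ox1 := ord_sub h1 ox; have oy1 := ord_sub h1 oy.
have [A [B [D [eg2 hABD]]]] := (iffLR (has_mult2P g)) m2.
have [[z0 z1 z2] [c20 c11 c02]] := coef2 A B D; rewrite -eg2 in z0 z1 z2 c20 c11 c02.
split; first by rewrite s_unitP coef2f_series_of z0 eqxx.
move=> b c ebc; have [hb|hb] := pselect (s_unit b); first by left.
have [hc|hc] := pselect (s_unit c); first by right.
move: hb hc; rewrite !s_unitP => /negP; rewrite negbK => /eqP b0 /negP.
rewrite negbK => /eqP c0.
have mult1 (s t : fps (fps K)) : s * t = series_of g -> coef2f s 0 0 = 0 ->
    coef2f t 0 0 = 0 -> s_mult1 t.
  move=> est s0 t0; split=> //.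
  have [h10|] := eqVneq (coef2f t 1 0) 0; last by left.
  have [h01|] := eqVneq (coef2f t 0 1) 0; last by right.
  have [] := coef2fM_deg2 s0 t0 h10 h01.
  rewrite est !coef2f_series_of c20 c11 c02 => a' b' d'.
  by move: hABD; rewrite a' b' d' eqxx => -[].
have /(vanishes_prime phi_inj ox1 oy1)[v|v] : vanishes phi [:: tau1] x y (b * c).
- by rewrite ebc; apply: vanishes_series_of.
- exfalso; apply: (no_smooth_series (s := b)) => //; last by rewrite -e12.
  by apply: (mult1 c b) => //; rewrite mulrC.
- exfalso; apply: (no_smooth_series (s := c)) => //; last by rewrite -e12.
  exact: (mult1 b c).
Qed.

(** Near [tau1] the factor ['X - tau2] of the root polynomial is a unit, so [x] or [y] generates the
    maximal ideal there: [x] if [x1] is not in the radical, otherwise [y], after an exchange of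
    coordinates. *)
Lemma branches_neq : tau1 != tau2 -> has_branches 2 g.
Proof.
move=> ne; have [ox oy] := immersed_ord im.
have h1 : tau1 \in rs by rewrite !inE eqxx.
have h2 : tau2 \in rs by rewrite !inE eqxx orbT.
have ox1 := ord_sub h1 ox; have oy1 := ord_sub h1 oy.
have ox2 := ord_sub h2 ox; have oy2 := ord_sub h2 oy.
have sub1 : {subset [:: tau1] <= rs} by move=> r; rewrite inE => /eqP ->.
case: im => x1 [y1 [/(loc_sub sub1) lx /(loc_sub sub1) ly ex ey]].
move=> [s [t [z [/(loc_sub sub1) ls /(loc_sub sub1) lt hz est]]]].
have iw : loc_invertible phi [:: tau1] (phi ('X - tau2%:P)).
  apply: (loc1_invertible phi_inj); first exact: loc_phi.
  move=> [p [q [[q0 hq] hp e]]].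
  have {}e : ('X - tau2%:P) * q = p.
    by apply: phi_inj; rewrite rmorphM e divfK // (phi_eq0 phi_inj).
  have ht : tau1 \in [:: tau1] by rewrite inE.
  have := hp _ ht; rewrite -e hornerM !hornerE => /eqP.
  by rewrite mulf_eq0 (negPf (hq _ ht)) orbF subr_eq0 (negPf ne).
have ew : phi (root_poly rs) = phi (root_poly [:: tau1]) * phi ('X - tau2%:P).
  by rewrite -rmorphM root_poly1 /root_poly big_cons big_seq1.
have hz1 : rad phi [:: tau1] z.
  case: hz => p [q [[q0 hq] hp ->]]; exists p, q; split=> //.
    by split=> // r /sub1/hq.
  by move=> r /sub1/hp.
have unit_case (u : L) : loc phi [:: tau1] u -> ~ rad phi [:: tau1] u ->
    loc_invertible phi [:: tau1] (phi ('X - tau2%:P) * u).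
  move=> lu /(loc1_invertible phi_inj lu)[_ u0 iu]; case: iw => lw w0 iw'.
  split; [exact: (locM phi_inj)|by rewrite mulf_neq0|].
  by rewrite invfM; apply: (locM phi_inj).
have fin' := no_smooth_series.
have unit2 (x' y' : L) (s' t' : fps (fps K)) : loc_ord phi [:: tau2] 1 x' ->
    loc_ord phi [:: tau2] 1 y' -> s_unit t' ->
    vanishes phi [:: tau2] x' y' (s' * t') -> vanishes phi [:: tau2] x' y' s'.
  move=> ox' oy' [u hu] /(vanishesMr phi_inj ox' oy' u).
  by rewrite -mulrA hu mulr1.
have [rx|nrx] := pselect (rad phi [:: tau1] x1); last first.
  apply/has_branchesE.
  apply: (s_branches_two_of_graph phi_inj ox1 oy1 (unit_case _ lx nrx) _
    (vanishes2 := vanishes phi [:: tau2] x y)) => //.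
  - by rewrite ex ew mulrA.
  - exact: vanishes_series_of.
  - exact: vanishes_prime.
  - by move=> s' t'; apply: unit2.
have [ry|nry] := pselect (rad phi [:: tau1] y1).
  exfalso; apply: (@loc_invertible_not_rad _ _ _ phi_inj [:: tau1] isT 1).
    by split; rewrite ?oner_neq0 ?invr1 //; apply: loc1.
  have -> : 1 = s * x1 + t * y1 - z by rewrite est addrK.
  by apply: (radB phi_inj) => //; apply: (radD phi_inj) => //; apply: (radMl phi_inj).
have fin2 (s' : fps (fps K)) : s_mult1 s' -> vanishes phi [:: tau1] y x s' ->
    vanishes phi [:: tau2] y x s' -> False.
  pose s2 := embed_swap (coef2f s').
  have c2 i j : coef2f s2 i j = coef2f s' j i by [].
  move=> [m0 m1]; have vs tau : vanishes phi [:: tau] y x s' -> vanishes phi [:: tau] x y s2.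
    move=> hv N; have [p hp op] := hv N; exists (swap p); last by rewrite eval2_swap.
    by move=> i j iN jN; rewrite mcoeff_swap hp.
  move=> /vs v1 /vs v2; apply: (fin' s2) => //; split; first by rewrite c2.
  by rewrite !c2; case: m1; [right|left].
apply/has_branches_swap.
apply: (s_branches_two_of_graph phi_inj oy1 ox1 (unit_case _ ly nry) _
    (vanishes2 := vanishes phi [:: tau2] y x)) => //.
- by rewrite ey ew mulrA.
- exact: has_mult_swap.
- by rewrite eval2_swap.
- by apply: vanishes_series_of; rewrite eval2_swap.
- exact: vanishes_prime.
- by move=> s' t'; apply: unit2.
Qed.

End Branches.

(** * The affine parametrization and the length of the fibre *)

Lemma proj_eq_refl (K : closedFieldType) N (v : 'rV[K]_N) : proj_eq v v.
Proof. by exists 1; rewrite ?oner_neq0 ?scale1r. Qed.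

Lemma proj_eq_sym (K : closedFieldType) N (v w : 'rV[K]_N) : proj_eq v w -> proj_eq w v.
Proof.
by move=> [c c0 ->]; exists c^-1; rewrite ?invr_eq0 // scalerA mulVf // scale1r.
Qed.

Lemma proj_eq_trans (K : closedFieldType) N (u v w : 'rV[K]_N) :
  proj_eq u v -> proj_eq v w -> proj_eq u w.
Proof.
by move=> [c c0 ->] [d d0 ->]; exists (d * c); rewrite ?mulf_neq0 // scalerA.
Qed.

Lemma size_top_exp (K : fieldType) (p : {poly K}) m : (size p <= 2)%N ->
  (size (p ^+ m) <= m.+1)%N /\ (p ^+ m)`_m = p`_1 ^+ m.
Proof.
move=> hp; elim: m => [|m [IH1 IH2]]; first by rewrite expr0 size_poly1 coef1.
rewrite exprS; split.
  apply: leq_trans (size_polyMleq _ _) _.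
  by have := leq_add hp IH1; rewrite add2n; case: (_ + _)%N.
rewrite coefM (bigD1 (inord 1)) //= inordK // subSS subn0 IH2 exprS big1 ?addr0 // => i.
rewrite -val_eqE /= inordK // => i1.
case: i i1 => [[|[|i]] hi] //= _; last by rewrite nth_default ?mul0r // (leq_trans hp).
by rewrite subn0 [X in _ * X]nth_default ?mulr0.
Qed.

Lemma coef_topM (K : fieldType) (p q : {poly K}) k l : (size p <= k.+1)%N -> (size q <= l.+1)%N ->
  (p * q)`_(k + l) = p`_k * q`_l.
Proof.
move=> hp hq; rewrite coefM (bigD1 (inord k)) //= inordK ?ltnS ?leq_addr //.
rewrite addKn big1 ?addr0 // => i; rewrite -val_eqE /= inordK ?ltnS ?leq_addr // => ik.
case: (ltngtP i k) ik => // ik _.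
  rewrite [X in _ * X]nth_default ?mulr0 //; apply: leq_trans hq _.
  by have := ltn_ord i; lia.
by rewrite nth_default ?mul0r // (leq_trans hp).
Qed.

Section AffineLine.
Variables (K : closedFieldType) (n : nat) (a : 'M[K]_(3, n.+1)).
(* [q1] is the point at infinity of the affine line [q0 + t q1]. *)
Variables q0 q1 : 'rV[K]_2.
Hypothesis q01 : q0 0 0 * q1 0 1 - q0 0 1 * q1 0 0 != 0.

Definition aff (t : K) : 'rV[K]_2 := q0 + t *: q1.

Definition affp (i : 'I_2) : {poly K} := (q0 0 i)%:P + q1 0 i *: 'X.

Definition nu (j : 'I_n.+1) : {poly K} := affp 0 ^+ (n - j) * affp 1 ^+ j.

Definition paramp (u : 'I_3) : {poly K} := \sum_(j < n.+1) a u j *: nu j.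

Lemma horner_affp i t : (affp i).[t] = aff t 0 i.
Proof. by rewrite /affp /aff !mxE !hornerE mulrC. Qed.

Lemma horner_nu j t : (nu j).[t] = veronese n (aff t) 0 j.
Proof. by rewrite /nu hornerM !horner_exp !horner_affp [RHS]mxE. Qed.

Lemma horner_paramp u t : (paramp u).[t] = param a (aff t) 0 u.
Proof.
rewrite /paramp horner_sum [RHS]mxE; apply: eq_bigr => j _.
by rewrite hornerZ /nu hornerM !horner_exp !horner_affp mulrA.
Qed.

Lemma size_affp i : (size (affp i) <= 2)%N.
Proof.
rewrite /affp; apply: leq_trans (size_polyD _ _) _; rewrite geq_max.
rewrite (leq_trans (size_polyC_leq1 _)) //=.
by apply: leq_trans (size_scale_leq _ _) _; rewrite size_polyX.
Qed.

Lemma size_nu j : (size (nu j) <= n.+1)%N.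
Proof.
have [h1 _] := size_top_exp (n - j) (size_affp 0).
have [h2 _] := size_top_exp j (size_affp 1).
apply: leq_trans (size_polyMleq _ _) _.
have jn : (j <= n)%N by rewrite -ltnS.
have := leq_add h1 h2; rewrite addSn addnS subnK //.
by case: (_ + _)%N.
Qed.

Lemma coef_nu j : (nu j)`_n = veronese n q1 0 j.
Proof.
have jn : (j <= n)%N by rewrite -ltnS.
have [h1 e1] := size_top_exp (n - j) (size_affp 0).
have [h2 e2] := size_top_exp j (size_affp 1).
rewrite -{1}(subnK jn) coef_topM // e1 e2 mxE.
by rewrite /affp !coefD !coefC !coefZ !coefX /= !add0r !mulr1.
Qed.

Lemma size_paramp u : (size (paramp u) <= n.+1)%N.
Proof.
apply: leq_trans (size_sum _ _ _) _; apply/bigmax_leqP => j _.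
by apply: leq_trans (size_scale_leq _ _) _; apply: size_nu.
Qed.

Lemma coef_paramp u : (paramp u)`_n = param a q1 0 u.
Proof.
rewrite /paramp coef_sum mxE; apply: eq_bigr => j _.
by rewrite coefZ coef_nu mxE mulrA.
Qed.

Lemma aff_neq0 t : aff t != 0.
Proof.
apply: contraNneq q01 => /rowP h; have := h 0; have := h 1; rewrite !mxE.
move/eqP; rewrite addr_eq0 => /eqP ->; move/eqP; rewrite addr_eq0 => /eqP ->.
by apply/eqP; ring.
Qed.

Lemma q1_neq0 : q1 != 0.
Proof. by apply: contraNneq q01 => ->; rewrite !mxE !mulr0 subr0. Qed.

Lemma row2P (v w : 'rV[K]_2) : v 0 0 = w 0 0 -> v 0 1 = w 0 1 -> v = w.
Proof.
move=> h0 h1; apply/rowP => i.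
have [->|->] // := ord2P i.
Qed.

Lemma proj_eq_aff_inj t s : proj_eq (aff t) (aff s) -> t = s.
Proof.
move=> [c c0 /rowP h]; have := h 0; have := h 1; rewrite !mxE => h1 h0.
have e1 : (1 - c) * (q0 0 0 * q1 0 1 - q0 0 1 * q1 0 0) = 0.
  transitivity ((q0 0 0 + s * q1 0 0) * q1 0 1 - (q0 0 1 + s * q1 0 1) * q1 0 0
    - c * (q0 0 0 * q1 0 1 - q0 0 1 * q1 0 0)); first by ring.
  rewrite h1 h0; ring.
have c1 : c = 1.
  by apply/esym/eqP; rewrite -subr_eq0; move/eqP: e1; rewrite mulf_eq0 (negPf q01) orbF.
have e2 : (s - t) * (q0 0 0 * q1 0 1 - q0 0 1 * q1 0 0) = 0.
  transitivity (q0 0 0 * (q0 0 1 + s * q1 0 1) - q0 0 1 * (q0 0 0 + s * q1 0 0)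
    - t * (q0 0 0 * q1 0 1 - q0 0 1 * q1 0 0)); first by ring.
  rewrite h1 h0 c1; ring.
by apply/esym/eqP; rewrite -subr_eq0; move/eqP: e2; rewrite mulf_eq0 (negPf q01) orbF.
Qed.

Lemma aff_cover q : q != 0 -> proj_eq q1 q \/ exists t, proj_eq (aff t) q.
Proof.
move=> qn0; pose dd := q0 0 0 * q1 0 1 - q0 0 1 * q1 0 0.
pose al := (q 0 0 * q1 0 1 - q 0 1 * q1 0 0) / dd.
pose be := (q0 0 0 * q 0 1 - q0 0 1 * q 0 0) / dd.
have eq : q = al *: q0 + be *: q1.
  by apply: row2P; rewrite !mxE /al /be /dd; field.
have [al0|al0] := eqVneq al 0.
  left; exists be; last by rewrite eq al0 scale0r add0r.
  by apply: contraNneq qn0 => be0; rewrite eq al0 be0 !scale0r addr0.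
right; exists (be / al); exists al => //.
by rewrite eq /aff scalerDr scalerA mulrC divfK.
Qed.

Lemma paramZ c q : param a (c *: q) = c ^+ n *: param a q.
Proof.
apply/rowP => u; rewrite !mxE mulr_sumr; apply: eq_bigr => j _.
have jn : (j <= n)%N by rewrite -ltnS.
have -> : c ^+ n = c ^+ (n - j) * c ^+ j by rewrite -exprD subnK.
by rewrite ?mxE !exprMn; ring.
Qed.

Lemma veroneseZ c (q : 'rV[K]_2) : veronese n (c *: q) = c ^+ n *: veronese n q.
Proof.
apply/rowP => j; have jn : (j <= n)%N by rewrite -ltnS.
have -> : c ^+ n = c ^+ (n - j) * c ^+ j by rewrite -exprD subnK.
by rewrite ?mxE !exprMn; ring.
Qed.

Lemma proj_eq_param q r : proj_eq q r -> proj_eq (param a q) (param a r).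
Proof. by move=> [c c0 ->]; rewrite paramZ; exists (c ^+ n); rewrite ?expf_neq0. Qed.

Lemma proj_eq_veronese (q r : 'rV[K]_2) : proj_eq q r -> proj_eq (veronese n q) (veronese n r).
Proof. by move=> [c c0 ->]; rewrite veroneseZ; exists (c ^+ n); rewrite ?expf_neq0. Qed.

Lemma proj_map_veronese q : proj_map a (veronese n q) = param a q.
Proof. by apply/rowP => u; rewrite !mxE; apply: eq_bigr => j _; rewrite mxE mulrA. Qed.

Lemma proj_mapZ c z : proj_map a (c *: z) = c *: proj_map a z.
Proof.
apply/rowP => u; rewrite !mxE mulr_sumr; apply: eq_bigr => j _.
by rewrite !mxE mulrCA.
Qed.

Lemma poly_eval0 (p : {poly K}) : (forall t, p.[t] = 0) -> p = 0.
Proof.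
move=> h; apply/eqP; have [//|/closed_nonrootP[x]] := eqVneq p 0.
by rewrite /root h eqxx.
Qed.

Lemma horner_mmap N (v : 'I_N -> {poly K}) (G : {mpoly K[N]}) t :
  (mmap polyC v G).[t] = G.@[fun i => (v i).[t]].
Proof.
rewrite -[LHS]/(horner_eval t _) rmorph_mmap /meval.
by apply: mmap_ext2 => // c; rewrite /= horner_evalE hornerC.
Qed.

Lemma eval_at_mmap N (v : 'I_N -> {poly K}) (w : K -> 'rV[K]_N) (G : {mpoly K[N]}) t :
  (forall i, (v i).[t] = w t 0 i) -> (mmap polyC v G).[t] = eval_at G (w t).
Proof. by move=> h; rewrite horner_mmap; apply: meval_eq. Qed.

Lemma eval_at_homog N d (G : {mpoly K[N]}) c v : G \is d.-homog ->
  eval_at G (c *: v) = c ^+ d * eval_at G v.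
Proof.
move=> hG; rewrite /eval_at /meval -(mmap_homog _ _ c hG).
by apply: mmap_ext => i; rewrite mxE.
Qed.

(* A form vanishing on the affine part of a parametrized curve also vanishes at
   the image of the point at infinity, by continuity. *)
Lemma form_vanishes_at_infinity N d (V : 'rV[K]_2 -> 'rV[K]_N) (G : {mpoly K[N]})
    (vp : 'I_N -> {poly K}) :
  G \is d.-homog -> (forall c q, exists2 c', V (c *: q) = c' *: V q & (c != 0 -> c' != 0)) ->
  (forall s i, (vp i).[s] = V (q1 + s *: q0) 0 i) ->
  (forall t, eval_at G (V (aff t)) = 0) -> forall q, q != 0 -> eval_at G (V q) = 0.
Proof.
move=> hG hV hvp h q /aff_cover hq.
have key r s : proj_eq r s -> eval_at G (V r) = 0 -> eval_at G (V s) = 0.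
  move=> [c c0 ->] e; have [c' -> _] := hV c r.
  by rewrite (eval_at_homog _ _ hG) e mulr0.
have [hq1|[t ht]] := hq; last by apply: key ht (h t).
apply: (key _ _ hq1).
pose p := mmap polyC vp G.
have pE s : p.[s] = eval_at G (V (q1 + s *: q0)).
  exact: (eval_at_mmap (w := fun s => V (q1 + s *: q0))).
have p0 : 'X * p = 0.
  apply: poly_eval0 => s; rewrite hornerM hornerX pE.
  have [->|s0] := eqVneq s 0; first by rewrite mul0r.
  rewrite (key (aff s^-1)) ?mulr0 //; exists s => //.
  by rewrite /aff scalerDr scalerA divff // scale1r addrC.
move/eqP: p0; rewrite mulf_eq0 polyX_eq0 /= => /eqP p0.
by have := pE 0; rewrite p0 horner0 scale0r addr0.
Qed.

End AffineLine.

Section Germ.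
Variables (K : closedFieldType) (P : 'rV[K]_3).
Hypothesis P0 : P != 0.
Local Notation c := (chart P).

Lemma chart_neq0 : P 0 c != 0.
Proof.
rewrite /chart; case: pickP => [i //|h].
by case/eqP: P0; apply/rowP => i; rewrite mxE; apply/eqP; have /negbFE := h i.
Qed.

Lemma germ_eval (R : comNzRingType) (f : {rmorphism K -> R}) (x y : R) (G : {mpoly K[3]}) :
  mmap f (pair2 x y) (germ_at G P) =
  mmap f (fun u => if unlift c u is Some j then pair2 x y j + f (P 0 u / P 0 c) else 1) G.
Proof.
rewrite /germ_at mmap_comp; apply: mmap_ext => u; rewrite tnth_mktuple.
case: (unlift c u) => [j|]; last exact: rmorph1.
by rewrite rmorphD /= mmapX mmap1U mmapC.
Qed.

Variable f : 'I_3 -> {poly K}.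

(* [tangent_form j] is the pull-back of the linear form [X_(lift c j) -
   P_(lift c j) / P_c * X_c], whose quotient by [X_c] is the coordinate [x_j]. *)
Definition tangent_form (j : 'I_2) : {poly K} :=
  f (lift c j) - (P 0 (lift c j) / P 0 c) *: f c.

Lemma germ_pullback (L : fieldType) (psi : {rmorphism {poly K} -> L}) d G :
  G \is d.-homog -> psi (f c) != 0 ->
  psi (mmap polyC f G) = psi (f c) ^+ d *
    mmap (psi \o polyC) (pair2 (psi (tangent_form 0) / psi (f c))
                               (psi (tangent_form 1) / psi (f c))) (germ_at G P).
Proof.
move=> hG f0; rewrite germ_eval -(mmap_homog _ _ _ hG) rmorph_mmap.
apply: mmap_ext => u /=; case: unliftP => [j|] ->; last by rewrite mulr1.
have -> : pair2 (psi (tangent_form 0) / psi (f c)) (psi (tangent_form 1) / psi (f c)) j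
   = psi (tangent_form j) / psi (f c).
  rewrite /pair2; case: eqP => [->//|/eqP j0]; congr (psi (tangent_form _) / _).
  by apply/val_inj; case: j j0 => [[|[|[]]]].
rewrite mulrDr mulrC divfK // /tangent_form -mul_polyC rmorphB rmorphM.
rewrite -[psi (_%:P)]/((psi \o polyC) _) /=; ring.
Qed.

Lemma tangent_root t : (f c).[t] != 0 \/ (exists u, (f u).[t] != 0) ->
  ((forall j, (tangent_form j).[t] = 0) <-> proj_eq P (\row_u (f u).[t])).
Proof.
move=> hf; have Pc := chart_neq0; split=> [h|[k k0 /rowP h] j]; last first.
  have := h (lift c j); have := h c; rewrite !mxE /tangent_form !hornerE => -> ->.
  by field.
exists ((f c).[t] / P 0 c).
  rewrite mulf_neq0 ?invr_eq0 //.
  apply/eqP => fc0; case: hf => [|[u]]; first by rewrite fc0 eqxx.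
  case: (unliftP c u) => [j|] ->; last by rewrite fc0 eqxx.
  by have := h j; rewrite /tangent_form !hornerE fc0 mulr0 subr0 => ->; rewrite eqxx.
apply/rowP => u; rewrite !mxE; case: (unliftP c u) => [j|] ->; last by field.
have /eqP := h j; rewrite /tangent_form !hornerE subr_eq0 => /eqP ->.
by field.
Qed.

End Germ.

Lemma homog_multiple_degree (K : closedFieldType) N n d (F A : {mpoly K[N]}) :
  F \is n.-homog -> A * F \is d.-homog -> A * F != 0 -> (n <= d)%N.
Proof.
move=> hF hAF AF0; have [A0 F0] : A != 0 /\ F != 0.
  by move: AF0; rewrite mulf_eq0 negb_or => /andP.
have e1 : mdeg (mlead (A * F)) = d by apply: (dhomog_mf hAF); apply: mlead_supp.
have e2 : mdeg (mlead F) = n by apply: (dhomog_mf hF); apply: mlead_supp.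
by rewrite -e1 mleadM // mdegD e2 leq_addl.
Qed.

Lemma roots_of_gcd (K : closedFieldType) (p0 p1 : {poly K}) : p0 != 0 ->
  exists rs r0 r1, [/\ p0 = root_poly rs * r0, p1 = root_poly rs * r1 & coprimep r0 r1].
Proof.
move=> p00; pose W := gcdp p0 p1; have W0 : W != 0 by rewrite gcdp_eq0 (negPf p00).
have [rs eW] := closed_field_poly_normal W.
exists rs, (lead_coef W *: (p0 %/ W)), (lead_coef W *: (p1 %/ W)).
have lc0 : lead_coef W != 0 by rewrite lead_coef_eq0.
split.
- by rewrite -scalerAr scalerAl -eW mulrC divpK ?dvdp_gcdl.
- by rewrite -scalerAr scalerAl -eW mulrC divpK ?dvdp_gcdr.
- by rewrite coprimepZl // coprimepZr // coprimep_div_gcd // p00.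
Qed.

(** * Lower bound for the length of the fibre *)

Section GenericLine.
Variables (K : closedFieldType) (charK : [pchar K] =i pred0).
Variables (n : nat) (a : 'M[K]_(3, n.+1)) (F : {mpoly K[3]}) (P : 'rV[K]_3).
Hypothesis F_homog : F \is n.-homog.
Hypothesis P0 : P != 0.
Hypothesis P2 : double_point F P.
Variables q0 q1 : 'rV[K]_2.
Hypothesis q01 : q0 0 0 * q1 0 1 - q0 0 1 * q1 0 0 != 0.
Local Notation f := (paramp a q0 q1).
Local Notation c := (chart P).
Local Notation p := (tangent_form P f).
Hypothesis F_vanishes : mmap polyC f F = 0.
Hypothesis no_linear : forall v : 'I_3 -> K, (exists u, v u != 0) ->
  \sum_u v u *: f u != 0.
Hypothesis param0 : forall q, q != 0 -> param a q != 0.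
Hypothesis infinity : ~ proj_eq P (param a q1).
Variable S : seq 'rV[K]_3.
Hypothesis generic_inj : forall q r : 'rV[K]_2, q != 0 -> r != 0 ->
  (forall v, v \in S -> ~ proj_eq v (param a q)) ->
  proj_eq (param a q) (param a r) -> proj_eq q r.
Variables (rs : seq K) (r0 r1 : {poly K}).
Hypothesis ep0 : p 0 = root_poly rs * r0.
Hypothesis ep1 : p 1 = root_poly rs * r1.
Hypothesis cop : coprimep r0 r1.

Lemma param_row t : param a (aff q0 q1 t) = \row_u (f u).[t].
Proof. by apply/rowP => u; rewrite [RHS]mxE horner_paramp. Qed.

Lemma f_neq0_at t : exists u, (f u).[t] != 0.
Proof.
apply: contrapT => h; have /eqP := param0 (aff_neq0 q01 t); apply.
rewrite param_row; apply/rowP => u; rewrite !mxE; apply/eqP/negP => /negP hu.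
by apply: h; exists u.
Qed.

Lemma fc_neq0 : f c != 0.
Proof.
have := no_linear (v := fun u => (u == c)%:R); rewrite (bigD1 c) //= eqxx scale1r.
rewrite big1 ?addr0 => [|u /negPf ->]; last by rewrite scale0r.
by apply; exists c; rewrite eqxx oner_neq0.
Qed.

Lemma line_neq0 (s t : K) : s != 0 \/ t != 0 -> s *: p 0 + t *: p 1 != 0.
Proof.
move=> st; pose v u : K := if unlift c u is Some j then pair2 s t j
  else - (s * (P 0 (lift c 0) / P 0 c) + t * (P 0 (lift c 1) / P 0 c)).
have := no_linear (v := v).
have -> : \sum_u v u *: f u = s *: p 0 + t *: p 1.
  rewrite (bigD1_ord c) //= !big_ord_recl big_ord0 addr0 /v unlift_none !liftK /=.
  rewrite /pair2 /tangent_form /=.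
  have -> : lift ord0 ord0 = 1 :> 'I_2 by apply/val_inj.
  by rewrite -!mul_polyC !rmorphN !rmorphD !rmorphM /=; ring.
apply; case: st => h; [exists (lift c 0)|exists (lift c 1)]; by rewrite /v liftK /pair2.
Qed.

(** The fibre misses the point at infinity, whose coordinates are the coefficients of index [n].
    This is what makes [n - size rs] the exact degree of a general combination of [r0] and [r1]. *)
Lemma p_top : (p 0)`_n != 0 \/ (p 1)`_n != 0.
Proof.
have e j : (p j)`_n = param a q1 0 (lift c j) - P 0 (lift c j) / P 0 c * param a q1 0 c.
  by rewrite /tangent_form coefB coefZ !coef_paramp.
have [h0|] := eqVneq (p 0)`_n 0; last by left.
have [h1|] := eqVneq (p 1)`_n 0; last by right.
case: infinity; have Pc := chart_neq0 P0; exists (param a q1 0 c / P 0 c).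
  rewrite mulf_neq0 ?invr_eq0 //; apply: contraNneq (param0 (q1_neq0 q01)) => z.
  move: h0 h1; rewrite !e z !mulr0 !subr0 => h0 h1.
  apply/eqP/rowP => u; rewrite [RHS]mxE; case: (unliftP c u) => [j|] ->; last by [].
  case: j => [[|[|[]]]] // hj; [rewrite -[RHS]h0|rewrite -[RHS]h1];
    by congr (param a q1 0 (lift c _)); apply/val_inj.
have h j : (p j)`_n = 0.
  by case: j => [[|[|[]]]] // hj; [rewrite -[RHS]h0|rewrite -[RHS]h1];
    congr ((p _)`_n); apply/val_inj.
apply/rowP => u; rewrite [RHS]mxE; case: (unliftP c u) => [j|] ->; last by field.
have /eqP := h j; rewrite e subr_eq0 => /eqP ->.
by field.
Qed.

Lemma size_p j : (size (p j) <= n.+1)%N.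
Proof.
apply: leq_trans (size_polyD _ _) _; rewrite geq_max size_paramp size_polyN.
by apply: leq_trans (size_scale_leq _ _) _; apply: size_paramp.
Qed.

Lemma monic_root_poly : root_poly rs \is monic.
Proof. exact: monic_prod_XsubC. Qed.

Lemma size_root_poly : size (root_poly rs) = (size rs).+1.
Proof. by rewrite /root_poly size_prod_XsubC. Qed.

Lemma line_factor (s t : K) : s *: p 0 + t *: p 1 = root_poly rs * (s *: r0 + t *: r1).
Proof. by rewrite ep0 ep1 mulrDr !scalerAr. Qed.

Lemma size_line_cofactor (s t : K) : (size rs <= n)%N /\
  (size (s *: r0 + t *: r1)%R <= (n - size rs).+1)%N.
Proof.
have key u v : u != 0 \/ v != 0 -> (size rs <= n)%N /\
    (size (u *: r0 + v *: r1)%R <= (n - size rs).+1)%N.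
  move=> uv; have l0 := line_neq0 uv; rewrite line_factor in l0.
  have h0 : u *: r0 + v *: r1 != 0 by apply: contraNneq l0 => ->; rewrite mulr0.
  have : (size (u *: p 0 + v *: p 1)%R <= n.+1)%N.
    apply: leq_trans (size_polyD _ _) _; rewrite geq_max.
    by rewrite !(leq_trans (size_scale_leq _ _)) ?size_p.
  rewrite line_factor size_monicM ?monic_root_poly // size_root_poly.
  have : (0 < size (u *: r0 + v *: r1)%R)%N by rewrite size_poly_gt0.
  move: (size rs) (size (u *: r0 + v *: r1)%R) => e1 e2 h1 h2; split; lia.
have [->|s0] := eqVneq s 0; last by apply: key; left.
have [->|t0] := eqVneq t 0; last by apply: key; right.
rewrite !scale0r addr0 size_poly0; split=> //.
by case: (key 1 0); rewrite ?oner_neq0 //; left.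
Qed.

Lemma r_top : r0`_(n - size rs) != 0 \/ r1`_(n - size rs) != 0.
Proof.
have [hn _] := size_line_cofactor 0 0.
have e (r : {poly K}) : (size r <= (n - size rs).+1)%N -> (root_poly rs * r)`_n = r`_(n - size rs).
  move=> hr; rewrite -{1}(subnKC hn) coef_topM ?size_root_poly //.
  have /monicP := monic_root_poly; rewrite /lead_coef size_root_poly /= => ->.
  by rewrite mul1r.
have s0 : (size r0 <= (n - size rs).+1)%N.
  by have [_] := size_line_cofactor 1 0; rewrite scale1r scale0r addr0.
have s1 : (size r1 <= (n - size rs).+1)%N.
  by have [_] := size_line_cofactor 0 1; rewrite scale1r scale0r add0r.
by have := p_top; rewrite ep0 ep1 !e.
Qed.

(** If the Wronskian were 0, then by coprimality [r0] would divide its own derivative, hence be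
    constant in characteristic 0, and likewise [r1]. Two constants satisfy a linear relation, which
    would put the curve on a line. *)
Lemma wronskian_neq0 : r0 * r1^`() - r1 * r0^`() != 0.
Proof.
have line_r u v : u != 0 \/ v != 0 -> u *: r0 + v *: r1 != 0.
  move=> /line_neq0; rewrite line_factor; by apply: contraNneq => ->; rewrite mulr0.
have r00 : r0 != 0.
  by have := line_r 1 0; rewrite scale1r scale0r addr0; apply; left; rewrite oner_neq0.
have r10 : r1 != 0.
  by have := line_r 0 1; rewrite scale1r scale0r add0r; apply; right; rewrite oner_neq0.
apply/eqP => /eqP; rewrite subr_eq0 => /eqP e.
have deriv0 (q : {poly K}) : q %| q^`() -> (size q <= 1)%N.
  move=> hq; have [//|sq] := leqP (size q) 1.
  have d0 : q^`() = 0.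
    apply/eqP; apply: contraTT hq => d0; apply/negP => /(dvdp_leq d0).
    by rewrite leqNgt lt_size_deriv // -size_poly_gt0 ltnW.
  have := congr1 (coefp (size q).-2) d0; rewrite /= coef0 coef_deriv.
  have -> : ((size q).-2).+1 = (size q).-1 by case: (size q) sq => [|[|]].
  move/eqP; rewrite -[q`_ _]/(lead_coef q) -mulr_natr mulf_eq0 lead_coef_eq0.
  rewrite (iffLR (pcharf0P K) charK) -size_poly_eq0.
  by case: (size q) sq => [|[|m]].
have s0 : (size r0 <= 1)%N.
  apply: deriv0; rewrite -(Gauss_dvdpr _ cop) -e dvdp_mulr //.
have s1 : (size r1 <= 1)%N.
  have cop' : coprimep r1 r0 by rewrite coprimep_sym.
  by apply: deriv0; rewrite -(Gauss_dvdpr _ cop') e dvdp_mulr.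
have := line_r (r1`_0) (- r0`_0); rewrite (size1_polyC s0) (size1_polyC s1) !coefC /=.
rewrite -!mul_polyC -!rmorphM -rmorphD /= mulNr mulrC subrr eqxx => h.
suff : false by []; apply: h; left.
by apply: contraNneq r10 => z; rewrite (size1_polyC s1) z.
Qed.

(** Through each point of the list passes a line, here $v_uX_{u'}=v_{u'}X_u$ with $v_u\ne0$; off the
    zeros of its pull-back the parametrization cannot meet that point. *)
Lemma avoid_points (s : seq 'rV[K]_3) : exists2 b : {poly K}, b != 0 &
  forall t, b.[t] != 0 -> forall v, v \in s -> ~ proj_eq v (param a (aff q0 q1 t)).
Proof.
elim: s => [|v s [b b0 hb]]; first by exists 1; rewrite ?oner_neq0.
suff [b' b'0 hb'] : exists2 b' : {poly K}, b' != 0 & forall t, b'.[t] != 0 ->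
    ~ proj_eq v (param a (aff q0 q1 t)).
  exists (b' * b); first by rewrite mulf_neq0.
  move=> t; rewrite hornerM mulf_eq0 negb_or => /andP[t1 t2] z.
  by rewrite inE => /orP[/eqP ->|]; [apply: hb'|apply: hb].
have [v0|v0] := eqVneq v 0.
  exists 1; rewrite ?oner_neq0 // => t _ [k k0]; rewrite v0 scaler0 => h.
  by have /eqP := param0 (aff_neq0 q01 t).
have [u hu] : exists u, v 0 u != 0.
  apply: contrapT => h; case/eqP: v0; apply/rowP => u; rewrite mxE.
  by apply/eqP/negP => /negP hu; apply: h; exists u.
have [u' uu'] : exists u' : 'I_3, u' != u.
  by exists (lift u 0); rewrite eq_sym neq_lift.
pose co (i : 'I_3) : K := if i == u' then v 0 u else if i == u then - v 0 u' else 0.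
exists (\sum_i co i *: f i).
  by apply: no_linear; exists u'; rewrite /co eqxx.
move=> t ht [k k0 /rowP h]; case/eqP: ht; rewrite horner_sum.
rewrite (bigD1 u') //= (bigD1 u) 1?eq_sym //= big1 ?addr0 => [|i /andP[i1 i2]].
  have -> : co u' = v 0 u by rewrite /co eqxx.
  have -> : co u = - v 0 u' by rewrite /co [u == u']eq_sym (negPf uu') eqxx.
  by rewrite !hornerZ !horner_paramp !h !mxE; ring.
by rewrite /co (negPf i1) (negPf i2) scale0r horner0.
Qed.

(* On a general line [y = lam x] through [P] the equation is [x ^+ 2] times a
   polynomial of degree at most [n - 2], with one root for each of the [n - size rs]
   other points of the curve on the line; these are distinct because the Wronskian
   of [r0], [r1] is nonzero and the parametrization is generically injective. *)
Lemma size_roots_ge2 : (2 <= size rs)%N.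
Proof.
have [A [B [D [eg hABD]]]] := (iffLR (has_mult2P _)) P2.
have [bS bS0 hbS] := avoid_points S.
(* Parameters which the line should avoid: zeros of the Wronskian would be multiple intersections,
   zeros of [root_poly rs] lie over [P], zeros of [f c] leave the affine chart, and at zeros of [bS]
   generic injectivity may fail. *)
pose bad := (r0 * r1^`() - r1 * r0^`()) * root_poly rs * f c * bS.
have bad0 : bad != 0.
  by rewrite !mulf_neq0 ?wronskian_neq0 ?fc_neq0 // monic_neq0 ?monic_root_poly.
have [bs ebs] := closed_field_poly_normal bad.
pose lin (u v : K) : {poly K} := v%:P - u *: 'X.
have lin0 u v : u != 0 \/ v != 0 -> lin u v != 0.
  move=> uv; apply/eqP => z; have := congr1 (coefp 0) z; have := congr1 (coefp 1) z.
  rewrite /lin /= !coefB !coefC !coefZ !coefX /= ?coef0 mulr1 mulr0 subr0 sub0r.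
  by move/eqP; rewrite oppr_eq0 => /eqP u0 v0; case: uv; rewrite ?u0 ?v0 eqxx.
set a0 := A@_(mon2 0 0) in hABD; set b0 := B@_(mon2 0 0) in hABD.
set d0 := D@_(mon2 0 0) in hABD.
(* A slope [lam] that is not a root of [T] keeps the degree of [r1 - lam r0], avoids the zeros of
   [bad], and is not a tangent direction at [P]. *)
pose T := lin r0`_(n - size rs) r1`_(n - size rs) * \prod_(t <- bs) lin r0.[t] r1.[t]
  * (a0%:P + b0 *: 'X + d0 *: 'X^2).
have T0 : T != 0.
  rewrite !mulf_neq0 ?lin0 //; first exact: r_top.
    rewrite prodf_seq_neq0; apply/allP => t _; apply: lin0.
    have [h0|] := eqVneq r0.[t] 0; last by left.
    right; apply: (coprimep_root cop); exact/rootP.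
  apply/eqP => z; have := congr1 (coefp 0) z; have := congr1 (coefp 1) z.
  have := congr1 (coefp 2) z; rewrite /= !coefD !coefC !coefZ !coefX !coefXn /= ?coef0.
  rewrite !mulr0 !mulr1 !addr0 !add0r => z2 z1 z0.
  by move: hABD; rewrite z0 z1 z2 eqxx => -[].
have [lam] := elimT (closed_nonrootP T) T0; rewrite /root !hornerM.
rewrite !mulf_eq0 !negb_or => /andP[/andP[lam1 lam2] lam3].
pose h := r1 - lam *: r0.
have hn : (size rs <= n)%N by case: (size_line_cofactor 0 0).
have sh : size h = (n - size rs).+1.
  apply/eqP; rewrite eqn_leq; apply/andP; split.
    have [_] := size_line_cofactor (- lam) 1; rewrite scale1r scaleNr addrC //.
  apply: contraNltn lam1 => hs; apply/eqP.
  have : h`_(n - size rs) = 0 by apply: nth_default.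
  by rewrite /h coefB coefZ /lin !hornerE mulrC.
have h0 : h != 0 by rewrite -size_poly_gt0 sh.
have good t : h.[t] = 0 -> bad.[t] != 0.
  move=> ht; apply: contraNneq lam2 => bt; rewrite horner_prod prodf_seq_eq0.
  apply/hasP; exists t.
    have : root bad t by apply/rootP.
    by rewrite ebs rootZ ?lead_coef_eq0 // root_prod_XsubC.
  by rewrite /= /lin; move: ht; rewrite /h !hornerE => /eqP; rewrite mulrC.
have [zs ezs] := closed_field_poly_normal h.
have szs : size zs = (n - size rs)%N.
  have := congr1 (fun q : {poly K} => size q) ezs.
  by rewrite /= size_scale ?lead_coef_eq0 // size_prod_XsubC sh => -[].
have hz z : z \in zs -> h.[z] = 0.
  move=> zz; have /rootP e : root (\prod_(z <- zs) ('X - z%:P)) z.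
    by rewrite root_prod_XsubC.
  by rewrite ezs hornerZ e mulr0.
have uzs : uniq zs.
  rewrite -separable_prod_XsubC.
  have -> : separable_poly (\prod_(z <- zs) ('X - z%:P)) = separable_poly h.
    rewrite !separable_poly.unlock [in RHS]ezs derivZ.
    by rewrite coprimepZl ?coprimepZr ?lead_coef_eq0.
  (* At a common zero of [h] and its derivative both [r1 = lam r0] and [r1' = lam r0'] hold, so the
     Wronskian vanishes. *)
  rewrite separable_poly.unlock; apply/Pdiv.ClosedField.coprimepP => t /rootP ht.
  apply: contraNneq (good t ht) => ht'.
  rewrite /bad !hornerM hornerD hornerN !hornerM.
  move: ht ht'; rewrite /h derivB derivZ !hornerE => /eqP; rewrite subr_eq0 => /eqP e1.
  move=> /eqP; rewrite subr_eq0 => /eqP e2.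
  by rewrite e1 e2; apply/eqP; ring.
pose Gl : {poly K} := mmap polyC (pair2 'X (lam *: 'X)) (germ_at F P).
pose Gh : {poly K} := mmap polyC (pair2 'X (lam *: 'X)) A
  + lam *: mmap polyC (pair2 'X (lam *: 'X)) B
  + lam ^+ 2 *: mmap polyC (pair2 'X (lam *: 'X)) D.
have eGl : Gl = 'X ^+ 2 * Gh.
  rewrite /Gl eg !rmorphD !rmorphM /= !mmapX !mmap1U /pair2 /= /Gh -!mul_polyC; ring.
have Gh0 : Gh.[0] = a0 + b0 * lam + d0 * lam ^+ 2.
  have e0 (Q : {mpoly K[2]}) : (mmap polyC (pair2 'X (lam *: 'X)) Q).[0] = Q@_(mon2 0 0).
    rewrite horner_mmap -[RHS]/(idfun _) -(eval2_at0 idfun) /meval; apply: mmap_ext => i.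
    by rewrite /pair2; case: ifP; rewrite !hornerE.
  by rewrite /Gh !hornerD !hornerZ !e0 mulrC [lam ^+ 2 * _]mulrC.
have Gh0' : Gh != 0.
  apply: contraNneq lam3 => z; move: Gh0; rewrite z horner0 => /esym.
  by rewrite !hornerE => ->.
have sGl : (size Gl <= n.+1)%N.
  rewrite /Gl germ_eval /mmap.
  apply: leq_trans (size_sum _ _ _) _; apply/bigmax_leqP_seq => m mF _.
  rewrite mul_polyC; apply: leq_trans (size_scale_leq _ _) _.
  have <- : mdeg m = n by apply: (dhomog_mf F_homog).
  rewrite -(mmapX _ (@polyC K)) -[mdeg m]mul1n; apply: size_mmap_mon => u.
  case: (unlift c u) => [j|]; last by rewrite size_poly1.
  apply: leq_trans (size_polyD _ _) _; rewrite geq_max.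
  rewrite (leq_trans (size_polyC_leq1 _)) // andbT /pair2; case: ifP => _.
    by rewrite size_polyX.
  by apply: leq_trans (size_scale_leq _ _) _; rewrite size_polyX.
have sGh : (size Gh + 2 <= n.+1)%N.
  move: sGl; rewrite eGl size_monicM ?monicXn // size_polyXn.
  by rewrite addSn /= addnC.
pose be z := (p 0).[z] / (f c).[z].
have gz z : z \in zs -> [/\ bS.[z] != 0, (f c).[z] != 0, (root_poly rs).[z] != 0
    & r1.[z] = lam * r0.[z]].
  move=> /hz hz0; have := good z hz0; rewrite /bad !hornerM !mulf_eq0 !negb_or.
  move=> /andP[/andP[/andP[_ h1] h2] h3]; split=> //.
  by move: hz0; rewrite /h !hornerE => /eqP; rewrite subr_eq0 => /eqP.
have p1z z : z \in zs -> (p 1).[z] = lam * (p 0).[z].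
  by move=> /gz[_ _ _ e]; rewrite ep0 ep1 !hornerM e; ring.
have be_inj : {in zs &, injective be}.
  move=> z z' zz zz' ebe; have [bz fz _ _] := gz z zz; have [_ fz' _ _] := gz z' zz'.
  apply: (proj_eq_aff_inj q01); apply: generic_inj; try exact: aff_neq0.
    exact: hbS.
  exists ((f c).[z'] / (f c).[z]); first by rewrite mulf_neq0 ?invr_eq0.
  have pE j : (p j).[z'] / (f c).[z'] = (p j).[z] / (f c).[z].
    have ebe' : (p 0).[z'] / (f c).[z'] = (p 0).[z] / (f c).[z] := esym ebe.
    have [->|->] := ord2P j.
      by [].
    by rewrite !p1z // -!mulrA ebe'.
  apply/rowP => u; rewrite [RHS]mxE !param_row !mxE.
  case: (unliftP c u) => [j|] ->; last by field.
  have fE t : (f c).[t] != 0 -> (f (lift c j)).[t]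
     = (f c).[t] * ((p j).[t] / (f c).[t] + P 0 (lift c j) / P 0 c).
    by move=> ft; rewrite /tangent_form !hornerE; field; rewrite ft chart_neq0.
  by rewrite !fE // pE; field; rewrite fz chart_neq0.
have Gh_root z : z \in zs -> root Gh (be z).
  move=> zz; have [_ fz wz e] := gz z zz.
  have be0 : be z != 0.
    rewrite /be mulf_neq0 ?invr_eq0 // ep0 hornerM mulf_neq0 //.
    apply/eqP => r0z; have : root r0 z by apply/rootP.
    by move/(coprimep_root cop); rewrite e r0z mulr0 eqxx.
  have : root Gl (be z).
    have := germ_pullback (P := P) (f := f) (psi := horner_eval z) F_homog fz.
    rewrite F_vanishes rmorph0 => /esym/eqP; rewrite mulf_eq0 expf_eq0.
    rewrite (negPf fz) andbF /= => /eqP e2; apply/rootP; rewrite -[RHS]e2 /Gl.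
    rewrite horner_mmap /meval; apply: mmap_ext2 => [k|i].
      by rewrite /= horner_evalE hornerC.
    rewrite /pair2; case: ifP => _; rewrite ?horner_evalE ?hornerZ ?hornerX //.
    by rewrite p1z // -mulrA.
  rewrite eGl /root hornerM mulf_eq0 => /orP[|//].
  by rewrite horner_exp hornerX expf_eq0 (negPf be0).
have : (size (map be zs) < size Gh)%N.
  apply: max_poly_roots => //; first by apply/allP => _ /mapP[z zz ->]; apply: Gh_root.
  by rewrite map_inj_in_uniq.
rewrite size_map szs; move: hn sGh; move: (size rs) (size Gh) => e s; clear; lia.
Qed.

End GenericLine.

(** * Upper bound for the length of the fibre: generators modulo [W ^+ k] *)

Section Span.
Variables (K : closedFieldType) (L : fieldType).
Variable phi : {rmorphism {poly K} -> L}.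
Hypothesis phi_inj : injective phi.
Variable rs : seq K.
Local Notation ord := (loc_ord phi rs).
Local Notation iota := (iota phi).
Local Notation X0 := ('X_(0 : 'I_2) : {mpoly K[2]}).
Local Notation X1 := ('X_(1 : 'I_2) : {mpoly K[2]}).

Lemma ord_dvdp k p : ord k (phi p) -> root_poly rs ^+ k %| p.
Proof.
move=> [z [u [q [hq ->]]] e].
have cop : coprimep (root_poly rs ^+ k) q.
  apply: coprimep_expl; apply/Pdiv.ClosedField.coprimepP => r.
  by rewrite root_prod_XsubC => hr; case: hq => _; apply.
rewrite -(Gauss_dvdpl _ cop); apply/dvdpP; exists u; apply: phi_inj.
rewrite !rmorphM e rmorphXn; field.
exact: (loc_unit_phi phi_inj hq).
Qed.

Lemma dvdp_ord k p : root_poly rs ^+ k %| p -> ord k (phi p).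
Proof.
move=> /dvdpP[u ->]; exists (phi u); first exact: loc_phi.
by rewrite rmorphM rmorphXn mulrC.
Qed.

Variables x y : L.
Hypothesis ox : ord 1 x.
Hypothesis oy : ord 1 y.

Lemma peval_trunc k (q : {poly K}) :
  ord k (peval phi q x - \sum_(i < k) iota q`_i * x ^+ i).
Proof.
rewrite /peval (horner_coef_wide (n := k + size q)); last first.
  by rewrite size_map_poly leq_addl.
rewrite big_split_ord /= addrAC.
rewrite (_ : \sum_(i < k) (map_poly iota q)`_i * x ^+ i = \sum_(i < k) iota q`_i * x ^+ i);
  last by apply: eq_bigr => i _; rewrite coef_map.
rewrite subrr add0r; apply: (loc_ord_sum phi_inj) => i _.
apply: (loc_ordMl phi_inj); first by rewrite coef_map; apply: loc_iota.
apply: (loc_ord_le phi_inj (leq_addr i k)).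
exact: (loc_ordX phi_inj).
Qed.

Lemma graph_span k (c : {poly K}) (h : {mpoly K[2]}) : c.[0] = 0 ->
  ord k (y - peval phi c x) ->
  ord k (eval2 phi x y h
         - \sum_(i < k) iota (mmap polyC (pair2 'X c) h)`_i * x ^+ i).
Proof.
move=> c0 hk; have lx := loc_ord_loc phi_inj ox; have ly := loc_ord_loc phi_inj oy.
have := peval_trunc k (mmap polyC (pair2 'X c) h); rewrite peval_mmap pevalX => h1.
have h2 : ord k (eval2 phi x y h - eval2 phi x (peval phi c x) h).
  by apply: (loc_ord_eval2_sub phi_inj) => //; apply: (loc_peval phi_inj).
have := loc_ordD phi_inj h2 h1.
by rewrite addrA subrK.
Qed.

Definition quadratic_span (k : nat) (z : L) : Prop :=
  exists v1 v2 : 'I_k -> K,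
    ord k (z - (\sum_(i < k) iota (v1 i) * x ^+ i
                + \sum_(i < k) iota (v2 i) * (x ^+ i * y))).

Lemma quadratic_spanD k z1 z2 :
  quadratic_span k z1 -> quadratic_span k z2 -> quadratic_span k (z1 + z2).
Proof.
move=> [u1 [u2 hu]] [v1 [v2 hv]]; exists (fun i => u1 i + v1 i), (fun i => u2 i + v2 i).
have -> (b : 'I_k -> L) (s t : 'I_k -> K) : \sum_(i < k) iota (s i + t i) * b i =
    \sum_(i < k) iota (s i) * b i + \sum_(i < k) iota (t i) * b i.
  by rewrite -big_split; apply: eq_bigr => i _; rewrite rmorphD mulrDl.
have -> (b : 'I_k -> L) (s t : 'I_k -> K) : \sum_(i < k) iota (s i + t i) * b i =
    \sum_(i < k) iota (s i) * b i + \sum_(i < k) iota (t i) * b i.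
  by rewrite -big_split; apply: eq_bigr => i _; rewrite rmorphD mulrDl.
rewrite (_ : _ - _ = (z1 - (\sum_(i < k) iota (u1 i) * x ^+ i
      + \sum_(i < k) iota (u2 i) * (x ^+ i * y)))
   + (z2 - (\sum_(i < k) iota (v1 i) * x ^+ i
      + \sum_(i < k) iota (v2 i) * (x ^+ i * y)))); last by ring.
exact: (loc_ordD phi_inj).
Qed.

Lemma quadratic_spanZ k c z : quadratic_span k z -> quadratic_span k (iota c * z).
Proof.
move=> [u1 [u2 hu]]; exists (fun i => c * u1 i), (fun i => c * u2 i).
have e (b : 'I_k -> L) (s : 'I_k -> K) : \sum_(i < k) iota (c * s i) * b i =
    iota c * \sum_(i < k) iota (s i) * b i.
  by rewrite mulr_sumr; apply: eq_bigr => i _; rewrite rmorphM mulrA.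
rewrite !e -mulrDr -mulrBr; apply: (loc_ordMl phi_inj) => //; exact: loc_iota.
Qed.

Lemma sum_iota0 k (b : 'I_k -> L) : \sum_(i < k) iota 0 * b i = 0.
Proof. by rewrite big1 // => i _; rewrite rmorph0 mul0r. Qed.

Lemma sum_iota_delta k a (ak : (a < k)%N) (b : 'I_k -> L) :
  \sum_(i < k) iota (nat_of_ord i == a)%:R * b i = b (Ordinal ak).
Proof.
rewrite (bigD1 (Ordinal ak)) //= eqxx rmorph1 mul1r big1 ?addr0 // => i ia.
by rewrite (_ : (nat_of_ord i == a) = false) ?rmorph0 ?mul0r //; apply: negPf ia.
Qed.

Lemma quadratic_span_ord k z : ord k z -> quadratic_span k z.
Proof.
move=> hz; exists (fun=> 0), (fun=> 0).
by rewrite !sum_iota0 addr0 subr0.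
Qed.

Lemma quadratic_span_x k a : quadratic_span k (x ^+ a).
Proof.
have [ak|ka] := ltnP a k; last first.
  by apply/quadratic_span_ord/(loc_ord_le phi_inj ka)/(loc_ordX phi_inj).
exists (fun i => (nat_of_ord i == a)%:R), (fun=> 0).
rewrite sum_iota0 (sum_iota_delta ak) addr0 subrr; exact: loc_ord_zero.
Qed.

Lemma quadratic_span_xy k a : quadratic_span k (x ^+ a * y).
Proof.
have [ak|ka] := ltnP a k; last first.
  apply/quadratic_span_ord/(loc_ordMr phi_inj); last exact: loc_ord_loc oy.
  by apply/(loc_ord_le phi_inj ka)/(loc_ordX phi_inj).
exists (fun=> 0), (fun i => (nat_of_ord i == a)%:R).
rewrite sum_iota0 (sum_iota_delta ak) add0r subrr; exact: loc_ord_zero.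
Qed.

(* Modulo higher order terms the equation expresses [y ^+ 2] through [x ^+ 2]
   and [x * y], so only the monomials [x ^+ i] and [x ^+ i * y] are needed. *)
Lemma mult2_span k (g A B D h : {mpoly K[2]}) :
  g = X0 ^+ 2 * A + X0 * X1 * B + X1 ^+ 2 * D -> D@_(mon2 0 0) != 0 ->
  eval2 phi x y g = 0 -> quadratic_span k (eval2 phi x y h).
Proof.
move=> eg d0 eg0; have lx := loc_ord_loc phi_inj ox; have ly := loc_ord_loc phi_inj oy.
pose ev := eval2 phi x y.
(* Here [s] is what the order of [x ^+ a * y ^+ b] may lack to reach [k]. The outer induction is on
   [s]; for fixed [s], [mono] is proved by induction on the exponent of [y]. *)
suff main s a b (q : {mpoly K[2]}) : (k <= a + b + s)%N ->
    quadratic_span k (x ^+ a * y ^+ b * ev q).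
  by have := main k 0%N 0%N h (leqnn _); rewrite !expr0 !mul1r.
elim: s a b q => [|s IH] a b q hs.
  apply/quadratic_span_ord/(loc_ordMr phi_inj); last exact: loc_eval2.
  rewrite addn0 in hs; apply: (loc_ord_le phi_inj hs).
  by apply: (loc_ordM phi_inj); apply: (loc_ordX phi_inj).
suff mono c d : (k <= c + d + s.+1)%N -> quadratic_span k (x ^+ c * y ^+ d).
  have [q1 [q2 ->]] := hadamard q.
  have -> : x ^+ a * y ^+ b * ev ((q@_(mon2 0 0))%:MP + X0 * q1 + X1 * q2)
    = iota q@_(mon2 0 0) * (x ^+ a * y ^+ b)
      + (x ^+ a.+1 * y ^+ b * ev q1 + x ^+ a * y ^+ b.+1 * ev q2).
    by rewrite /ev !eval2E !exprS; ring.
  apply: quadratic_spanD; first by apply/quadratic_spanZ/mono.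
  by apply: quadratic_spanD; apply: IH; move: hs; clear; lia.
elim/ltn_ind: d c => d IHd c hcd.
case: d IHd hcd => [|[|d]] IHd hcd.
- by rewrite expr0 mulr1; apply: quadratic_span_x.
- by rewrite expr1; apply: quadratic_span_xy.
have key m n (q' : {mpoly K[2]}) : (n < d.+2)%N -> (m + n = c + d.+2)%N ->
    quadratic_span k (x ^+ m * y ^+ n * ev q').
  move=> hn emn; have [q1 [q2 ->]] := hadamard q'.
  have -> : x ^+ m * y ^+ n * ev ((q'@_(mon2 0 0))%:MP + X0 * q1 + X1 * q2)
    = iota q'@_(mon2 0 0) * (x ^+ m * y ^+ n)
      + (x ^+ m.+1 * y ^+ n * ev q1 + x ^+ m * y ^+ n.+1 * ev q2).
    by rewrite /ev !eval2E !exprS; ring.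
  apply: quadratic_spanD; first by apply/quadratic_spanZ/IHd => //; rewrite emn.
  by apply: quadratic_spanD; apply: IH; move: emn hcd; clear; lia.
have [D1 [D2 eD]] := hadamard D.
have evD : eval2 phi x y D = iota D@_(mon2 0 0) + x * ev D1 + y * ev D2.
  by rewrite {1}eD !eval2E.
(* The equation [g = 0] times [x ^+ c * y ^+ d] is solved for this monomial. The terms with [A] and
   [B] start with a smaller exponent of [y], those with [D1] and [D2] have larger total degree. *)
have -> : x ^+ c * y ^+ d.+2 = iota (- (D@_(mon2 0 0))^-1) *
    ((x ^+ c.+2 * y ^+ d * ev A + x ^+ c.+1 * y ^+ d.+1 * ev B)
     + (x ^+ c.+1 * y ^+ d.+2 * ev D1 + x ^+ c * y ^+ d.+3 * ev D2)).
  apply: (mulfI (x := iota D@_(mon2 0 0))); first by rewrite (iota_eq0 phi_inj).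
  rewrite [RHS]mulrA -rmorphM mulrN divff // rmorphN rmorph1 mulN1r.
  apply/eqP; rewrite -subr_eq0 opprK; apply/eqP.
  transitivity (x ^+ c * y ^+ d * ev g); last by rewrite /ev eg0 mulr0.
  rewrite /ev eg !eval2E evD !exprS; ring.
apply: quadratic_spanZ; apply: quadratic_spanD; apply: quadratic_spanD.
- by apply: key => //; rewrite !addSn !addnS.
- by apply: key => //; rewrite !addSn !addnS.
- by apply: IH; move: hcd; clear; lia.
- by apply: IH; move: hcd; clear; lia.
Qed.

End Span.

Section CodimensionOfSpan.
Variables (K : closedFieldType) (L : fieldType).
Variable phi : {rmorphism {poly K} -> L}.
Hypothesis phi_inj : injective phi.
Variables (rs : seq K) (P : 'rV[K]_3) (f : 'I_3 -> {poly K}).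
Local Notation c := (chart P).
Local Notation x := (phi (tangent_form P f 0) / phi (f c)).
Local Notation y := (phi (tangent_form P f 1) / phi (f c)).
Hypothesis fc0 : f c != 0.

Lemma form_order d (G : {mpoly K[3]}) : G \is d.-homog ->
  phi (mmap polyC f G) = phi (f c) ^+ d * eval2 phi x y (germ_at G P).
Proof.
move=> hG; rewrite (germ_pullback (P := P) (f := f) (psi := phi) hG) //.
by rewrite (phi_eq0 phi_inj).
Qed.

Lemma codim_hyp_of_span k r (b : 'I_r -> L) :
  (forall h, exists v : 'rV[K]_r,
     loc_ord phi rs k (eval2 phi x y h - \sum_i iota phi (v 0 i) * b i)) ->
  forall d, exists Phi : 'X_{1..3} -> 'rV[K]_r,
     forall N (a : 'I_N -> K) (m : 'I_N -> 'X_{1..3}),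
     (forall i, mdeg (m i) = d) -> \sum_i a i *: Phi (m i) = 0 ->
     root_poly rs ^+ k %| \sum_i a i *: mmap polyC f 'X_[m i].
Proof.
move=> hb d.
have [Phi hPhi] := choice (fun m : 'X_{1..3} => hb (germ_at 'X_[m] P)).
exists Phi => N a m hm hs; apply: (ord_dvdp phi_inj).
have -> : phi (\sum_i a i *: mmap polyC f 'X_[m i]) = phi (f c) ^+ d *
    \sum_i iota phi (a i) * (eval2 phi x y (germ_at 'X_[m i] P)
                             - \sum_j iota phi (Phi (m i) 0 j) * b j).
  under [in RHS]eq_bigr => i _ do rewrite mulrBr.
  rewrite big_split /= [X in _ + X](_ : _ = 0) ?addr0.
    rewrite rmorph_sum mulr_sumr; apply: eq_bigr => i _ /=.
    rewrite -mul_polyC rmorphM mulrCA; congr (_ * _).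
    by apply: form_order; rewrite dhomogX; apply/eqP/hm.
  rewrite sumrN; apply/eqP; rewrite oppr_eq0; apply/eqP.
  under eq_bigr => i _ do rewrite mulr_sumr.
  rewrite exchange_big big1 // => j _.
  transitivity (iota phi ((\sum_i a i *: Phi (m i)) 0 j) * b j); last first.
    by rewrite hs mxE rmorph0 mul0r.
  rewrite summxE rmorph_sum mulr_suml; apply: eq_bigr => i _.
  by rewrite mxE rmorphM mulrA.
apply: (loc_ordMl phi_inj); first by apply/(locX phi_inj)/loc_phi.
apply: (loc_ord_sum phi_inj) => i _; apply: (loc_ordMl phi_inj) => //.
exact: loc_iota.
Qed.

End CodimensionOfSpan.

(** * Smooth arcs and the image of a fat point *)

Section MpolyTools.
Variable K : closedFieldType.

Lemma mpoly_ring_ind (N : nat) (Q : {mpoly K[N]} -> Prop) :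
  (forall c, Q c%:MP) -> (forall i, Q 'X_i) ->
  (forall p q, Q p -> Q q -> Q (p + q)) -> (forall p q, Q p -> Q q -> Q (p * q)) ->
  forall p, Q p.
Proof.
move=> hC hX hD hM; elim/mpolyind => [|c m p _ _ IH]; first by rewrite -mpolyC0.
apply: (hD) IH; rewrite -mul_mpolyC; apply: (hM) => //; rewrite mpolyXE_id.
apply: big_ind => [||i _]; [by rewrite -mpolyC1|exact: hM|].
elim: (m i) => [|e IHe]; first by rewrite expr0 -mpolyC1.
by rewrite exprS; apply: (hM).
Qed.

(* The derivative of [H] at [w] in the direction [v], read off on the line
   [w + 'X v]. *)
Lemma directional_derivative (N : nat) (w v : 'I_N -> K) (H : {mpoly K[N]}) :
  let l := fun u => (w u)%:P + v u *: 'X in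
  (mmap polyC l H)`_0 = H.@[w] /\ (mmap polyC l H)`_1 = \sum_u v u * (H^`M(u)).@[w].
Proof.
move=> l; elim/mpoly_ring_ind: H => [c|i|p q [p0 p1] [q0 q1]|p q [p0 p1] [q0 q1]].
- rewrite mmapC !coefC mevalC /= big1 // => u _.
  by rewrite mderivC meval0 mulr0.
- rewrite mmapX mmap1U /l !coefD !coefC !coefZ !coefX /= mulr0 mulr1 addr0 add0r.
  rewrite mevalXU; split=> //; rewrite (bigD1 i) //= big1 ?addr0 => [|u ui].
    rewrite mderivX mnm1E eqxx scale1r.
    have -> : (U_(i) - U_(i) = 0)%MM by apply/mnmP => j; rewrite mnmBE mnm0E subnn.
    by rewrite mpolyX0 meval1 mulr1.
  by rewrite mderivX mnm1E eq_sym (negPf ui) scale0r meval0 mulr0.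
- rewrite rmorphD !coefD p0 p1 q0 q1 mevalD; split=> //; rewrite -big_split.
  by apply: eq_bigr => u _; rewrite mderivD mevalD mulrDr.
- rewrite rmorphM /= coef0M p0 q0 mevalM; split=> //.
  rewrite coefM !big_ord_recl big_ord0 /= p0 p1 q0 q1 addr0.
  rewrite mulr_sumr mulr_suml addrC -big_split; apply: eq_bigr => u _ /=.
  by rewrite mderivM mevalD !mevalM; ring.
Qed.

Lemma prod_ord3 (R : nzRingType) (E : 'I_3 -> R) :
  \prod_(u < 3) E u = E 0 * E 1 * E 2%:R.
Proof.
rewrite !big_ord_recl big_ord0 mulr1 mulrA.
by congr (E _ * E _ * E _); apply/val_inj.
Qed.

(** Kronecker substitution: [X_u] goes to ['X^(M ^ u)]. Exponents below [M] are digits in base [M],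
    so distinct monomials go to distinct powers, and the resulting polynomial in one variable
    vanishes everywhere. *)
Lemma mpoly3_eval0 (p : {mpoly K[3]}) : (forall v : 'I_3 -> K, p.@[v] = 0) -> p = 0.
Proof.
move=> h; apply/eqP; case: eqVneq => // p0.
pose M := msize p; pose e (m : 'X_{1..3}) := (m 0%R + M * m 1%R + M * M * m 2%:R)%N.
pose q : {poly K} := mmap polyC (fun u : 'I_3 => 'X^(M ^ u)) p.
have q0 : q = 0.
  by apply: poly_eval0 => t; rewrite horner_mmap; apply: h.
have eX m : mmap polyC (fun u : 'I_3 => 'X^(M ^ u)) 'X_[m] = 'X^(e m).
  rewrite mmapX /mmap1 prod_ord3 -!exprM -!exprD; congr ('X^_).
  by rewrite /e expn0 expn1 (_ : (M ^ 2 = M * M)%N) ?mul1n // expnS expn1.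
have small m u : m \in msupp p -> (m u < M)%N.
  move=> /msize_mdeg_lt; apply: leq_ltn_trans.
  by rewrite mdegE (bigD1 u) //= leq_addr.
have e_inj : {in msupp p &, injective e}.
  have digit a b : (a < M)%N -> ((a + M * b) %% M)%N = a /\ ((a + M * b) %/ M)%N = b.
    move=> aM; have M0 : (0 < M)%N by apply: leq_ltn_trans aM.
    by rewrite mulnC addnC modnMDl divnMDl // modn_small // divn_small ?addn0.
  have eE m : e m = (m 0%R + M * (m 1%R + M * m 2%:R))%N by rewrite /e; lia.
  move=> m m' hm hm' emm'; rewrite !eE in emm'.
  have [e1 d1] := digit _ (m 1%R + M * m 2%:R)%N (small m 0 hm).
  have [e1' d1'] := digit _ (m' 1%R + M * m' 2%:R)%N (small m' 0 hm').
  have [e2 d2] := digit _ (m 2%:R) (small m 1 hm).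
  have [e2' d2'] := digit _ (m' 2%:R) (small m' 1 hm').
  rewrite emm' in e1 d1; rewrite d1' in d1; rewrite e1' in e1; rewrite -d1 in e2 d2.
  rewrite e2' in e2; rewrite d2' in d2.
  apply/mnmP => u; case: u => [[|[|[|]]]] //= hu.
  - by rewrite (_ : Ordinal hu = 0) ?e1 //; apply/val_inj.
  - by rewrite (_ : Ordinal hu = 1) ?e2 //; apply/val_inj.
  - by rewrite (_ : Ordinal hu = 2%:R) ?d2 //; apply/val_inj.
have : q`_(e (mlead p)) = p@_(mlead p).
  rewrite /q {1}(mpolyE p) raddf_sum coef_sum (bigD1_seq (mlead p)) ?mlead_supp ?msupp_uniq //=.
  rewrite mmapZ eX mul_polyC coefZ coefXn eqxx mulr1 big_seq_cond big1 ?addr0 //.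
  move=> m /andP[hm mm]; rewrite mmapZ eX mul_polyC coefZ coefXn.
  case: eqP => [ee|]; last by rewrite mulr0.
  by case/eqP: mm; apply: e_inj; rewrite ?mlead_supp.
by rewrite q0 coef0 => /esym/eqP; rewrite mleadc_eq0 (negPf p0).
Qed.
End MpolyTools.

(** * A squarefree form with a prescribed smooth arc at [P] *)

Section SmoothCurve.
Variables (K : closedFieldType) (P : 'rV[K]_3).
Hypothesis P0 : P != 0.
Local Notation c := (chart P).
Local Notation Pc := (chart_neq0 P0).

Definition tangent_coord (j : 'I_2) : {mpoly K[3]} :=
  'X_(lift c j) - (P 0 (lift c j) / P 0 c) *: 'X_c.

Lemma tangent_coord_homog j : tangent_coord j \is 1.-homog.
Proof. by rewrite rpredB ?rpredZ // dhomogX; apply/eqP/mdeg1. Qed.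

Lemma Xc_homog : 'X_c \is [in K[3], 1.-homog].
Proof. by rewrite dhomogX; apply/eqP/mdeg1. Qed.

Lemma homogX (N d : nat) (p : {mpoly K[N]}) : p \is 1.-homog -> p ^+ d \is d.-homog.
Proof. by move=> hp; have := dhomogMn d hp; rewrite mul1n. Qed.

Variables jT jY : 'I_2.
Hypothesis jTY : jT != jY.
Local Notation Tm := (tangent_coord jT).
Local Notation Ym := (tangent_coord jY).
Local Notation Zm := ('X_c : {mpoly K[3]}).

Lemma ord2_cases (j : 'I_2) : j = jT \/ j = jY.
Proof.
move: jTY; case: j jT jY => [[|[|[]]]] // h1 [[|[|[]]]] // h2 [[|[|[]]]] // h3 _;
  by [left; apply/val_inj|right; apply/val_inj].
Qed.

Variables (q : {poly K}) (D : nat).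
Hypothesis D2 : (2 <= D)%N.
Hypothesis sq : (size q <= D)%N.

(* The homogenization of [y - q(x) + x ^ D]; the last term makes it squarefree. *)
Definition smooth_form : {mpoly K[3]} :=
  Ym * Zm ^+ D.-1 - \sum_(i < D) q`_i *: (Tm ^+ i * Zm ^+ (D - i)) + Tm ^+ D.

Lemma smooth_form_homog : smooth_form \is D.-homog.
Proof.
have hT := tangent_coord_homog jT; have hY := tangent_coord_homog jY.
have hZ := Xc_homog.
apply: rpredD; last exact: homogX.
apply: rpredB.
  by have := dhomogM hY (homogX D.-1 hZ); rewrite add1n prednK // ltnW.
apply: rpred_sum => i _; apply: rpredZ.
by have := dhomogM (homogX i hT) (homogX (D - i) hZ); rewrite subnKC // ltnW.
Qed.

Section SmoothFormEval.
Variables (R : comNzRingType) (f : {rmorphism K -> R}) (v : 'I_3 -> R).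

Lemma mmap_tangent_coord j :
  mmap f v (tangent_coord j) = v (lift c j) - f (P 0 (lift c j) / P 0 c) * v c.
Proof. by rewrite rmorphB /= mmapZ !mmapX !mmap1U. Qed.

Lemma mmap_smooth_form :
  mmap f v smooth_form = mmap f v Ym * v c ^+ D.-1
    - \sum_(i < D) f q`_i * (mmap f v Tm ^+ i * v c ^+ (D - i)) + mmap f v Tm ^+ D.
Proof.
rewrite /smooth_form; move: Ym Tm => Y0 T0.
rewrite rmorphD rmorphB rmorphM !rmorphXn /= mmapX mmap1U.
congr (_ - _ + _); rewrite rmorph_sum; apply: eq_bigr => i _ /=.
by rewrite mmapZ rmorphM !rmorphXn /= mmapX mmap1U.
Qed.

End SmoothFormEval.

Lemma mderiv_expr (u : 'I_3) (p : {mpoly K[3]}) k : p^`M(u) = 0 -> (p ^+ k)^`M(u) = 0.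
Proof.
move=> h; elim: k => [|k IH]; first by rewrite expr0 -mpolyC1 mderivC.
by rewrite exprS mderivM h IH mul0r mulr0 addr0.
Qed.

Lemma mderivXU (u i : 'I_3) : ('X_i : {mpoly K[3]})^`M(u) = (i == u)%:R%:MP.
Proof.
rewrite mderivX mnm1E; case: eqP => [->|_]; last by rewrite scale0r mpolyC0.
rewrite scale1r (_ : (U_(u) - U_(u) = 0)%MM) ?mpolyX0 ?mpolyC1 //.
by apply/mnmP => j; rewrite mnmBE mnm0E subnn.
Qed.

Lemma mderiv_tangent_coord j j' : (tangent_coord j)^`M(lift c j') = (j == j')%:R%:MP.
Proof.
rewrite /tangent_coord mderivB mderivZ !mderivXU (negPf (neq_lift _ _)).
by rewrite (inj_eq lift_inj) mpolyC0 scaler0 subr0.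
Qed.

(** Neither [Tm] nor [Zm] contains the variable of index [lift c jY], so the derivative is
    [Zm ^+ D.-1], which is nonzero at [P]. *)
Lemma smooth_form_deriv : eval_at (smooth_form^`M(lift c jY)) P != 0.
Proof.
have hT : Tm^`M(lift c jY) = 0 by rewrite mderiv_tangent_coord (negPf jTY) mpolyC0.
have hZ : Zm^`M(lift c jY) = 0 by rewrite mderivXU (negPf (neq_lift _ _)) mpolyC0.
have -> : smooth_form^`M(lift c jY) = Zm ^+ D.-1.
  rewrite /smooth_form mderivD mderivB (mderiv_expr _ hT) addr0.
  rewrite mderivM mderiv_tangent_coord eqxx mpolyC1 mul1r (mderiv_expr _ hZ) mulr0 addr0.
  have -> : (\sum_(i < D) q`_i *: (Tm ^+ i * Zm ^+ (D - i)))^`M(lift c jY)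
      = \sum_(i < D) (q`_i *: (Tm ^+ i * Zm ^+ (D - i)))^`M(lift c jY).
    exact: (raddf_sum (mderiv (lift c jY))).
  rewrite big1 ?subr0 ?addr0 // => i _.
  by rewrite mderivZ mderivM (mderiv_expr _ hT) (mderiv_expr _ hZ) mul0r mulr0 addr0 scaler0.
by rewrite /eval_at rmorphXn /= mevalXU expf_neq0 // Pc.
Qed.

Definition affine_point (R : comNzRingType) (f : {rmorphism K -> R}) (z t y : R)
    (u : 'I_3) : R :=
  if unlift c u is Some j then (if j == jT then t else y) + f (P 0 u / P 0 c) * z else z.

Lemma affine_pointE (R : comNzRingType) (f : {rmorphism K -> R}) (z t y : R) :
  [/\ affine_point f z t y c = z, mmap f (affine_point f z t y) Tm = t
    & mmap f (affine_point f z t y) Ym = y].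
Proof.
rewrite !mmap_tangent_coord /affine_point unlift_none !liftK eqxx.
by rewrite [jY == jT]eq_sym (negPf jTY) !addrK.
Qed.

Lemma affine_point_cover (v : 'I_3 -> K) :
  v =1 affine_point idfun (v c) (mmap idfun v Tm) (mmap idfun v Ym).
Proof.
move=> u; rewrite /affine_point !mmap_tangent_coord /=.
case: (unliftP c u) => [j|] -> //.
by case: (ord2_cases j) => ->; rewrite ?eqxx ?[jY == jT]eq_sym ?(negPf jTY) subrK.
Qed.

(** Where [z] is nonzero the form is linear in [y] with leading coefficient [z ^+ D.-1], so it has
    no double zero; where [z = 0] it is [t ^+ D]. Hence [A] can vanish only at [z = t = 0]. On the
    line from [(1, 0, 0)] to a point with [t] nonzero it has no zero, so it is constant there; it is
    then constant off [Tm = 0], hence everywhere. *)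
Lemma smooth_form_squarefree : squarefree_form smooth_form.
Proof.
move=> A B e.
pose pt := affine_point (idfun : {rmorphism K -> K}).
have D0 : (0 < D)%N by apply: ltnW.
have eH z t y : (mmap idfun (pt z t y) A) ^+ 2 * mmap idfun (pt z t y) B =
    y * z ^+ D.-1 - \sum_(i < D) q`_i * (t ^+ i * z ^+ (D - i)) + t ^+ D.
  have := congr1 (mmap idfun (pt z t y)) e; rewrite mmap_smooth_form !rmorphM /=.
  have [h1 h2 h3] : [/\ pt z t y c = z, mmap idfun (pt z t y) Tm = t
      & mmap idfun (pt z t y) Ym = y] := affine_pointE idfun z t y.
  by rewrite h1 h2 h3 -expr2.
have A_neq0 z t y : z != 0 \/ t != 0 -> mmap idfun (pt z t y) A != 0.
  have [z0|z0 _] := eqVneq z 0.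
    case=> // t0; apply: contraNneq t0 => A0; have := eH z t y.
    rewrite A0 expr0n mul0r z0 expr0n -subn1 subn_eq0 leqNgt D2 mulr0 sub0r.
    rewrite big1 ?oppr0 ?add0r => [|i _].
      by move=> /esym/eqP; rewrite expf_eq0 => /andP[].
    by rewrite expr0n subn_eq0 leqNgt ltn_ord !mulr0.
  apply/eqP => A0.
  pose l : 'I_3 -> {poly K} := affine_point (@polyC K) z%:P t%:P 'X.
  have lE (G : {mpoly K[3]}) s : (mmap polyC l G).[s] = mmap idfun (pt z t s) G.
    rewrite horner_mmap /meval; apply: mmap_ext => u.
    rewrite /l /pt /affine_point; case: (unlift c u) => [j|]; rewrite ?hornerE //.
    by case: ifP; rewrite !hornerE.
  have /factor_theorem[A' eA] : root (mmap polyC l A) y by apply/rootP; rewrite lE.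
  have := congr1 (mmap polyC l) e; rewrite mmap_smooth_form !rmorphM /=.
  have [h1 h2 h3] : [/\ l c = z%:P, mmap polyC l Tm = t%:P & mmap polyC l Ym = 'X]
    := affine_pointE (@polyC K) z%:P t%:P 'X.
  rewrite h1 h2 h3 eA => e2.
  pose k : K := t ^+ D - \sum_(i < D) q`_i * (t ^+ i * z ^+ (D - i)).
  have e3 : z ^+ D.-1 *: 'X + k%:P = A' * ('X - y%:P) * (A' * ('X - y%:P)) * mmap polyC l B.
    rewrite -e2 /k rmorphB rmorphXn rmorph_sum /= -mul_polyC rmorphXn.
    rewrite [X in _ + (_ - X)](_ : _ =
      \sum_(i < D) (q`_i)%:P * (t%:P ^+ i * z%:P ^+ (D - i))); first by ring.
    by apply: eq_bigr => i _; rewrite !rmorphM !rmorphXn.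
  have := congr1 (fun p : {poly K} => (p^`()).[y]) e3.
  rewrite derivD derivZ derivX derivC addr0 !derivM derivB derivX derivC subr0.
  rewrite !(hornerD, hornerM, hornerN, hornerX, hornerC, hornerZ) subrr mulr1 => e4.
  have /eqP : z ^+ D.-1 = 0 by rewrite e4; ring.
  by rewrite expf_eq0 (negPf z0) andbF.
pose a0 := mmap idfun (pt 1 0 0) A.
have A_const z t y : t != 0 -> mmap idfun (pt z t y) A = a0.
  move=> t0; pose l : 'I_3 -> {poly K} :=
    affine_point (@polyC K) (1 + (z - 1) *: 'X) (t *: 'X) (y *: 'X).
  have lE s : (mmap polyC l A).[s] = mmap idfun (pt (1 + (z - 1) * s) (t * s) (y * s)) A.
    rewrite horner_mmap /meval; apply: mmap_ext => u.
    rewrite /l /pt /affine_point; case: (unlift c u) => [j|]; rewrite ?hornerE //.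
    by case: ifP; rewrite !hornerE.
  have /size_poly1P[k k0 ek] : size (mmap polyC l A) == 1%N.
    apply/closed_rootP => -[s] /rootP; rewrite lE => /eqP; apply/negP/A_neq0.
    have [->|s0] := eqVneq s 0; first by left; rewrite mulr0 addr0 oner_neq0.
    by right; rewrite mulf_neq0.
  have := lE 1; have := lE 0; rewrite ek !hornerC !mulr0 !mulr1 addr0 /a0 => <- ->.
  by rewrite addrC subrK.
have : Tm * (A - a0%:MP) = 0.
  apply: mpoly3_eval0 => v; rewrite mevalM [(A - _).@[v]]mevalB mevalC.
  have [t0|t0] := eqVneq (mmap idfun v Tm) 0; first by rewrite /meval t0 mul0r.
  have -> : A.@[v] = a0.
    by rewrite /meval (mmap_ext _ (affine_point_cover v)) A_const.
  by rewrite subrr mulr0.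
have T0 : Tm != 0.
  have [_ hT _] := affine_pointE (idfun : {rmorphism K -> K}) 0 1 0.
  by apply/eqP => z; move: hT; rewrite z rmorph0 => /esym/eqP; rewrite oner_eq0.
move/eqP; rewrite mulf_eq0 (negPf T0) subr_eq0 => /eqP ->.
by rewrite msizeC leq_b1.
Qed.

End SmoothCurve.

(** * Contact and the curvilinearity of the image *)

Section ImageContact.
Variables (K : closedFieldType) (L : fieldType).
Variable phi : {rmorphism {poly K} -> L}.
Hypothesis phi_inj : injective phi.
Variables (n : nat) (a : 'M[K]_(3, n.+1)) (P : 'rV[K]_3).
Hypothesis P0 : P != 0.
Local Notation c := (chart P).
Variable f : 'I_3 -> {poly K}.
Variables (tau1 tau2 : K) (r0 r1 : {poly K}).
Local Notation rs := [:: tau1; tau2].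
Local Notation W := (root_poly rs).
Local Notation p := (tangent_form P f).
Hypothesis ep0 : p 0 = W * r0.
Hypothesis ep1 : p 1 = W * r1.
Hypothesis cop : coprimep r0 r1.
Hypothesis fc_unit : loc_unit rs (f c).
Local Notation x := (phi (p 0) / phi (f c)).
Local Notation y := (phi (p 1) / phi (f c)).
Local Notation ord := (loc_ord phi rs).
Local Notation iota := (iota phi).

Lemma fc_phi_neq0 : phi (f c) != 0. Proof. exact: (loc_unit_phi phi_inj fc_unit). Qed.

Lemma immersed_branch : immersed phi rs x y.
Proof.
have [/= [u v] /= euv] := Bezout_eq1_coprimepP _ _ cop.
exists (phi r0 / phi (f c)), (phi r1 / phi (f c)); split.
- by exists r0, (f c).
- by exists r1, (f c).
- by rewrite ep0 rmorphM mulrA.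
- by rewrite ep1 rmorphM mulrA.
exists (phi (u * f c)), (phi (v * f c)), 0; split; try exact: loc_phi.
  exists 0, 1; split; [|by move=> r _; rewrite horner0|by rewrite rmorph0 mul0r].
  exact: (loc_unitC _ (oner_neq0 K)).
rewrite addr0 -(rmorph1 phi) -euv rmorphD !rmorphM; field.
exact: fc_phi_neq0.
Qed.

Lemma coprime_W k q : loc_unit rs q -> coprimep (W ^+ k) q.
Proof.
move=> hq; apply: coprimep_expl; apply/Pdiv.ClosedField.coprimepP => r.
by rewrite root_prod_XsubC => hr; case: hq => _; apply.
Qed.

Lemma dvd_iff_ord k d (G : {mpoly K[3]}) : G \is d.-homog ->
  W ^+ k %| mmap polyC f G <-> ord k (eval2 phi x y (germ_at G P)).
Proof.
move=> hG; have [fc0 _] := fc_unit.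
have e := form_order phi_inj (P := P) fc0 hG.
have inv : loc_invertible phi rs (phi (f c) ^+ d).
  split; first exact/(locX phi_inj)/loc_phi.
    by rewrite expf_neq0 // fc_phi_neq0.
  rewrite -exprVn; apply: (locX phi_inj); exists 1, (f c).
  by rewrite rmorph1 div1r.
split=> [/(dvdp_ord phi)|h].
  by rewrite e => /(loc_ord_invertible phi_inj inv).
apply: (ord_dvdp phi_inj); rewrite e; apply: (loc_ordMl phi_inj) => //.
by case: inv.
Qed.

Lemma eval_tau (G : {mpoly K[3]}) k tau : tau \in rs -> (0 < k)%N ->
  W ^+ k %| mmap polyC f G -> eval_at G (\row_u (f u).[tau]) = 0.
Proof.
move=> ht k0 /dvdpP[q e].
have -> : eval_at G (\row_u (f u).[tau]) = (mmap polyC f G).[tau].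
  by rewrite horner_mmap; apply: meval_eq => u; rewrite mxE.
by rewrite e hornerM horner_exp root_poly_root // expr0n eqn0Ngt k0 mulr0.
Qed.

Lemma row_tau_neq0 tau : tau \in rs -> \row_u (f u).[tau] != 0.
Proof.
move=> ht; apply/eqP => /rowP /(_ c); rewrite !mxE => /eqP.
by case: fc_unit => _ /(_ _ ht) /negPf ->.
Qed.

Lemma p_tau j tau : tau \in rs -> (p j).[tau] = 0.
Proof.
move=> ht; have [->|->] := ord2P j.
  by rewrite ep0 hornerM root_poly_root ?mul0r.
by rewrite ep1 hornerM root_poly_root ?mul0r.
Qed.

Lemma row_tau_proj tau : tau \in rs -> proj_eq P (\row_u (f u).[tau]).
Proof.
move=> ht; apply/(tangent_root P0 (f := f)); last by move=> j; apply: p_tau.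
by left; case: fc_unit => _; apply.
Qed.

Variables (J : {mpoly K[3]} -> Prop) (k : nat).
Hypothesis k_gt0 : (0 < k)%N.
Hypothesis J_dvd : forall G, J G -> W ^+ k %| mmap polyC f G.
Hypothesis dvd_J : forall d G, G \is d.-homog -> W ^+ k %| mmap polyC f G -> J G.
Hypothesis J_mul : forall A G, J G -> J (A * G).
Hypothesis J_curve : forall G, vanishing_ideal (on_curve a) G -> J G.
Hypothesis J_vanish : forall G w, J G -> proj_eq P w -> eval_at G w = 0.

Lemma tau1_in : tau1 \in rs. Proof. by rewrite inE eqxx. Qed.

Lemma saturation_dvd G : saturation J G -> W ^+ k %| mmap polyC f G.
Proof.
move=> [N /(_ c) /J_dvd]; rewrite rmorphM rmorphXn /= mmapX mmap1U mulrC.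
rewrite Gauss_dvdpl //; elim: N => [|N IH]; first by rewrite expr0 coprimep1.
by rewrite exprS coprimepMr IH coprime_W.
Qed.

Lemma J_saturation G : J G -> saturation J G.
Proof. by move=> h; exists 0%N => i; rewrite expr0 mul1r. Qed.

(** The curve [H] that contains the scheme has a germ of multiplicity 1 at [P], whose value on the
    branches has order [k], so the implicit function theorem gives the contact. *)
Lemma contact_of_curvilinear : curvilinear J -> contact phi rs k x y.
Proof.
move=> [P' [P'0 sup [d [H [hH _ sub [u hu]]]]]].
have sH : saturation J H.
  by apply: sub; exists 0%N => i; rewrite expr0 mul1r; exists 1; rewrite mul1r.
have dH := saturation_dvd sH.
have w0 := row_tau_neq0 tau1_in.
have P'w : proj_eq P' (\row_u (f u).[tau1]).
  by apply/(sup _ w0) => G /J_dvd; apply: eval_tau; rewrite ?tau1_in.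
have PP' : proj_eq P P'.
  exact: proj_eq_trans (row_tau_proj tau1_in) (proj_eq_sym P'w).
have [s s0 eP'] := PP'.
have Pc := chart_neq0 P0.
have P'c : P' 0 c != 0 by rewrite eP' mxE mulf_neq0.
have HP' : eval_at H P' = 0.
  have [N /(_ c) JN] := sH; have := (sup _ P'0).2 (proj_eq_refl P') _ JN.
  rewrite /eval_at mevalM rmorphXn /= mevalXU => /eqP; rewrite mulf_eq0 expf_eq0.
  by rewrite (negPf P'c) andbF /= => /eqP.
pose h := germ_at H P.
have ePu i : P' 0 i = P' 0 c * (P 0 i / P 0 c).
  by rewrite eP' !mxE; field.
have lineE (v : 'I_3 -> K) : v c = 0 ->
    mmap polyC (fun i => (P' 0 i)%:P + v i *: 'X) H = (P' 0 c ^+ d)%:P *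
    mmap polyC (pair2 ((v (lift c 0) / P' 0 c) *: 'X) ((v (lift c 1) / P' 0 c) *: 'X)) h.
  move=> vc; rewrite germ_eval rmorphXn -(mmap_homog _ _ _ hH); apply: mmap_ext => i.
  case: (unliftP c i) => [j|] ->; last by rewrite vc scale0r addr0 mulr1.
  rewrite {1}ePu rmorphM mulrDr addrC; congr (_ + _); last by rewrite !rmorphM.
  have -> : pair2 ((v (lift c 0) / P' 0 c) *: 'X) ((v (lift c 1) / P' 0 c) *: 'X) j
    = (v (lift c j) / P' 0 c) *: 'X.
    have [->|->] := ord2P j; last by [].
    by [].
  by rewrite -!mul_polyC mulrA -rmorphM /= [P' 0 c * _]mulrC divfK.
have h00 : h@_(mon2 0 0) = 0.
  pose v0 : 'I_3 -> K := fun=> 0.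
  have e1 : mmap polyC (fun i => (P' 0 i)%:P + v0 i *: 'X) H = (eval_at H P')%:P.
    rewrite [RHS](rmorph_mmap _ (@polyC K)).
    by apply: mmap_ext2 => // i; rewrite /= scale0r addr0.
  have := lineE v0 erefl; rewrite e1 HP' mul0r scale0r eval2_at0 -rmorphM.
  move=> /polyC_inj/esym/eqP.
  by rewrite mulf_eq0 expf_eq0 (negPf P'c) andbF /= => /eqP.
have m1 : has_mult 1 h.
  apply/has_mult1P; split=> //; apply: contrapT => hn.
  have h10 : h@_(mon2 1 0) = 0 by apply/eqP/negP => /negP z; apply: hn; left.
  have h01 : h@_(mon2 0 1) = 0 by apply/eqP/negP => /negP z; apply: hn; right.
  have dir0 (v : 'I_3 -> K) : v c = 0 -> \sum_i v i * (H^`M(i)).@[fun i => P' 0 i] = 0.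
    move=> vc; have [_ <-] := directional_derivative (fun i => P' 0 i) v H.
    rewrite lineE // coefCM; apply/eqP; rewrite mulf_eq0; apply/orP; right.
    have [A [B [D ->]]] := taylor2 h; rewrite h00 h10 h01 mpolyC0 !scale0r !add0r.
    rewrite !rmorphD !rmorphM /= !mmapX !mmap1U /pair2 /=.
    move: (mmap _ _ A) (mmap _ _ B) (mmap _ _ D) => mA mB mD.
    move: (_ / _) (_ / _) => be al; rewrite -!mul_polyC.
    rewrite [X in polyseq X](_ : _ = 'X * ('X *
      (al%:P ^+ 2 * mA + al%:P * be%:P * mB + be%:P ^+ 2 * mD))); last by ring.
    by rewrite !coefXM.
  have lift0 j : (H^`M(lift c j)).@[fun i => P' 0 i] = 0.
    have := dir0 (fun i => (i == lift c j)%:R); rewrite (negPf (neq_lift _ _)) => /(_ erefl).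
    rewrite (bigD1 (lift c j)) //= eqxx mul1r big1 ?addr0 // => i /negPf ->.
    by rewrite mul0r.
  (* The derivatives in the two affine directions vanish with the linear part of the germ; Euler's
     relation at the zero [P'] of [H] covers the remaining one. *)
  have euler : \sum_i P' 0 i * (H^`M(i)).@[fun i => P' 0 i] = 0.
    have [_ <-] := directional_derivative (fun i => P' 0 i) (fun i => P' 0 i) H.
    have -> : mmap polyC (fun i => (P' 0 i)%:P + P' 0 i *: 'X) H = 0; last by rewrite coef0.
    transitivity (mmap polyC (fun i => (1 + 'X) * (P' 0 i)%:P) H).
      by apply: mmap_ext => i; rewrite -mul_polyC; ring.
    rewrite (mmap_homog _ _ _ hH) (_ : mmap _ _ H = (eval_at H P')%:P).
      by rewrite HP' mulr0.
    by rewrite [RHS](rmorph_mmap _ (@polyC K)); apply: mmap_ext2.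
  case/eqP: hu; rewrite /eval_at; case: (unliftP c u) => [j|] ->; first exact: lift0.
  move: euler; rewrite (bigD1_ord c) //= big1 ?addr0 => [/eqP|j _]; last by rewrite lift0 mulr0.
  by rewrite mulf_eq0 (negPf P'c) => /eqP.
have [ox oy] := immersed_ord immersed_branch.
by apply: (contact_of_mult1 phi_inj m1 ox oy); apply/(dvd_iff_ord _ hH).
Qed.

Section Graph.
Variables jT jY : 'I_2.
Hypothesis jTY : jT != jY.
Local Notation xT := (phi (p jT) / phi (f c)).
Local Notation xY := (phi (p jY) / phi (f c)).
Variable q : {poly K}.
Hypothesis q0 : q.[0] = 0.
Hypothesis graph : ord k (xY - peval phi q xT).
Hypothesis span : forall G, exists v : 'I_k -> K,
  ord k (eval2 phi x y (germ_at G P) - \sum_(i < k) iota (v i) * xT ^+ i).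

(** At least 2 for squarefreeness, at least [size q] to homogenize [q], and at least [k] so that the
    pull-back of the extra term is divisible by [W ^+ k]. *)
Let D := maxn 2 (maxn k (size q)).

Lemma ord_p j : ord 1 (phi (p j) / phi (f c)).
Proof.
have [ox oy] := immersed_ord immersed_branch.
have [->//|->//] := ord2P j.
Qed.

Lemma loc_xT : loc phi rs xT. Proof. exact: (loc_ord_loc phi_inj (ord_p jT)). Qed.

Lemma mmap_f_tangent j : mmap polyC f (tangent_coord P j) = p j.
Proof. by rewrite mmap_tangent_coord /tangent_form mul_polyC. Qed.

Lemma smooth_form_dvd : W ^+ k %| mmap polyC f (smooth_form P jT jY q D).
Proof.
have D2 : (2 <= D)%N by rewrite leq_maxl.
have sD : (size q <= D)%N by rewrite /D !leq_max leqnn !orbT.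
have kD : (k <= D)%N by rewrite /D !leq_max leqnn !orbT.
apply: (ord_dvdp phi_inj); rewrite mmap_smooth_form !mmap_f_tangent.
have fp := fc_phi_neq0.
have -> : phi (p jY * f c ^+ D.-1 - \sum_(i < D) (q`_i)%:P * (p jT ^+ i * f c ^+ (D - i))
     + p jT ^+ D) = phi (f c) ^+ D * (xY - peval phi q xT + xT ^+ D).
  have -> : peval phi q xT = \sum_(i < D) iota q`_i * xT ^+ i.
    rewrite /peval (horner_coef_wide (n := D)) ?size_map_poly //.
    by apply: eq_bigr => i _; rewrite coef_map.
  rewrite mulrDr mulrBr rmorphD rmorphB; congr (_ - _ + _).
  - by rewrite rmorphM rmorphXn -{2}(prednK (ltnW D2)) exprS; field.
  - rewrite mulr_sumr rmorph_sum; apply: eq_bigr => i _.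
    have -> : phi (f c) ^+ D = phi (f c) ^+ i * phi (f c) ^+ (D - i).
      by rewrite -exprD subnKC // ltnW.
    rewrite !rmorphM !rmorphXn /= expr_div_n.
    by field; rewrite expf_neq0.
  - by rewrite rmorphXn expr_div_n mulrC divfK // expf_neq0.
apply: (loc_ordMl phi_inj); first exact/(locX phi_inj)/loc_phi.
apply: (loc_ordD phi_inj) => //; apply: (loc_ord_le phi_inj kD).
by apply/(loc_ordX phi_inj)/ord_p.
Qed.

(** For [k > 1] the contact gives [xY = b xT] up to order 2. As [xT] and [xY] together generate the
    ideal of [W], [xT] alone does. *)
Lemma xT_uniformizer : (1 < k)%N -> exists2 u, loc_invertible phi rs u & xT = phi W * u.
Proof.
move=> k1; have [x1 [y1 [lx ly ex ey [s [t [z [ls lt hz est]]]]]]] := immersed_branch.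
have ex' : exists x1' y1' s' t' z', [/\ loc phi rs x1', loc phi rs y1', xT = phi W * x1',
    xY = phi W * y1' & [/\ loc phi rs s', loc phi rs t', rad phi rs z' &
    s' * x1' + t' * y1' = 1 + z']].
  have [j0|j0] := eqVneq jT 0.
    have j1 : jY = 1.
      by move: jTY; rewrite j0; case: jY => [[|[|[]]]] // hj _; apply/val_inj.
    by rewrite j0 j1; exists x1, y1, s, t, z; split.
  have j1 : jT = 1 by move: j0; case: jT => [[|[|[]]]] // hj _; apply/val_inj.
  have j2 : jY = 0.
    by move: jTY; rewrite j1; case: jY => [[|[|[]]]] // hj _; apply/val_inj.
  by rewrite j1 j2; exists y1, x1, t, s, z; split=> //; split=> //; rewrite addrC.
case: ex' => x1' [y1' [s' [t' [z' [lx' ly' exx eyy [ls' lt' hz' est']]]]]].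
exists x1' => //.
have [b [q2 [_ /(_ xT) eq]]] := peval_root0_linear phi q0; have oT := ord_p jT.
have h2 : ord 2 (xY - iota b * xT).
  have -> : xY - iota b * xT = (xY - peval phi q xT) + xT ^+ 2 * peval phi q2 xT.
    by rewrite eq; ring.
  apply: (loc_ordD phi_inj); first exact: (loc_ord_le phi_inj k1).
  apply: (loc_ordMr phi_inj); first exact: (loc_ordX phi_inj).
  by apply: (loc_peval phi_inj); apply: loc_xT.
apply: (immersed_invertible phi_inj (rs := rs) (c := b) isT lx' ly' ls' lt' hz' est').
apply: (ord1_rad phi_inj); apply/(loc_ord_cancel phi_inj rs 1 1).
by rewrite expr1 mulrBr -eyy mulrCA -exx.
Qed.

(** Coefficients vanish in increasing order of index: the rest of the sum shows that the term of
    index [m] has order [m + 1], whereas [xT ^+ m] is the [m]-th power of [W] times a unit. This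
    gives the uniqueness of coordinates in the length of the image. *)
Lemma xT_independent (v : 'I_k -> K) : ord k (\sum_(i < k) iota (v i) * xT ^+ i) ->
  forall i, v i = 0.
Proof.
move=> hv; suff key m : forall i : 'I_k, (i < m)%N -> v i = 0.
  by move=> i; apply: key (ltnSn i).
elim: m => [|m IH] i //; rewrite ltnS leq_eqVlt => /orP[/eqP em|]; last exact: IH.
have oi : ord m.+1 (iota (v i) * xT ^+ m).
  have -> : iota (v i) * xT ^+ m = \sum_(j < k) iota (v j) * xT ^+ j
      - \sum_(j < k | (j != i)) iota (v j) * xT ^+ j.
    by rewrite (bigD1 i) //= em addrK.
  apply: (loc_ordB phi_inj).
    by apply: (loc_ord_le phi_inj) hv; rewrite -em.
  apply: (loc_ord_sum phi_inj) => j ji.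
  have [jm|mj] := ltnP j m; first by rewrite IH // rmorph0 mul0r; apply: loc_ord_zero.
  apply: (loc_ordMl phi_inj); first exact: loc_iota.
  apply: (@loc_ord_le _ _ _ phi_inj _ m.+1 j); last by apply/(loc_ordX phi_inj)/ord_p.
  by rewrite ltn_neqAle mj andbT -em eq_sym; move: ji; rewrite -val_eqE.
apply: (rad_iota phi_inj (rs := rs)) => //; apply: (ord1_rad phi_inj).
case: m em oi {IH} => [|m] em oi; first by rewrite expr0 mulr1 in oi.
have k1 : (1 < k)%N by apply: leq_ltn_trans (ltn_ord i); rewrite em.
have [u [lu u0 lui] exT] := xT_uniformizer k1.
move: oi; rewrite exT exprMn mulrCA -addn1 => /(loc_ord_cancel phi_inj).
move/(loc_ordMr phi_inj) => /(_ _ (locX phi_inj m.+1 lui)).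
by rewrite exprVn mulfK // expf_neq0.
Qed.

Lemma graph_form_homog d i : (i <= d)%N ->
  tangent_coord P jT ^+ i * 'X_c ^+ (d - i) \is [in K[3], d.-homog].
Proof.
move=> id; have hT := tangent_coord_homog P jT; have hZ := Xc_homog P.
by have := dhomogM (homogX i hT) (homogX (d - i) hZ); rewrite subnKC.
Qed.

Lemma curvilinear_on_curve_of_graph : curvilinear_on_curve a J k.
Proof.
have D2 : (2 <= D)%N by rewrite leq_maxl.
have fp := fc_phi_neq0.
have hS := smooth_form_homog P jT jY q D2.
have JH : J (smooth_form P jT jY q D) := dvd_J hS smooth_form_dvd.
split; first exists P; first split=> //.
- move=> w w0; split=> [hw|Pw G JG]; last exact: J_vanish JG Pw.
  (* A tangent coordinate pulls back to a multiple of [W], so its [k]-th power lies in [J] and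
     vanishes on the support. *)
  have wj j : w 0 (lift c j) = P 0 (lift c j) / P 0 c * w 0 c.
    have JT : J (tangent_coord P j ^+ k).
      apply: (dvd_J (homogX k (tangent_coord_homog P j))).
      rewrite rmorphXn /= mmap_f_tangent; apply: dvdp_exp2r.
      have [->|->] := ord2P j.
        by rewrite ep0 dvdp_mulr.
      by rewrite ep1 dvdp_mulr.
    have := hw _ JT; rewrite /eval_at rmorphXn => /eqP; rewrite expf_eq0 => /andP[_].
    rewrite /= /meval mmap_tangent_coord subr_eq0 => /eqP -> //.
  have Pc := chart_neq0 P0.
  exists (w 0 c / P 0 c).
    rewrite mulf_neq0 ?invr_eq0 //; apply: contraNneq w0 => wc.
    apply/eqP/rowP => u; rewrite mxE; case: (unliftP c u) => [j|] -> //.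
    by rewrite wj wc mulr0.
  apply/rowP => u; rewrite mxE; case: (unliftP c u) => [j|] ->; last by field.
  by rewrite wj; field.
- exists D, (smooth_form P jT jY q D); split=> //.
  + exact: smooth_form_squarefree.
  + move=> G [N hN]; exists N => i; have [A ->] := hN i; exact: J_mul.
  + by exists (lift c jY); apply: smooth_form_deriv.
- exists k => d kd.
  exists (fun i : 'I_k => tangent_coord P jT ^+ i * 'X_c ^+ (d - i)).
    by move=> i; apply: graph_form_homog; apply: leq_trans kd; apply: ltnW.
  move=> G hG.
  have hG' (v : 'rV[K]_k) : (G - \sum_(i < k) v 0 i *: (tangent_coord P jT ^+ i * 'X_c ^+ (d - i)))
      \is d.-homog.
    apply: rpredB => //; apply: rpred_sum => i _; apply: rpredZ; apply: graph_form_homog.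
    by apply: leq_trans kd; apply: ltnW.
  have sat_iff (v : 'rV[K]_k) :
      saturation J (G - \sum_(i < k) v 0 i *: (tangent_coord P jT ^+ i * 'X_c ^+ (d - i)))
      <-> ord k (eval2 phi x y (germ_at G P) - \sum_(i < k) iota (v 0 i) * xT ^+ i).
    have -> : eval2 phi x y (germ_at G P) - \sum_(i < k) iota (v 0 i) * xT ^+ i
      = eval2 phi x y (germ_at (G - \sum_(i < k) v 0 i *:
                      (tangent_coord P jT ^+ i * 'X_c ^+ (d - i))) P).
      have [fc0 _] := fc_unit; apply: (mulfI (x := phi (f c) ^+ d)); first by rewrite expf_neq0.
      rewrite -(form_order phi_inj (P := P) fc0 (hG' v)) mulrBr.
      rewrite -(form_order phi_inj (P := P) fc0 hG) [mmap _ _ (G - _)]rmorphB /=.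
      rewrite [phi (mmap _ _ G - _)]rmorphB; congr (_ - _).
      rewrite mulr_sumr (rmorph_sum (mmap polyC f)) (rmorph_sum phi).
      apply: eq_bigr => i _ /=.
      rewrite mmapZ !rmorphM !rmorphXn /= mmap_f_tangent mmapX mmap1U ?rmorphXn.
      have id : (i <= d)%N by apply: leq_trans kd; apply: ltnW.
      have -> : phi (f c) ^+ d = phi (f c) ^+ i * phi (f c) ^+ (d - i).
        by rewrite -exprD subnKC.
      rewrite expr_div_n; field.
      by rewrite expf_neq0.
    rewrite -(dvd_iff_ord k (hG' v)); split; first exact: saturation_dvd.
    by move=> h; apply/J_saturation/(dvd_J (hG' v)).
  have [v hv] := span G; exists (\row_i v i); split.
    apply/sat_iff; rewrite (eq_bigr (fun i => iota (v i) * xT ^+ i)) // => i _.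
    by rewrite mxE.
  move=> v' /sat_iff hv'; apply/rowP => i; rewrite mxE; apply/eqP.
  rewrite -subr_eq0; apply/eqP; move: i; apply: xT_independent.
  have -> : \sum_(i < k) iota (v i - v' 0 i) * xT ^+ i =
     (eval2 phi x y (germ_at G P) - \sum_(i < k) iota (v' 0 i) * xT ^+ i)
     - (eval2 phi x y (germ_at G P) - \sum_(i < k) iota (v i) * xT ^+ i).
    have e (A B E : L) : A - B = E - B - (E - A) by ring.
    rewrite -e -sumrB; apply: eq_bigr => i _.
    by rewrite rmorphB mulrBl.
  exact: (loc_ordB phi_inj).
- move=> G [N hN]; exists N => i; exact: J_curve.
Qed.

End Graph.

Lemma curvilinear_on_curve_of_contact : contact phi rs k x y -> curvilinear_on_curve a J k.
Proof.
have [ox oy] := immersed_ord immersed_branch.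
move=> [q q0 [h|h]].
  apply: (@curvilinear_on_curve_of_graph 0 1 isT q q0 h) => G.
  exists (fun i => (mmap polyC (pair2 'X q) (germ_at G P))`_i).
  exact: (graph_span phi_inj ox oy).
apply: (@curvilinear_on_curve_of_graph 1 0 isT q q0 h) => G.
exists (fun i => (mmap polyC (pair2 'X q) (swap (germ_at G P)))`_i).
have := graph_span phi_inj oy ox (swap (germ_at G P)) q0 h.
by rewrite eval2_swap.
Qed.

Lemma curvilinear_on_curve_contact : curvilinear_on_curve a J k <-> contact phi rs k x y.
Proof.
split; first by case=> h _ _; apply: contact_of_curvilinear.
exact: curvilinear_on_curve_of_contact.
Qed.

End ImageContact.

(** * Fat points of the rational normal curve *)

Section IdealPowers.
Variables (K : closedFieldType) (N : nat).
Implicit Types (I : {mpoly K[N]} -> Prop) (A B G : {mpoly K[N]}).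

Lemma ideal_pow0 I G : ideal_pow I 0 G.
Proof.
exists 1%N, (fun=> G), (fun _ _ => 0); split; first by move=> _ [].
by rewrite big_ord1 big_ord0 mulr1.
Qed.

Lemma ideal_pow_zero I s : ideal_pow I s 0.
Proof. by exists 0%N, (fun=> 0), (fun _ _ => 0); split; [case|rewrite big_ord0]. Qed.

Lemma ideal_powM I s A G : ideal_pow I s G -> ideal_pow I s (A * G).
Proof.
move=> [k [c [g [hg ->]]]]; exists k, (fun i => A * c i), g; split=> //.
by rewrite mulr_sumr; apply: eq_bigr => i _; rewrite mulrA.
Qed.

Lemma ideal_powD I s A B : ideal_pow I s A -> ideal_pow I s B -> ideal_pow I s (A + B).
Proof.
move=> [k [c [g [hg ->]]]] [l [d [h [hh ->]]]].
exists (k + l)%N, (fun i => match split i with inl i => c i | inr i => d i end),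
  (fun i => match split i with inl i => g i | inr i => h i end); split.
  by move=> i j; case: (split i) => i'.
rewrite big_split_ord /=; congr (_ + _); apply: eq_bigr => i _.
  by have -> : split (lshift l i) = inl i := unsplitK (inl i).
by have -> : split (rshift k i) = inr i := unsplitK (inr i).
Qed.

Lemma ideal_powS I s A B : I A -> ideal_pow I s B -> ideal_pow I s.+1 (A * B).
Proof.
move=> hA [k [c [g [hg ->]]]].
exists k, c, (fun i j => if unlift ord0 j is Some j' then g i j' else A); split.
  by move=> i j; case: unliftP.
rewrite mulr_sumr; apply: eq_bigr => i _; rewrite big_ord_recl unlift_none mulrCA.
by congr (_ * (_ * _)); apply: eq_bigr => j _; rewrite liftK.
Qed.

Lemma fat_pointM s v (D : 'rV[K]_N -> Prop) A G : fat_point s v D G -> fat_point s v D (A * G).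
Proof.
move=> [k hk]; exists k => i; have [U [V [hU hV e]]] := hk i.
exists (A * U), (A * V); split; last by rewrite -mulrDr -e mulrCA.
  by move=> w w0 Dw; rewrite /eval_at mevalM [X in _ * X](hU w w0 Dw) mulr0.
exact: ideal_powM.
Qed.

Lemma fat_point_of_vanishing s v (D : 'rV[K]_N -> Prop) G :
  vanishing_ideal D G -> fat_point s v D G.
Proof.
move=> h; exists 0%N => i; rewrite expr0 mul1r; exists G, 0; split=> //.
  exact: ideal_pow_zero.
by rewrite addr0.
Qed.

End IdealPowers.

Section FatPoints.
Variables (K : closedFieldType) (n : nat).
Hypothesis n_gt0 : (0 < n)%N.
Variables q0 q1 : 'rV[K]_2.
Hypothesis q01 : q0 0 0 * q1 0 1 - q0 0 1 * q1 0 0 != 0.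
Local Notation nuq := (@nu K n q0 q1).
Local Notation aff := (aff q0 q1).
Local Notation affp := (affp q0 q1).
Local Notation rnc := (@on_rnc K n).
Local Notation pb := (mmap (@polyC K) nuq).
Implicit Types (M G : {mpoly K[n.+1]}).

Lemma veronese_neq0 (q : 'rV[K]_2) : q != 0 -> veronese n q != 0.
Proof.
apply: contraNneq => /rowP h; apply/eqP/row2P; rewrite [RHS]mxE.
  have := h ord0; rewrite !mxE subn0 expr0 mulr1 => /eqP.
  by rewrite expf_eq0 n_gt0 => /eqP.
have := h ord_max; rewrite !mxE subnn expr0 mul1r => /eqP.
by rewrite expf_eq0 n_gt0 => /eqP.
Qed.

Lemma pullback_eval M t : (pb M).[t] = eval_at M (veronese n (aff t)).
Proof. by apply: (eval_at_mmap (w := fun t => veronese n (aff t))) => i; apply: horner_nu. Qed.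

Lemma pullback_vanishing M : vanishing_ideal rnc M -> pb M = 0.
Proof.
move=> h; apply: poly_eval0 => t; rewrite pullback_eval; apply: h.
  exact/veronese_neq0/aff_neq0.
by exists (aff t); [apply: aff_neq0|apply: proj_eq_refl].
Qed.

Lemma vanishing_of_pullback d M : M \is d.-homog -> pb M = 0 -> vanishing_ideal rnc M.
Proof.
move=> hM e v _ [q qn0 [c c0 ->]]; rewrite (eval_at_homog _ _ hM).
rewrite (form_vanishes_at_infinity q01 (V := veronese n) (vp := nu q1 q0) hM) ?mulr0 //.
- by move=> b r; exists (b ^+ n); [apply: veroneseZ|move=> b0; rewrite expf_neq0].
- by move=> s i; rewrite horner_nu.
by move=> t; rewrite -pullback_eval e horner0.
Qed.

Lemma nu_neq0_at tau : exists i, (nuq i).[tau] != 0.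
Proof.
apply: contrapT => h; have /eqP := veronese_neq0 (aff_neq0 q01 tau); apply.
apply/rowP => i; rewrite [RHS]mxE -horner_nu; apply/eqP/negP => /negP hu.
by apply: h; exists i.
Qed.

Section OnePoint.
Variables (Q : 'rV[K]_n.+1) (tau : K).
Hypothesis Qtau : proj_eq (veronese n (aff tau)) Q.
Local Notation ell := ('X - tau%:P).

Lemma saturation_pullback_dvd (I : {mpoly K[n.+1]} -> Prop) s :
  (forall M, I M -> ell ^+ s %| pb M) -> forall M, saturation I M -> ell ^+ s %| pb M.
Proof.
move=> hI M [k hk]; have [i hi] := nu_neq0_at tau.
have := hI _ (hk i); rewrite rmorphM rmorphXn /= mmapX mmap1U mulrC.
rewrite Gauss_dvdpl //; apply/coprimep_expl/coprimep_expr.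
by rewrite coprimep_sym coprimep_XsubC.
Qed.

Lemma saturation_vanish (I : {mpoly K[n.+1]} -> Prop) :
  (forall M w, I M -> proj_eq Q w -> eval_at M w = 0) ->
  forall M w, saturation I M -> proj_eq Q w -> eval_at M w = 0.
Proof.
move=> hI M w [k hk] Qw; have [i hi] := nu_neq0_at tau.
have wi : w 0 i != 0.
  have [c c0 ->] := proj_eq_trans Qtau Qw.
  by rewrite mxE -horner_nu mulf_neq0.
have /eqP := hI _ _ (hk i) Qw; rewrite /eval_at mevalM rmorphXn /= mevalXU.
by rewrite mulf_eq0 expf_eq0 (negPf wi) andbF /= => /eqP.
Qed.

Lemma fat_point_dvd s M : fat_point s Q rnc M -> ell ^+ s %| pb M.
Proof.
apply: saturation_pullback_dvd => {}M [A [B [hA [k [c [g [hg ->]]]] ->]]].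
rewrite rmorphD /= (pullback_vanishing hA) add0r (rmorph_sum pb).
apply: (big_rec (fun z => ell ^+ s %| z)) => [|i z _ hz]; first exact: dvdp0.
apply: dvdp_add hz; rewrite rmorphM dvdp_mull // (rmorph_prod pb).
have -> : ell ^+ s = \prod_(j < s) ell by rewrite prodr_const card_ord.
apply: (big_ind2 (fun z1 z2 => z1 %| z2)) => [|z1 z2 z3 z4|j _]; first exact: dvd1p.
  exact: dvdp_mul.
rewrite dvdp_XsubCl /root pullback_eval; apply/eqP; apply: hg.
  exact/veronese_neq0/aff_neq0.
exact: proj_eq_sym.
Qed.

Lemma fat_point_vanish s M w : (0 < s)%N -> fat_point s Q rnc M -> proj_eq Q w ->
  eval_at M w = 0.
Proof.
move=> s0; apply: saturation_vanish => {}M {}w [A [B [hA [k [c [g [hg ->]]]] ->]]] Qw.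
have vw := proj_eq_trans Qtau Qw.
have w0 : w != 0.
  by have [b b0 ->] := vw; rewrite scaler_eq0 negb_or b0 /= veronese_neq0 // aff_neq0.
rewrite /eval_at mevalD [A.@[_]](hA w w0 _); last by exists (aff tau); rewrite ?aff_neq0.
rewrite add0r rmorph_sum big1 // => i _; rewrite rmorphM rmorph_prod /=.
by rewrite (bigD1 (Ordinal s0)) //= [X in _ * (X * _)](hg _ _ w w0 Qw) mul0r mulr0.
Qed.

Lemma pullback_size d M : M \is d.-homog -> (size (pb M) <= (n * d).+1)%N.
Proof.
move=> /dhomogP hM; apply: leq_trans (size_sum _ _ _) _; apply/bigmax_leqP_seq => m hm _.
apply: leq_trans (_ : size (mmap1 nuq m) <= _)%N.
  by rewrite mul_polyC size_scale_leq.
have -> : d = (\sum_(i < n.+1) m i)%N by rewrite -mdegE; apply/esym/(hM _ hm).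
rewrite /mmap1 big_distrr /=.
apply: (big_ind2 (fun (p : {poly K}) k => (size p <= k.+1)%N)) => [|p k q l hp hq|i _].
- by rewrite size_poly1.
- by apply: leq_trans (size_polyMleq _ _) _; lia.
elim: (m i) => [|l IH]; first by rewrite expr0 size_poly1.
rewrite exprS; apply: leq_trans (size_polyMleq _ _) _.
by have := size_nu q0 q1 i; move: IH; lia.
Qed.

Definition pullback_of_form d (p : {poly K}) : Prop :=
  exists2 M, M \is d.-homog & pb M = p.

Lemma pullback_of_formD d p r : pullback_of_form d p -> pullback_of_form d r ->
  pullback_of_form d (p + r).
Proof.
by move=> [M hM <-] [G hG <-]; exists (M + G); rewrite ?rmorphD // rpredD.
Qed.

Lemma pullback_of_formZ d c p : pullback_of_form d p -> pullback_of_form d (c *: p).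
Proof. by move=> [M hM <-]; exists (c *: M); rewrite ?rpredZ // mmapZ mul_polyC. Qed.

(** A coordinate of index [j'] pulls back to [affp 0 ^+ (n - j') * affp 1 ^+ j']. Splitting off the
    one with [j'] the minimum of [j] and [n] leaves nonnegative exponents for degree one less. *)
Lemma pullback_of_binary_monomial d i j : (i + j = n * d)%N ->
  pullback_of_form d (affp 0 ^+ i * affp 1 ^+ j).
Proof.
elim: d i j => [|d IH] i j.
  move/eqP; rewrite muln0 addn_eq0 => /andP[/eqP-> /eqP->].
  by exists 1; rewrite ?rmorph1 ?mulr1 // dhomog1.
rewrite mulnS => ij; pose j' := minn j n.
have [j'n [ij' jj']] : (j' < n.+1)%N /\ (n - j' <= i)%N /\ (j' <= j)%N.
  by rewrite /j'; lia.
have [|M hM eM] := IH (i - (n - j'))%N (j - j')%N; first lia.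
exists (M * 'X_(Ordinal j'n)).
  have hX : 'X_(Ordinal j'n) \is [in K[n.+1], 1.-homog] by rewrite dhomogX; apply/eqP/mdeg1.
  by have := dhomogM hM hX; rewrite addn1.
rewrite rmorphM /= eM mmapX mmap1U /nu /=.
rewrite -{2}(subnK ij') -{2}(subnK jj') !exprD; ring.
Qed.

(** This is the projective normality of the rational normal curve: [affp 0] and [affp 1] span the
    polynomials of degree at most 1, so their products with [n * d] factors span those of degree at
    most [n * d]. *)
Lemma pullback_of_formP d (p : {poly K}) : (size p <= (n * d).+1)%N -> pullback_of_form d p.
Proof.
pose dd := q0 0 0 * q1 0 1 - q0 0 1 * q1 0 0.
have e1 : 1 = (q1 0 1 / dd) *: affp 0 - (q1 0 0 / dd) *: affp 1 :> {poly K}.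
  apply/polyP => i; rewrite /affp !(coefD, coefN, coefZ, coefC, coefX, coef1).
  by case: i => [|[|i]] /=; rewrite /dd; field.
have eX : 'X = - (q0 0 1 / dd) *: affp 0 + (q0 0 0 / dd) *: affp 1 :> {poly K}.
  apply/polyP => i; rewrite /affp !(coefD, coefN, coefZ, coefC, coefX, coef1).
  by case: i => [|[|i]] /=; rewrite /dd; field.
(* [m] counts the linear factors not yet chosen. Writing 1 or ['X] as a combination of [affp 0] and
   [affp 1] chooses one more. *)
have key m : forall i j b, (i + j + m = n * d)%N -> (b <= m)%N ->
    pullback_of_form d (affp 0 ^+ i * affp 1 ^+ j * 'X^b).
  elim: m => [|m IH] i j b.
    rewrite addn0 leqn0 => h /eqP ->; rewrite expr0 mulr1.
    exact: pullback_of_binary_monomial.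
  have step (u v : K) b' : (i + j + m.+1 = n * d)%N -> (b' <= m)%N ->
      pullback_of_form d (affp 0 ^+ i * affp 1 ^+ j * 'X^b' * (u *: affp 0 + v *: affp 1)).
    move=> h hb'.
    have -> : affp 0 ^+ i * affp 1 ^+ j * 'X^b' * (u *: affp 0 + v *: affp 1) =
      u *: (affp 0 ^+ i.+1 * affp 1 ^+ j * 'X^b') + v *: (affp 0 ^+ i * affp 1 ^+ j.+1 * 'X^b').
      by rewrite !exprS -!mul_polyC; ring.
    by apply: pullback_of_formD; apply: pullback_of_formZ; apply: IH => //; lia.
  case: b => [|b] h hb.
    by have := step (q1 0 1 / dd) (- (q1 0 0 / dd)) 0%N h isT; rewrite scaleNr -e1 mulr1.
  by have := step (- (q0 0 1 / dd)) (q0 0 0 / dd) b h hb; rewrite -eX -mulrA -exprSr.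
move=> hp; rewrite -[p]coefK poly_def.
have hp' (i : 'I_(size p)) : (i <= n * d)%N by rewrite -ltnS (leq_trans _ hp).
elim/big_ind: _ => [|u v|i _].
- by exists 0; rewrite ?rmorph0 // rpred0.
- exact: pullback_of_formD.
apply: pullback_of_formZ; have := key (n * d)%N 0%N 0%N i erefl (hp' i).
by rewrite !expr0 !mul1r.
Qed.

Lemma pullback_of_point_ideal (u : {poly K}) : (size u <= n)%N ->
  exists2 G, G \is 1.-homog & point_ideal Q G /\ pb G = ell * u.
Proof.
move=> hu; have [|G hG eG] := @pullback_of_formP 1%N (ell * u).
  apply: leq_trans (size_polyMleq _ _) _; rewrite size_XsubC muln1; lia.
exists G => //; split=> // w w0 Qw; have [c c0 ->] := proj_eq_trans Qtau Qw.
rewrite (eval_at_homog _ _ hG) -pullback_eval eG hornerM hornerXsubC subrr.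
by rewrite mul0r mulr0.
Qed.

(* Induction on [s], splitting [r] as [u1 + 'X^(n - 1) * u2]: each of [ell * u1] and
   [ell * 'X^(n - 1)] is the pull-back of a linear form through [Q]. *)
Lemma pullback_of_ideal_pow s d (r : {poly K}) : (s <= d)%N ->
  (size (ell ^+ s * r)%R <= (n * d).+1)%N ->
  exists2 B, B \is d.-homog & ideal_pow (point_ideal Q) s B /\ pb B = ell ^+ s * r.
Proof.
have szX (u : {poly K}) k : u != 0 -> size (ell ^+ k * u) = (k + size u)%N.
  by move=> u0; rewrite size_monicM ?monic_exp ?monicXsubC // size_exp_XsubC.
elim: s d r => [|s IH] d r sd.
  rewrite expr0 mul1r => /pullback_of_formP[B hB eB]; exists B => //.
  by split=> //; apply: ideal_pow0.
case: d sd => [//|d]; rewrite ltnS => sd hr.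
pose u1 := take_poly n.-1 r; pose u2 := drop_poly n.-1 r.
have [|G1 hG1 [IG1 eG1]] := @pullback_of_point_ideal u1.
  by apply: leq_trans (size_take_poly _ _) (leq_pred _).
have [|G2 hG2 [IG2 eG2]] := @pullback_of_point_ideal 'X^(n.-1).
  by rewrite size_polyXn prednK.
have [|B1 hB1 [IB1 eB1]] := IH d 1 sd.
  rewrite mulr1 size_exp_XsubC ltnS; apply: leq_trans sd _.
  by rewrite leq_pmull.
have [|B2 hB2 [IB2 eB2]] := IH d u2 sd.
  have [->|u20] := eqVneq u2 0; first by rewrite mulr0 size_poly0.
  have r0 : r != 0 by apply: contraNneq u20 => r0; rewrite /u2 r0 drop_poly0r.
  move: hr; rewrite !szX // size_drop_poly mulnS.
  have : (0 < size u2)%N by rewrite size_poly_gt0.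
  rewrite size_drop_poly; move: (size r) (n * d)%N => x y; move: n_gt0; clear; lia.
exists (G1 * B1 + G2 * B2).
  by apply: rpredD; rewrite -[d.+1]add1n; apply: dhomogM.
split; first by apply: ideal_powD; apply: ideal_powS.
rewrite rmorphD !rmorphM /= eG1 eB1 eG2 eB2.
by rewrite -[r in RHS](poly_take_drop n.-1) exprS -/u1 -/u2; ring.
Qed.

(** Multiplication by ['X_i ^+ s], which saturation absorbs, raises the degree to at least [s], as
    [pullback_of_ideal_pow] requires. The form found there has the same pull-back, so the difference
    vanishes on the curve. *)
Lemma fat_point_of_dvd s d M : M \is d.-homog -> ell ^+ s %| pb M -> fat_point s Q rnc M.
Proof.
move=> hM hdvd; exists s => i.
have hXM : 'X_i ^+ s * M \is (s + d).-homog.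
  apply: dhomogM => //.
  have hX : 'X_i \is [in K[n.+1], 1.-homog] by rewrite dhomogX; apply/eqP/mdeg1.
  by have := homogX s hX.
have /dvdpP[r er] : ell ^+ s %| pb ('X_i ^+ s * M).
  by rewrite rmorphM dvdp_mull.
have [||B hB [IB eB]] := @pullback_of_ideal_pow s (s + d)%N r; first exact: leq_addr.
  by rewrite mulrC -er pullback_size.
exists ('X_i ^+ s * M - B), B; split=> //; last by rewrite subrK.
apply: (@vanishing_of_pullback (s + d)); first exact: rpredB.
by rewrite rmorphB /= eB er mulrC subrr.
Qed.

End OnePoint.
End FatPoints.

(** * The main equivalence *)

Section RootCount.
Variables (K : closedFieldType) (L : fieldType).
Variable phi : {rmorphism {poly K} -> L}.
Hypothesis phi_inj : injective phi.
Variables (n : nat) (F : {mpoly K[3]}) (f : 'I_3 -> {poly K}) (P : 'rV[K]_3).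
Hypothesis n_gt0 : (0 < n)%N.
Hypothesis F_homog : F \is n.-homog.
Hypothesis F_neq0 : F != 0.
Hypothesis size_f : forall u, (size (f u) <= n.+1)%N.
Hypothesis F_generates : forall d (G : {mpoly K[3]}), G \is d.-homog ->
  mmap polyC f G = 0 -> exists A, G = A * F.
Variables (rs : seq K) (r0 r1 : {poly K}).
Local Notation W := (root_poly rs).
Local Notation c := (chart P).
Local Notation p := (tangent_form P f).
Hypothesis ep0 : p 0 = W * r0.
Hypothesis ep1 : p 1 = W * r1.
Hypothesis fc_unit : loc_unit rs (f c).
Local Notation x := (phi (p 0) / phi (f c)).
Local Notation y := (phi (p 1) / phi (f c)).
Local Notation ord := (loc_ord phi rs).
Local Notation iota := (iota phi).

Lemma ord1_multiple (q r : {poly K}) : q = W * r -> ord 1 (phi q / phi (f c)).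
Proof.
move=> ->; exists (phi r / phi (f c)); first by exists r, (f c).
by rewrite rmorphM mulrA expr1.
Qed.

Let ox : ord 1 x := ord1_multiple ep0.
Let oy : ord 1 y := ord1_multiple ep1.

Lemma codim_of_span k r (b : 'I_r -> L) :
  (forall h, exists v : 'I_r -> K, ord k (eval2 phi x y h - \sum_i iota (v i) * b i)) ->
  (size rs * k <= r + n * n + 1)%N.
Proof.
move=> hb; apply: (codim_bound n_gt0 F_homog F_neq0 size_f F_generates (W := W)).
  by rewrite /root_poly size_prod_XsubC.
apply: (@codim_hyp_of_span _ _ phi phi_inj rs P f _ k r b); first by case: fc_unit.
move=> h; have [v hv] := hb h; exists (\row_i v i).
by rewrite (eq_bigr (fun i => iota (v i) * b i)) // => i _; rewrite mxE.
Qed.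

(** Under contact of order [k] the [k] powers of one coordinate span all forms modulo [W ^+ k], and
    the dimension count reads [2 * k <= k + n * n + 1]. *)
Lemma not_contact (k : nat) : size rs = 2%N -> (n * n + 1 < k)%N -> ~ contact phi rs k x y.
Proof.
move=> rs2 kn [q q0 h].
suff : (2 * k <= k + n * n + 1)%N by rewrite mul2n -addnn -addnA leq_add2l leqNgt kn.
rewrite -rs2; case: h => h.
  apply: (codim_of_span (b := fun i : 'I_k => x ^+ i)) => g.
  by exists (fun i => (mmap polyC (pair2 'X q) g)`_i); apply: (graph_span phi_inj ox oy).
apply: (codim_of_span (b := fun i : 'I_k => y ^+ i)) => g.
exists (fun i => (mmap polyC (pair2 'X q) (swap g))`_i).
by rewrite -eval2_swap; apply: (graph_span phi_inj oy ox).
Qed.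

Definition shear (mu : K) (h : {mpoly K[2]}) : {mpoly K[2]} :=
  h \mPo [tuple 'X_0 + mu%:MP * 'X_1; 'X_1].

Lemma eval2_shear mu h : eval2 phi (x - iota mu * y) y (shear mu h) = eval2 phi x y h.
Proof.
rewrite /eval2 mmap_comp; apply: mmap_ext; case=> [[|[|[]]]] //= hi.
  by rewrite (tnth_nth 0) /= rmorphD rmorphM /= mmapC !mmapX !mmap1U /pair2 /= subrK.
by rewrite (tnth_nth 0) /= mmapX mmap1U.
Qed.

Lemma shear_at0 mu h : (shear mu h)@_(mon2 0 0) = h@_(mon2 0 0).
Proof.
rewrite -[LHS]/(idfun _) -[RHS]/(idfun _) -!(eval2_at0 idfun) mmap_comp; apply: mmap_ext.
case=> [[|[|[]]]] //= hi; rewrite (tnth_nth 0) /=.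
  by rewrite rmorphD rmorphM /= mmapC !mmapX !mmap1U /= mulr0 addr0.
by rewrite mmapX mmap1U.
Qed.

Lemma nonroot_direction (A B D : K) : [\/ A != 0, B != 0 | D != 0] ->
  exists mu, mu ^+ 2 * A + mu * B + D != 0.
Proof.
move=> h; have q0 : A *: 'X^2 + B *: 'X + D%:P != 0 :> {poly K}.
  have cE i : (A *: 'X^2 + B *: 'X + D%:P)`_i =
      if i is 0%N then D else if i is 1%N then B else if i is 2%N then A else 0.
    rewrite !coefD !coefZ coefXn coefX coefC.
    by case: i => [|[|[|i]]] /=; rewrite ?(mulr0, mulr1, addr0, add0r).
  apply/negP => /eqP/polyP e; have := (e 0%N, e 1%N, e 2%N).
  rewrite !coef0 !cE => -[[eD eB] eA].
  by case: h; rewrite ?eD ?eB ?eA eqxx.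
have [mu hmu] := closed_nonrootP _ q0; exists mu; move: hmu.
by rewrite /root !(hornerD, hornerZ, hornerXn, hornerX, hornerC) mulrC [B * _]mulrC.
Qed.

(* The shear by a non-root [mu] of the tangent cone makes the coefficient of
   [y ^+ 2] nonzero, as [mult2_span] requires. *)
Lemma size_roots_le2 : double_point F P -> eval2 phi x y (germ_at F P) = 0 ->
  (size rs <= 2)%N.
Proof.
move=> /has_mult2P[A [B [D [eg hABD]]]] g0.
have [mu hmu] := nonroot_direction hABD.
pose x' := x - iota mu * y.
have ox' : ord 1 x'.
  by apply: (loc_ordB phi_inj) => //; apply: (loc_ordMl phi_inj) => //; apply: loc_iota.
have eg' : shear mu (germ_at F P) = 'X_0 ^+ 2 * shear mu A
    + 'X_0 * 'X_1 * ((mu *+ 2)%:MP * shear mu A + shear mu B)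
    + 'X_1 ^+ 2 * (mu ^+ 2 *: shear mu A + mu *: shear mu B + shear mu D).
  have eX0 : shear mu 'X_0 = 'X_0 + mu%:MP * 'X_1 by apply: comp_mpolyXU.
  have eX1 : shear mu 'X_1 = 'X_1 by apply: comp_mpolyXU.
  have sM g h : shear mu (g * h) = shear mu g * shear mu h by apply: rmorphM.
  have sD g h : shear mu (g + h) = shear mu g + shear mu h by apply: rmorphD.
  rewrite eg !sD !expr2 !sM eX0 eX1 -!mul_mpolyC mpolyCM mpolyCMn; ring.
(* Three or more roots would give [3 * k <= 2 * k + n * n + 1], which fails from this value on. *)
pose k := (n * n + 2)%N.
have : (size rs * k <= (k + k) + n * n + 1)%N.
  apply: (codim_of_span (b := fun i : 'I_(k + k) =>
    match split i with inl j => x' ^+ j | inr j => x' ^+ j * y end)) => h.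
  have [|v1 [v2 hv]] := mult2_span phi_inj ox' oy k (shear mu h) eg' _
    (etrans (eval2_shear mu _) g0).
    by rewrite !mcoeffD !mcoeffZ !shear_at0.
  exists (fun i => match split i with inl j => v1 j | inr j => v2 j end).
  rewrite -(eval2_shear mu h) big_split_ord /=; move: hv.
  congr (ord k (_ - (_ + _))); apply: eq_bigr => i _.
    by have -> : split (lshift k i) = inl i := unsplitK (inl i).
  by have -> : split (rshift k i) = inr i := unsplitK (inr i).
apply: contraLR; rewrite -!ltnNge => h3.
apply: leq_trans (leq_mul h3 (leqnn k)); rewrite /k; move: (n * n)%N; clear; lia.
Qed.

End RootCount.

(** * Application to the curve and its fibre over [P] *)

Section Setup.
Variables (K : closedFieldType) (L : fieldType).
Variable phi : {rmorphism {poly K} -> L}.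
Hypothesis phi_inj : injective phi.
Hypothesis charK : [pchar K] =i pred0.
Variables (n : nat) (a : 'M[K]_(3, n.+1)) (F : {mpoly K[3]}) (P : 'rV[K]_3).
Hypothesis hn : (3 <= n)%N.
Hypothesis ha : proper_param a.
Hypothesis hF : curve_equation a F.
Hypothesis P0 : P != 0.
Hypothesis P2 : double_point F P.
Local Notation c := (chart P).

Lemma n_gt0 : (0 < n)%N. Proof. exact: leq_trans hn. Qed.

Lemma equation_neq0 : F != 0.
Proof.
apply/eqP => F0; have [_ [m]] := P2.
by rewrite /germ_at F0 comp_mpoly0 msupp0.
Qed.

Lemma low_degree_form d (G : {mpoly K[3]}) : G \is d.-homog -> (d < n)%N ->
  vanishing_ideal (on_curve a) G -> G = 0.
Proof.
move=> hG dn /hF.2[A eA]; apply/eqP; move: dn; apply: contraTT => G0.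
rewrite -leqNgt; apply: (homog_multiple_degree hF.1 (A := A)); by rewrite -eA.
Qed.

(** Otherwise the whole curve would be the point [P] and satisfy a linear equation, although its
    ideal is generated in degree [n > 1]. *)
Lemma exists_infinity : exists2 q1, q1 != 0 & ~ proj_eq P (param a q1).
Proof.
apply: contrapT => h; have Pc := chart_neq0 P0.
have : tangent_coord P 0 = 0.
  apply: (low_degree_form (tangent_coord_homog P 0)); first exact: leq_trans hn.
  move=> v v0 [q qn0 pq]; have [b b0 ->] : proj_eq P v.
    apply: proj_eq_trans pq; apply: contrapT => Pq; apply: h; exists q => //.
  by rewrite /eval_at /meval mmap_tangent_coord /= !mxE; field.
move/(congr1 (mcoeff U_(lift c 0%R))); rewrite mcoeff0 mcoeffB mcoeffZ !mcoeffX.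
rewrite eqxx (_ : (U_(c) == U_(lift c 0%R))%MM = false) ?mulr0 ?subr0; last first.
  apply/negbTE/eqP => /mnmP/(_ c); rewrite !mnm1E eqxx eq_sym.
  by rewrite (negPf (neq_lift _ _)).
by move/eqP; rewrite oner_eq0.
Qed.

Lemma exists_complement (q1 : 'rV[K]_2) : q1 != 0 ->
  exists q0 : 'rV[K]_2, q0 0 0 * q1 0 1 - q0 0 1 * q1 0 0 != 0.
Proof.
move=> h; have [z|nz] := eqVneq (q1 0 1) 0; last first.
  exists (\row_i (i == 0)%:R); rewrite !mxE /= mul1r mul0r subr0 //.
exists (\row_i (i == 1)%:R); rewrite !mxE /= mul0r mul1r sub0r oppr_eq0.
by apply: contraNneq h => z'; apply/eqP/row2P; rewrite ?z ?z' mxE.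
Qed.

Section Affine.
Variables q0 q1 : 'rV[K]_2.
Hypothesis q01 : q0 0 0 * q1 0 1 - q0 0 1 * q1 0 0 != 0.
Hypothesis infinity : ~ proj_eq P (param a q1).
Local Notation f := (paramp a q0 q1).
Local Notation aff := (aff q0 q1).
Local Notation p := (tangent_form P f).
Local Notation x := (phi (p 0) / phi (f c)).
Local Notation y := (phi (p 1) / phi (f c)).
Local Notation pb := (mmap (@polyC K) (@nu K n q0 q1)).

Lemma vanishing_of_param d (G : {mpoly K[3]}) : G \is d.-homog -> mmap polyC f G = 0 ->
  vanishing_ideal (on_curve a) G.
Proof.
move=> hG e v _ [q qn0 [b b0 ->]]; rewrite (eval_at_homog _ _ hG).
rewrite (form_vanishes_at_infinity q01 (V := param a) (vp := paramp a q1 q0) hG) ?mulr0 //.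
- by move=> k r; exists (k ^+ n); [apply: paramZ|move=> k0; rewrite expf_neq0].
- by move=> s i; rewrite horner_paramp.
move=> t; rewrite -(eval_at_mmap (v := f) (w := fun t => param a (aff t))) ?e ?horner0 //.
by move=> i; apply: horner_paramp.
Qed.

Lemma equation_generates d (G : {mpoly K[3]}) : G \is d.-homog -> mmap polyC f G = 0 ->
  exists A, G = A * F.
Proof. by move=> hG e; apply/hF.2/(vanishing_of_param hG e). Qed.

Lemma equation_vanishes : mmap polyC f F = 0.
Proof.
apply: poly_eval0 => t.
rewrite (eval_at_mmap (w := fun t => param a (aff t))) => [|i]; last exact: horner_paramp.
have pn0 : param a (aff t) != 0 by apply/ha.1/aff_neq0.
have /hF.2 h : principal_ideal F F by exists 1; rewrite mul1r.
by apply: h => //; exists (aff t); [apply: aff_neq0|apply: proj_eq_refl].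
Qed.

Lemma param_independent (v : 'I_3 -> K) : (exists u, v u != 0) -> \sum_u v u *: f u != 0.
Proof.
move=> [u vu]; apply: contra_neq vu => e.
pose G : {mpoly K[3]} := \sum_u v u *: 'X_u.
have hG : G \is 1.-homog.
  by apply: rpred_sum => i _; apply: rpredZ; rewrite dhomogX; apply/eqP/mdeg1.
have : G = 0.
  apply: (low_degree_form hG); first exact: leq_trans hn.
  apply: (vanishing_of_param hG); rewrite -e (rmorph_sum (mmap polyC f)).
  by apply: eq_bigr => i _; rewrite /= mmapZ mmapX mmap1U mul_polyC.
move/(congr1 (mcoeff U_(u))); rewrite mcoeff0 (raddf_sum (mcoeff _)) (bigD1 u) //=.
rewrite mcoeffZ mcoeffX eqxx mulr1 big1 ?addr0 // => i iu.
rewrite mcoeffZ mcoeffX (_ : (U_(i) == U_(u))%MM = false) ?mulr0 //.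
by apply/negbTE/eqP => /mnmP/(_ i); rewrite !mnm1E eqxx eq_sym (negPf iu).
Qed.

(** At a root both tangent forms vanish, so the parametrized point is [P] up to a factor, and the
    coordinate of [P] of index [c] is nonzero by the choice of the chart. *)
Lemma chart_unit (rs : seq K) r0 r1 : p 0 = root_poly rs * r0 -> p 1 = root_poly rs * r1 ->
  loc_unit rs (f c).
Proof.
move=> ep0 ep1; split; first exact: (fc_neq0 P param_independent).
move=> t ht; have hf := f_neq0_at q01 ha.1 t.
have [|b b0 /rowP/(_ c)] := iffLR (tangent_root P0 (f := f) (or_intror hf)) _.
  case=> [[|[|[]]]] //= hj.
    have -> : Ordinal hj = 0 by apply/val_inj.
    by rewrite ep0 hornerM root_poly_root ?mul0r.
  have -> : Ordinal hj = 1 by apply/val_inj.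
  by rewrite ep1 hornerM root_poly_root ?mul0r.
by rewrite !mxE => ->; rewrite mulf_neq0 // chart_neq0.
Qed.

Lemma germ_vanishes : eval2 phi x y (germ_at F P) = 0.
Proof.
have fc0 := fc_neq0 P param_independent.
have := form_order phi_inj (P := P) fc0 hF.1; rewrite equation_vanishes rmorph0.
by move/esym/eqP; rewrite mulf_eq0 expf_eq0 (phi_eq0 phi_inj) (negPf fc0) andbF => /eqP.
Qed.

Lemma two_roots : exists tau1 tau2 r0 r1,
  [/\ p 0 = root_poly [:: tau1; tau2] * r0, p 1 = root_poly [:: tau1; tau2] * r1
    & coprimep r0 r1].
Proof.
have p00 : p 0 != 0.
  have := line_neq0 P param_independent (or_introl (oner_neq0 K) : _ \/ (0 : K) != 0).
  by rewrite scale1r scale0r addr0.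
have [rs [r0 [r1 [ep0 ep1 cop]]]] := roots_of_gcd (p 1) p00.
have fcu := chart_unit ep0 ep1; have [S hS] := ha.2.
have ge2 := size_roots_ge2 charK hF.1 P0 P2 q01 equation_vanishes param_independent ha.1 infinity
  hS ep0 ep1 cop.
have le2 := size_roots_le2 phi_inj n_gt0 hF.1 equation_neq0 (size_paramp a q0 q1)
  equation_generates ep0 ep1 fcu P2 germ_vanishes.
case: rs ep0 ep1 ge2 le2 {fcu} => [|t1 [|t2 [|]]] //= ep0 ep1 _ _.
by exists t1, t2, r0, r1.
Qed.

Variables (tau1 tau2 : K) (r0 r1 : {poly K}).
Local Notation rs := [:: tau1; tau2].
Local Notation W := (root_poly rs).
Hypothesis ep0 : p 0 = W * r0.
Hypothesis ep1 : p 1 = W * r1.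
Hypothesis cop : coprimep r0 r1.
Local Notation contact k := (contact phi rs k x y).
Local Notation ver t := (veronese n (aff t)).
Local Notation rnc := (@on_rnc K n).

Lemma fibre_root z : in_fibre a P z -> exists2 t, t \in rs & proj_eq (ver t) z.
Proof.
move=> [z0 [q qn0 qz] Pz]; have Pq : proj_eq P (param a q).
  apply: proj_eq_trans Pz _; apply: proj_eq_sym; have [b b0 ->] := qz.
  by rewrite proj_mapZ proj_map_veronese; exists b.
case: (aff_cover q01 qn0) => [q1q|[t tq]].
  by case: infinity; apply: proj_eq_trans Pq _; apply/proj_eq_sym/proj_eq_param.
exists t; last exact: proj_eq_trans (proj_eq_veronese n tq) qz.
have hf := f_neq0_at q01 ha.1 t.
have h : forall j, (p j).[t] = 0.
  apply/(tangent_root P0 (f := f) (or_intror hf)); rewrite -param_row.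
  by apply: proj_eq_trans Pq _; apply/proj_eq_sym/proj_eq_param.
apply: contraT => ht; have Wt : W.[t] != 0 by rewrite -/(root W t) root_prod_XsubC.
have rt j r : p j = W * r -> root r t.
  by move=> e; have /eqP := h j; rewrite e hornerM mulf_eq0 (negPf Wt).
by have := coprimep_root cop (rt _ _ ep0); rewrite -/(root r1 t) (rt _ _ ep1).
Qed.

Lemma root_fibre t : t \in rs -> in_fibre a P (ver t).
Proof.
move=> ht; split; first by apply: veronese_neq0; [apply: n_gt0|apply: aff_neq0].
  by exists (aff t); [apply: aff_neq0|apply: proj_eq_refl].
rewrite proj_map_veronese param_row.
exact: (row_tau_proj P0 ep0 ep1 (chart_unit ep0 ep1) ht).
Qed.

Lemma veronese_aff_inj t s : proj_eq (ver t) (ver s) -> t = s.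
Proof.
move=> h; have [|G _ [IG eG]] := pullback_of_point_ideal n_gt0 q01 (proj_eq_refl (ver t)) (u := 1).
  by rewrite size_poly1 n_gt0.
have := IG _ (veronese_neq0 n_gt0 (aff_neq0 q01 s)) h.
by rewrite -pullback_eval eG mulr1 hornerXsubC => /eqP; rewrite subr_eq0 => /eqP.
Qed.

Lemma finite_contact : exists k, ~ contact k.
Proof.
exists (n * n + 2)%N; apply: (not_contact phi_inj n_gt0 hF.1 equation_neq0 (size_paramp a q0 q1)
  equation_generates ep0 ep1 (chart_unit ep0 ep1) erefl).
by rewrite ltn_add2l.
Qed.

Lemma immersion : immersed phi rs x y.
Proof. exact: (immersed_branch phi_inj ep0 ep1 cop (chart_unit ep0 ep1)). Qed.

Lemma needs_blowups_contact m : (0 < m)%N ->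
  needs_blowups m (germ_at F P) <-> contact m /\ ~ contact m.+1.
Proof.
have sac k := smooth_after_contact phi_inj (isT : rs != [::]) erefl k immersion P2
  germ_vanishes finite_contact.
case: m => // m _; split=> [[/sac h1 h2]|[h1 h2]].
  by split=> //; apply: contrapT => h; apply: (h2 m) => //; apply/sac.
split; first exact/sac.
by move=> k km /sac; apply; apply: (contact_le phi_inj) h1.
Qed.

Definition projection : 3.-tuple {mpoly K[n.+1]} :=
  [tuple \sum_(j < n.+1) a u j *: 'X_j | u < 3].

Lemma pullback_projection (G : {mpoly K[3]}) : pb (G \mPo projection) = mmap polyC f G.
Proof.
rewrite mmap_comp; apply: mmap_ext => u; rewrite tnth_mktuple (rmorph_sum pb).
by apply: eq_bigr => j _; rewrite /= mmapZ mmapX mmap1U mul_polyC.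
Qed.

Lemma eval_at_projection (G : {mpoly K[3]}) z :
  eval_at (G \mPo projection) z = eval_at G (proj_map a z).
Proof.
rewrite /eval_at comp_mpoly_meval; apply: meval_eq => u; rewrite tnth_mktuple mxE.
rewrite (raddf_sum (meval _)); apply: eq_bigr => j _.
by rewrite /= mevalZ mevalXU.
Qed.

Lemma projection_homog d (G : {mpoly K[3]}) : G \is d.-homog -> G \mPo projection \is d.-homog.
Proof.
move=> /dhomogP hG; rewrite comp_mpolyEX big_seq; apply: rpred_sum => m hm.
apply: rpredZ; rewrite comp_mpolyX -(hG _ hm) /= mdegE.
apply: (big_ind2 (fun (M : {mpoly K[n.+1]}) e => M \is e.-homog)) => [|M e M' e'|u _].
- exact: dhomog1.
- exact: dhomogM.
apply: homogX; rewrite tnth_mktuple; apply: rpred_sum => j _; apply: rpredZ.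
by rewrite dhomogX; apply/eqP/mdeg1.
Qed.

Section Image.
Variables (I : {mpoly K[n.+1]} -> Prop) (Q : 'rV[K]_n.+1) (k : nat).
Hypothesis k_gt0 : (0 < k)%N.
Hypothesis I_dvd : forall M, saturation I M -> W ^+ k %| pb M.
Hypothesis dvd_I : forall d M, M \is d.-homog -> W ^+ k %| pb M -> I M.
Hypothesis I_mul : forall A M, I M -> I (A * M).
Hypothesis I_curve : forall M, vanishing_ideal rnc M -> I M.
Hypothesis PQ : proj_eq P (proj_map a Q).
Hypothesis I_vanish : forall M w, saturation I M -> proj_eq Q w -> eval_at M w = 0.

(** A form belongs to the saturation of [I] exactly when its pull-back is divisible by [W ^+ k]. The
    schemes $kQ_1\cup kQ_2$ and $2kQ$ share this property, so both parts of the theorem follow from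
    the one statement. *)
Lemma image_contact : curvilinear_on_curve a (scheme_image a I) k <-> contact k.
Proof.
have sat M : I M -> saturation I M by move=> h; exists 0%N => i; rewrite expr0 mul1r.
apply: (curvilinear_on_curve_contact phi_inj P0 ep0 ep1 cop (chart_unit ep0 ep1) k_gt0).
- by move=> G /I_dvd; rewrite -/projection pullback_projection.
- move=> d G hG; rewrite -pullback_projection => h.
  exact/sat/(dvd_I (projection_homog hG) h).
- move=> A G [N hN]; exists N => i; rewrite -/projection rmorphM mulrCA.
  exact: I_mul (hN i).
- move=> G hG; apply: sat; apply: I_curve => z z0 [q qn0 [b b0 ez]].
  rewrite -/projection eval_at_projection; apply: hG; rewrite ez proj_mapZ proj_map_veronese.
    by rewrite scaler_eq0 negb_or b0 ha.1.
  by exists q => //; exists b.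
move=> G w JG Pw; have [b b0 ew] := proj_eq_trans (proj_eq_sym PQ) Pw.
rewrite ew -proj_mapZ -eval_at_projection; apply: I_vanish JG _.
by exists b.
Qed.

End Image.

Lemma image_two_points s1 s2 Q1 Q2 k : (0 < k)%N -> s1 != s2 -> W = ('X - s1%:P) * ('X - s2%:P) ->
  proj_eq (ver s1) Q1 -> proj_eq (ver s2) Q2 -> in_fibre a P Q1 ->
  curvilinear_on_curve a
    (scheme_image a (ideal_cap (fat_point k Q1 rnc) (fat_point k Q2 rnc))) k <-> contact k.
Proof.
move=> k0 s12 eW sQ1 sQ2 [_ _ PQ1].
have dvdW M : W ^+ k %| M = (('X - s1%:P) ^+ k %| M) && (('X - s2%:P) ^+ k %| M).
  rewrite eW exprMn Gauss_dvdp // coprimep_expl // coprimep_expr // coprimep_XsubC.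
  by rewrite root_XsubC eq_sym.
apply: (image_contact (Q := Q1)) => //.
- move=> M [N hN]; rewrite dvdW.
  have dvd s Q (sQ : proj_eq (ver s) Q) :
      (forall i, fat_point k Q rnc ('X_i ^+ N * M)) -> ('X - s%:P) ^+ k %| pb M.
    move=> h; apply: (saturation_pullback_dvd n_gt0 q01 (I := fat_point k Q rnc)).
      by move=> M'; apply: (fat_point_dvd n_gt0 q01 sQ).
    by exists N.
  by rewrite (dvd s1 Q1) ?(dvd s2 Q2) // => i; case: (hN i).
- move=> d M hM; rewrite dvdW => /andP[h1 h2].
  by split; [apply: (fat_point_of_dvd n_gt0 q01 sQ1 hM h1)|
             apply: (fat_point_of_dvd n_gt0 q01 sQ2 hM h2)].
- by move=> A M [h1 h2]; split; apply: fat_pointM.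
- by move=> M h; split; apply: fat_point_of_vanishing.
move=> M w [N hN]; apply: (saturation_vanish n_gt0 q01 sQ1 (I := fat_point k Q1 rnc)).
  by move=> M' w' h; apply: (fat_point_vanish n_gt0 q01 sQ1 k0 h).
by exists N => i; case: (hN i).
Qed.

Lemma image_one_point s Q k : (0 < k)%N -> W = ('X - s%:P) ^+ 2 ->
  proj_eq (ver s) Q -> in_fibre a P Q ->
  curvilinear_on_curve a (scheme_image a (fat_point (2 * k) Q rnc)) k <-> contact k.
Proof.
move=> k0 eW sQ [_ _ PQ].
have k20 : (0 < 2 * k)%N by rewrite muln_gt0.
have eWk : W ^+ k = ('X - s%:P) ^+ (2 * k) by rewrite eW -exprM.
apply: (image_contact (Q := Q)) => //.
- move=> M hM; rewrite eWk; apply: (saturation_pullback_dvd n_gt0 q01) hM.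
  by move=> M'; apply: (fat_point_dvd n_gt0 q01 sQ).
- by move=> d M hM; rewrite eWk; apply: (fat_point_of_dvd n_gt0 q01 sQ hM).
- by move=> A M; apply: fat_pointM.
- by move=> M; apply: fat_point_of_vanishing.
move=> M w; apply: (saturation_vanish n_gt0 q01 sQ).
by move=> M' w' h; apply: (fat_point_vanish n_gt0 q01 sQ k20 h).
Qed.

(** Contact passes to smaller orders, so maximality of [m] amounts to failure at [m.+1]. For [k = 0]
    the bound [k <= m] is trivial, so the comparison with contact is asked for positive [k]. *)
Lemma maximal_contact m (ok : nat -> Prop) : (0 < m)%N ->
  (forall k, (0 < k)%N -> ok k <-> contact k) ->
  (ok m /\ forall k, ok k -> (k <= m)%N) <-> (contact m /\ ~ contact m.+1).
Proof.
move=> m0 h; split=> [[/h -/(_ m0) h1 h2]|[h1 h2]].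
  by split=> // /(h m.+1 isT)/h2; rewrite ltnn.
split=> [|k hk]; first exact/h.
have [//|mk] := leqP k m; case: h2.
by apply: (contact_le phi_inj mk); apply/h => //; apply: leq_trans mk.
Qed.

Lemma two_branches_iff : has_branches 2 (germ_at F P) <-> tau1 != tau2.
Proof.
split=> [h|]; last exact: (branches_neq phi_inj immersion finite_contact P2 germ_vanishes).
apply/eqP => /(branches_eq phi_inj immersion finite_contact P2 germ_vanishes).
by move=> /has_branchesE/s_branches_uniq; apply; apply/has_branchesE.
Qed.

Lemma one_branch_iff : has_branches 1 (germ_at F P) <-> tau1 = tau2.
Proof.
split=> [h|]; last exact: (branches_eq phi_inj immersion finite_contact P2 germ_vanishes).
apply/eqP; apply: contraT.
move=> /(branches_neq phi_inj immersion finite_contact P2 germ_vanishes)/has_branchesE.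
by move: h => /has_branchesE/s_branches_uniq.
Qed.

Lemma sing_A_oddP m : (0 < m)%N -> sing_A_odd F P m <->
  exists Q1 Q2 : 'rV[K]_(n.+1),
    let image_ok k := curvilinear_on_curve a
      (scheme_image a (ideal_cap (fat_point k Q1 rnc) (fat_point k Q2 rnc))) k in
    [/\ [/\ in_fibre a P Q1, in_fibre a P Q2, ~ proj_eq Q1 Q2 &
            forall z, in_fibre a P z -> proj_eq Q1 z \/ proj_eq Q2 z],
        image_ok m & forall k : nat, image_ok k -> (k <= m)%N].
Proof.
move=> m0.
have W2 : W = ('X - tau1%:P) * ('X - tau2%:P) by rewrite /root_poly !big_cons big_nil mulr1.
have [in1 in2] : tau1 \in rs /\ tau2 \in rs by rewrite !inE !eqxx orbT.
split=> [[_ /two_branches_iff t12 /(needs_blowups_contact m0) hc]|].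
  exists (ver tau1), (ver tau2).
  have fib1 := root_fibre in1; have fib2 := root_fibre in2.
  have [h1 h2] := (maximal_contact (m := m) m0 (fun k k0 =>
    image_two_points k0 t12 W2 (proj_eq_refl _) (proj_eq_refl _) fib1)).2 hc.
  split=> //; split=> //; first by move/veronese_aff_inj/eqP; rewrite (negPf t12).
  by move=> z /fibre_root[t]; rewrite !inE => /orP[/eqP->|/eqP->]; [left|right].
move=> [Q1 [Q2 /= [[fib1 fib2 Q12 _] h1 h2]]].
have [s1 s1in sQ1] := fibre_root fib1; have [s2 s2in sQ2] := fibre_root fib2.
have s12 : s1 != s2.
  apply/eqP => e; apply: Q12; apply: proj_eq_trans (proj_eq_sym sQ1) _; by rewrite e.
have [t12 eW] : tau1 != tau2 /\ W = ('X - s1%:P) * ('X - s2%:P).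
  move: s1in s2in s12; rewrite !inE => /orP[] /eqP-> /orP[] /eqP->; rewrite ?eqxx //.
  by rewrite eq_sym W2 mulrC.
split=> //; first exact/two_branches_iff.
apply/(needs_blowups_contact m0); apply/(maximal_contact m0).
  by move=> k k0; apply: (image_two_points k0 s12 eW sQ1 sQ2 fib1).
by split.
Qed.

Lemma sing_A_evenP m : (0 < m)%N -> sing_A_even F P m <->
  exists Q : 'rV[K]_(n.+1),
    let image_ok k := curvilinear_on_curve a (scheme_image a (fat_point (2 * k) Q rnc)) k in
    [/\ in_fibre a P Q /\ (forall z, in_fibre a P z -> proj_eq Q z),
        image_ok m & forall k : nat, image_ok k -> (k <= m)%N].
Proof.
move=> m0.
have W2 : W = ('X - tau1%:P) * ('X - tau2%:P) by rewrite /root_poly !big_cons big_nil mulr1.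
have [in1 in2] : tau1 \in rs /\ tau2 \in rs by rewrite !inE !eqxx orbT.
have fib1 := root_fibre in1; have fib2 := root_fibre in2.
split=> [[_ /one_branch_iff t12 /(needs_blowups_contact m0) hc]|].
  have eW : W = ('X - tau1%:P) ^+ 2 by rewrite W2 -t12.
  exists (ver tau1).
  have [h1 h2] := (maximal_contact (m := m) m0 (fun k k0 =>
    image_one_point k0 eW (proj_eq_refl _) fib1)).2 hc.
  split=> //; split=> // z /fibre_root[t]; rewrite !inE -t12 orbb => /eqP -> //.
move=> [Q /= [[fibQ Q12] h1 h2]].
have t12 : tau1 = tau2.
  by apply: veronese_aff_inj; apply: proj_eq_trans (proj_eq_sym (Q12 _ fib1)) (Q12 _ fib2).
have eW : W = ('X - tau1%:P) ^+ 2 by rewrite W2 -t12.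
split=> //; first exact/one_branch_iff.
apply/(needs_blowups_contact m0); apply/(maximal_contact m0).
  by move=> k k0; apply: (image_one_point k0 eW (proj_eq_sym (Q12 _ fib1)) fibQ).
by split.
Qed.

End Affine.
End Setup.

Unset Implicit Arguments.

Theorem theorem4p3 (K : closedFieldType) (charK : [pchar K] =i pred0)
    (n : nat) (hn : (3 <= n)%N) (a : 'M[K]_(3, n.+1)) (ha : proper_param a)
    (F : {mpoly K[3]}) (hF : curve_equation a F)
    (P : 'rV[K]_3) (P0 : P != 0) (PC : on_curve a P) (P2 : double_point F P)
    (m : nat) (hm : (1 <= m)%N) :
  (sing_A_odd F P m <->
    exists Q1 Q2 : 'rV[K]_(n.+1),
      let image_ok (k : nat) :=
        curvilinear_on_curve a
          (scheme_image a (ideal_cap (fat_point k Q1 (@on_rnc K n))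
                                     (fat_point k Q2 (@on_rnc K n)))) k in
      [/\ [/\ in_fibre a P Q1, in_fibre a P Q2, ~ proj_eq Q1 Q2 &
              forall z, in_fibre a P z -> proj_eq Q1 z \/ proj_eq Q2 z],
          image_ok m &
          forall k : nat, image_ok k -> (k <= m)%N])
  /\
  (sing_A_even F P m <->
    exists Q : 'rV[K]_(n.+1),
      let image_ok (k : nat) :=
        curvilinear_on_curve a
          (scheme_image a (fat_point (2 * k) Q (@on_rnc K n))) k in
      [/\ in_fibre a P Q /\ (forall z, in_fibre a P z -> proj_eq Q z),
          image_ok m &
          forall k : nat, image_ok k -> (k <= m)%N]).
Proof.
(* The field [L] is taken to be the field of rational functions in the parameter. *)
have phi_inj : injective (@tofrac {poly K}) by move=> p q /eqP; rewrite tofrac_eq => /eqP.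
have [q1 q1n0 infinity] := exists_infinity hn hF P0.
have [q0 q01] := exists_complement q1n0.
have [tau1 [tau2 [r0 [r1 [ep0 ep1 cop]]]]] :=
  two_roots phi_inj charK hn ha hF P0 P2 q01 infinity.
split.
  exact: (sing_A_oddP phi_inj hn ha hF P0 P2 q01 infinity ep0 ep1 cop hm).
exact: (sing_A_evenP phi_inj hn ha hF P0 P2 q01 infinity ep0 ep1 cop hm).
Qed.
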